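(* Take $\mathbf a$, $\mathbf b$ and $\mathbf c$ to be three independent $n$-sided dice with i.i.d. faces. Assume that the distribution of a single face has density (PDF) $f$ and CDF $F$, mean zero and variance one. Let $\mathcal E_0$ denote the event that the face-sums of $\mathbf a$, $\mathbf b$ and $\mathbf c$ are all zero. Additionally, assume that the distribution of a single face: (i) has enough (say, six) finite moments; (ii) has PDF $f$ supported on a (possibly infinite) closed interval $\mathrm{supp}(f)$, and $f$ is continuous on $\mathrm{supp}(f)$; (iii) is not uniform on $[-\sqrt3,\sqrt3]$. Then: 1. Conditional on $\mathcal E_0$, with probability tending to one as $n\to\infty$, $$\mathbf a\text{ beats }\mathbf b\quad\text{if and only if}\quad \sum_{i=1}^n F(a_i)>\sum_{i=1}^n F(b_i).$$ 2. As $n\to\infty$, $\Pr[\mathbf a,\mathbf b,\mathbf c\text{ are transitive}\mid\mathcal E_0]\to1$.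
   Context: An $n$-sided die is a vector $\mathbf a=(a_1,\dots,a_n)$ of real numbers; its face-sum is $\sum_{i=1}^n a_i$. Die $\mathbf a$ beats die $\mathbf b$ if $\sum_{i,j=1}^n\big(\mathbb 1[a_i>b_j]-\mathbb 1[a_i<b_j]\big)>0$. A set of dice is transitive if it forms a linear ordering under the ''beats'' relation. The single-face distribution (with PDF $f$ and CDF $F$) is fixed and does not depend on $n$. Conditioning on the null event $\mathcal E_0$ is understood in the sense of conditional densities.
   Formalization: It is additionally assumed that for some number of faces the face-sum has a bounded density (automatic when f is bounded); otherwise f may have ever taller, thinner spikes towards infinity, making the face-sum density at 0 infinite for all even n and conditioning on E_0 undefined. *)

(* Defs.v *)
From HB Require Import structures.
From mathcomp Require Import all_boot all_order all_algebra.
From mathcomp Require Import all_classical all_reals all_analysis.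

Set Implicit Arguments.
Unset Strict Implicit.
Unset Printing Implicit Defensive.

Import Order.TTheory GRing.Theory Num.Theory.
Import numFieldNormedType.Exports.

Local Open Scope classical_set_scope.
Local Open Scope ring_scope.

(* An n-sided die is a vector of n real numbers. *)
Definition die (R : realType) (n : nat) := n.-tuple R.

Section dice.
Context {R : realType}.

Definition face_sum n (a : die R n) : R := \sum_(i < n) tnth a i.

Definition beats n (a b : die R n) : Prop :=
  0 < \sum_(i < n) \sum_(j < n)
        ((tnth b j < tnth a i)%R%:Z - (tnth a i < tnth b j)%R%:Z).

Definition transitive_dice n (S : set (die R n)) : Prop :=
  [/\ forall a, S a -> ~ beats a a,
      forall a b c, S a -> S b -> S c -> beats a b -> beats b c -> beats a c
    & forall a b, S a -> S b -> a <> b -> beats a b \/ beats b a].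

(* Iterated integral over R^m with respect to Lebesgue measure; by Tonelli it
   is the integral over R^m for nonnegative Borel integrands, the only ones
   used below. *)
Fixpoint tuple_integral (m : nat) : (m.-tuple R -> \bar R) -> \bar R :=
  match m with
  | 0 => fun g => g [tuple]
  | m'.+1 => fun g =>
      (\int[lebesgue_measure]_(x in [set: R])
         tuple_integral (fun v : m'.-tuple R => g [tuple of x :: v]))%E
  end.

(* The (m+1)-sided die with face-sum s whose first m faces are v. The map
   (v, s) |-> die_of v s is a linear bijection of determinant 1, so the
   density of a die at die_of v s is the joint density of its first m faces
   and its face-sum at (v, s). *)
Definition die_of m (v : m.-tuple R) (s : R) : die R m.+1 :=
  [tuple of rcons v (s - \sum_(i < m) tnth v i)].

Lemma face_sum_die_of m (v : m.-tuple R) (s : R) : face_sum (die_of v s) = s.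
Proof.
rewrite /face_sum big_ord_recr/=.
have E (i : 'I_m) : tnth (die_of v s) (widen_ord (leqnSn m) i) = tnth v i.
  by rewrite !(tnth_nth 0)/= nth_rcons size_tuple ltn_ord.
under eq_bigr do rewrite E.
rewrite (tnth_nth 0)/= nth_rcons size_tuple ltnn eqxx.
by rewrite addrC subrK.
Qed.

Variable f : R -> R.

Definition die_density n (a : die R n) : R := \prod_(i < n) f (tnth a i).

Definition face_sum_density m (s : R) : \bar R :=
  tuple_integral (fun v : m.-tuple R => (die_density (die_of v s))%:E).

(* Three independent dice: the joint density is the product. *)
Definition dice_density n (a b c : die R n) : R :=
  die_density a * die_density b * die_density c.

(* Integral over the dice a, b, c having face-sum 0, parametrized by all their
   faces but the last. *)
Definition integral_E0 m (g : die R m.+1 -> die R m.+1 -> die R m.+1 -> R) :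
    \bar R :=
  tuple_integral (fun u : m.-tuple R =>
  tuple_integral (fun v : m.-tuple R =>
  tuple_integral (fun w : m.-tuple R =>
    (g (die_of u 0) (die_of v 0) (die_of w 0))%:E))).

(* Pr[(a, b, c) \in A | E_0] for (m+1)-sided dice: the integral over A of the
   conditional density of the faces given that the three face-sums are 0, i.e.
   of the joint density of the faces and the face-sums divided by the joint
   density of the face-sums at (0, 0, 0). *)
Definition Pr_E0 m (A : die R m.+1 -> die R m.+1 -> die R m.+1 -> Prop) : R :=
  fine (integral_E0 (fun a b c => (`[< A a b c >])%:R * dice_density a b c))
  / fine (integral_E0 (@dice_density m.+1)).

Definition supp : set R := closure [set x | f x != 0].

End dice.

Definition has_density d (T : measurableType d) (R : realType)
    (P : probability T R) (X : {RV P >-> R}) (f : R -> R) : Prop :=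
  [/\ measurable_fun [set: R] f,
      forall x, 0 <= f x
    & forall A : set R, measurable A ->
        distribution P X A = (\int[lebesgue_measure]_(x in A) (f x)%:E)%E].

(* Conditioning on a face-sum being exactly 0 uses the value at a point of the
   density of the face-sum, so that density must be more than an almost
   everywhere defined function: we ask that it be bounded for some number of
   faces (by convolution it is then bounded for all larger numbers, and
   continuous from twice that number on). This holds whenever f is bounded. It
   can only fail for f unbounded near an infinite endpoint of its support, in
   which case the density of the face-sum at 0 may be infinite for infinitely
   many n. *)
Definition face_sum_density_bounded (R : realType) (f : R -> R) : Prop :=
  exists m (M : R), forall s, (face_sum_density f m s <= M%:E)%E.

Lemma bounded_face_sum_density_bounded (R : realType) (f : R -> R) (M : R) :
  (forall x, f x <= M) -> face_sum_density_bounded f.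
Proof.
move=> fM; exists 0%N, M => s.
by rewrite /face_sum_density/= /die_density big_ord1 lee_fin.
Qed.

Lemma sqrt3_itv (R : realType) : - Num.sqrt 3 < Num.sqrt 3 :> R.
Proof. by rewrite gt0_cp// sqrtr_gt0 ltr0n. Qed.

(* Main.v *)
(** Write U(a) for the sum of the F(a_i) and
    r(x, y) = 1[y < x] - 1[x < y] - 2 F(x) + 2 F(y), so that the sum deciding
    whether a beats b is 2 n (U(a) - U(b)) plus the sum of the r(a_i, b_j).
    The function r has mean zero in each variable separately, so the sum of
    the r(a_i, b_j), having uncorrelated terms, is O(n) in mean square,
    whereas U(a) - U(b) exceeds any constant with probability tending to one.
    Both facts are needed given zero face-sums; they follow without local
    limit theorems.

    Anti-concentration. Near a point where f >= c > 0, f is the mixture of a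
    remainder and of two copies of a small bump, 2 h apart. When a face falls
    in one of the bumps, a fair coin chooses which one; given everything but
    the coins, Littlewood-Offord (in the form of the Lubell-Yamamoto-Meshalkin
    inequality) bounds the density of a sum of n faces by O(1/sqrt n). Since
    f is not uniform, it takes two different positive values at interior
    points x0 and y0; shifting one face by 2 h near x0 and another by -2 h near
    y0 leaves the face-sum unchanged and moves U by a definite amount, so the
    same argument on pairs of faces bounds the density of the event
    {face-sum 0, U within K of a given value} by O(1/n).

    The density of the face-sum at 0 is at least of order 1/sqrt n: by
    Chebyshev the sum of the coin-free parts is O(sqrt n), and central binomial
    coefficients bound below the probability that the coins compensate it.

    Second moment. Split the faces in two blocks of comparable size. Given the
    faces of one block, the density of the sum of the other one is O(1/sqrt n),
    that is O(1) times the density of the face-sum at 0. Hence, up to a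
    constant, conditioning does not increase the mean square of the part of a
    sum coming from a single block. *)

Require Import Defs.
From HB Require Import structures.
From mathcomp Require Import all_boot all_order all_algebra.
From mathcomp Require Import all_classical all_reals all_analysis.
From mathcomp Require Import measurable_realfun.
From mathcomp Require Import ring lra zify.

Set Implicit Arguments.
Unset Strict Implicit.
Unset Printing Implicit Defensive.

Import Order.TTheory GRing.Theory Num.Theory.
Import numFieldNormedType.Exports.

Local Open Scope classical_set_scope.
Local Open Scope ring_scope.

(** * Integrals of nonnegative measurable functions *)

Section nnm.
Context d (T : measurableType d) (R : realType).

Definition nnm (g : T -> \bar R) : Prop :=
  measurable_fun [set: T] g /\ forall x, (0 <= g x)%E.

Lemma nnmD g h : nnm g -> nnm h -> nnm (fun x => g x + h x)%E.
Proof.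
move=> [mg g0] [mh h0]; split; first exact: emeasurable_funD.
by move=> x; rewrite adde_ge0.
Qed.

Lemma nnmM g h : nnm g -> nnm h -> nnm (fun x => g x * h x)%E.
Proof.
move=> [mg g0] [mh h0]; split; first exact: emeasurable_funM.
by move=> x; rewrite mule_ge0.
Qed.

Lemma nnm_cst (c : \bar R) : (0 <= c)%E -> nnm (cst c).
Proof. by move=> c0; split. Qed.

Lemma nnm_EFin (g : T -> R) : measurable_fun setT g -> (forall x, 0 <= g x) ->
  nnm (fun x => (g x)%:E).
Proof.
move=> mg g0; split; first exact/measurable_EFinP.
by move=> x; rewrite lee_fin.
Qed.

Lemma nnm_indic (A : T -> bool) : measurable_fun setT A ->
  nnm (fun x => ((A x)%:R : R)%:E).
Proof.
move=> mA; split=> [|x]; last by rewrite lee_fin.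
apply/measurable_EFinP; rewrite (_ : (fun x => _) = \1_[set x | A x]).
  by apply: measurable_indic; rewrite -[X in measurable X]setTI; exact: mA.
by apply/funext => x; rewrite indicE mem_setE.
Qed.

Variable mu : {measure set T -> \bar R}.

Lemma int_ge0 (g : T -> \bar R) : (forall x, 0 <= g x)%E ->
  (0 <= \int[mu]_x g x)%E.
Proof. by move=> g0; exact: integral_ge0. Qed.

(* The integral of a nonnegative function is a supremum over the simple
   functions below it, so no measurability is needed. *)
Lemma int_le (g h : T -> \bar R) : (forall x, 0 <= g x)%E ->
  (forall x, g x <= h x)%E -> (\int[mu]_x g x <= \int[mu]_x h x)%E.
Proof.
move=> g0 gh; have h0 x : (0 <= h x)%E by exact: le_trans (gh x).
rewrite !ge0_integralTE//; apply: ub_ereal_sup => _ [s sg <-].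
by apply: ereal_sup_ubound; exists s => // x; exact: le_trans (sg x) (gh x).
Qed.

Lemma intD g h : nnm g -> nnm h ->
  (\int[mu]_x (g x + h x) = \int[mu]_x g x + \int[mu]_x h x)%E.
Proof. by move=> [mg g0] [mh h0]; rewrite ge0_integralD. Qed.

Lemma intZ k g : 0 <= k -> nnm g ->
  (\int[mu]_x (k%:E * g x) = k%:E * \int[mu]_x g x)%E.
Proof. by move=> k0 [mg g0]; rewrite ge0_integralZl_EFin. Qed.

Lemma intZr k g : 0 <= k -> nnm g ->
  (\int[mu]_x (g x * k%:E) = \int[mu]_x g x * k%:E)%E.
Proof.
move=> k0 ng; rewrite muleC -intZ//.
by apply: eq_integral => x _; rewrite muleC.
Qed.

Lemma int_eq (g h : T -> \bar R) : g =1 h -> (\int[mu]_x g x = \int[mu]_x h x)%E.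
Proof. by move=> gh; apply: eq_integral. Qed.

End nnm.

Lemma nnm_comp d1 d2 (T1 : measurableType d1) (T2 : measurableType d2)
    (R : realType) (g : T2 -> \bar R) (h : T1 -> T2) :
  measurable_fun setT h -> nnm g -> nnm (fun x => g (h x)).
Proof. by move=> mh [mg g0]; split=> //; exact: measurableT_comp mg mh. Qed.

Section nnm_param.
Context d1 d2 (T1 : measurableType d1) (T2 : measurableType d2) (R : realType).
Variables (m1 : {sigma_finite_measure set T1 -> \bar R})
  (m2 : {sigma_finite_measure set T2 -> \bar R}).

Lemma nnm_int (g : T1 -> T2 -> \bar R) : nnm (fun p : T1 * T2 => g p.1 p.2) ->
  nnm (fun x => \int[m2]_y g x y)%E.
Proof.
move=> [mg g0]; split; first exact: (measurable_fun_fubini_tonelli_F _ mg g0).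
by move=> x; apply: int_ge0 => y; exact: (g0 (x, y)).
Qed.

Lemma int_exchange (g : T1 -> T2 -> \bar R) :
    nnm (fun p : T1 * T2 => g p.1 p.2) ->
  (\int[m1]_x \int[m2]_y g x y = \int[m2]_y \int[m1]_x g x y)%E.
Proof. by move=> [mg g0]; exact: (fubini_tonelli _ mg g0). Qed.

End nnm_param.

Section step.
Context {R : realType}.
Local Notation Z := (R * R)%type.
Implicit Types (Psi Phi : Z -> \bar R) (z c : Z).
Local Open Scope ereal_scope.

Lemma measurable_addZ d (T : measurableType d) (g h : T -> Z) :
  measurable_fun setT g -> measurable_fun setT h ->
  measurable_fun setT (fun x => (g x + h x)%R).
Proof.
move=> mg mh.
have m1 (k : T -> Z) : measurable_fun setT k ->
    measurable_fun setT (fun x => (k x).1).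
  exact: (measurableT_comp measurable_fst).
have m2 (k : T -> Z) : measurable_fun setT k ->
    measurable_fun setT (fun x => (k x).2).
  exact: (measurableT_comp measurable_snd).
rewrite (_ : (fun x => _) = fun x =>
  ((g x).1 + (h x).1, (g x).2 + (h x).2)%R) //.
apply: measurable_fun_pair.
- by apply: measurable_funD; exact: m1.
- by apply: measurable_funD; exact: m2.
Qed.

Lemma nnm_shift Psi c : nnm Psi -> nnm (fun z => Psi (z + c)%R).
Proof. by apply: nnm_comp; exact: measurable_addZ. Qed.

Section one_step.
Context d (T : measurableType d) (mu : {sigma_finite_measure set T -> \bar R}).
Implicit Types (w : T -> R) (th : T -> Z).

(* The state z accumulates a pair of sums; iterating [step] integrates a function
   of the final state over independent contributions. *)
Definition step w th Psi z := \int[mu]_o ((w o)%:E * Psi (z + th o)%R).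

Variables (w : T -> R) (th : T -> Z).
Hypotheses (mw : measurable_fun setT w) (w0 : forall o, (0 <= w o)%R).
Hypothesis mth : measurable_fun setT th.

Lemma nnm_step_integrand Psi : nnm Psi ->
  nnm (fun p : Z * T => (w p.2)%:E * Psi (p.1 + th p.2)%R).
Proof.
move=> nP; apply: nnmM.
  by apply: nnm_EFin => //; exact: (measurableT_comp mw measurable_snd).
apply: nnm_comp nP => //; apply: measurable_addZ => //.
exact: (measurableT_comp mth measurable_snd).
Qed.

Lemma nnm_step_section Psi z : nnm Psi ->
  nnm (fun o => (w o)%:E * Psi (z + th o)%R).
Proof.
move=> /nnm_step_integrand; apply: (nnm_comp (h := fun o => (z, o))).
exact: measurable_fun_pair.
Qed.

Lemma nnm_step Psi : nnm Psi -> nnm (step w th Psi).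
Proof. by move=> nP; apply: nnm_int; exact: nnm_step_integrand. Qed.

Lemma step_le Psi Phi z : (forall z, 0 <= Psi z) -> (forall z, Psi z <= Phi z) ->
  step w th Psi z <= step w th Phi z.
Proof.
move=> P0 PP; apply: int_le => o; first by rewrite mule_ge0// lee_fin.
by apply: lee_wpmul2l; rewrite ?lee_fin.
Qed.

Lemma stepD Psi Phi z : nnm Psi -> nnm Phi ->
  step w th (fun z => Psi z + Phi z) z = step w th Psi z + step w th Phi z.
Proof.
move=> nP nQ; rewrite /step -intD; [|exact: nnm_step_section..].
by apply: int_eq => o; rewrite ge0_muleDr//; [case: nP|case: nQ].
Qed.

Lemma stepZ k Psi z : (0 <= k)%R -> nnm Psi ->
  step w th (fun z => k%:E * Psi z) z = k%:E * step w th Psi z.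
Proof.
move=> k0 nP; rewrite /step -intZ//; last exact: nnm_step_section.
by apply: int_eq => o; rewrite muleCA.
Qed.

Lemma step_shift Psi c z :
  step w th (fun z => Psi (z + c)%R) z = step w th Psi (z + c)%R.
Proof. by apply: int_eq => o; rewrite addrAC. Qed.

End one_step.

(* The coins: the second coordinate of the state is increased by the sum of a
   uniformly random subsequence of ds. *)
Fixpoint avg (ds : seq R) Psi z : \bar R :=
  if ds is dl :: ds' then
    (2^-1)%:E * (avg ds' Psi z + avg ds' Psi (z + (0%R, dl))%R)
  else Psi z.

Lemma nnm_avg ds Psi : nnm Psi -> nnm (avg ds Psi).
Proof.
move=> nP; elim: ds => [|dl ds IH]//=; apply: nnmM.
  by apply: nnm_cst; rewrite lee_fin invr_ge0.
by apply: nnmD => //; exact: nnm_shift.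
Qed.

Lemma avg_ge0 ds Psi z : (forall z, 0 <= Psi z) -> 0 <= avg ds Psi z.
Proof.
move=> P0; elim: ds z => [|dl ds IH] z//=.
by apply: mule_ge0; rewrite ?lee_fin ?invr_ge0// adde_ge0.
Qed.

Lemma avg_le ds Psi Phi z : (forall z, Psi z <= Phi z) ->
  avg ds Psi z <= avg ds Phi z.
Proof.
move=> P0; elim: ds z => [|dl ds IH] z//=.
by apply: lee_wpmul2l; rewrite ?lee_fin ?invr_ge0// leeD.
Qed.

Lemma avgD ds Psi Phi z : (forall z, 0 <= Psi z) -> (forall z, 0 <= Phi z) ->
  avg ds (fun z => Psi z + Phi z) z = avg ds Psi z + avg ds Phi z.
Proof.
move=> P0 Q0; elim: ds z => [|dl ds IH] z//=.
rewrite !IH -ge0_muleDr ?adde_ge0 ?avg_ge0//; congr (_ * _).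
by rewrite addeACA.
Qed.

Lemma avg_step d (T : measurableType d)
    (mu : {sigma_finite_measure set T -> \bar R}) (w : T -> R) (th : T -> Z)
    ds Psi z :
    measurable_fun setT w -> (forall o, (0 <= w o)%R) ->
    measurable_fun setT th -> nnm Psi ->
  avg ds (step mu w th Psi) z = step mu w th (avg ds Psi) z.
Proof.
move=> mw w0 mth nP; elim: ds z => [|dl ds IH] z//=.
rewrite !IH stepZ ?invr_ge0//; last first.
  by apply: nnmD; [|apply: nnm_shift]; exact: nnm_avg.
rewrite stepD//; [|exact: nnm_avg|exact/nnm_shift/nnm_avg].
by rewrite step_shift.
Qed.

Lemma step_exchange d1 d2 (T1 : measurableType d1) (T2 : measurableType d2)
    (m1 : {sigma_finite_measure set T1 -> \bar R})
    (m2 : {sigma_finite_measure set T2 -> \bar R})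
    (w1 : T1 -> R) (th1 : T1 -> Z) (w2 : T2 -> R) (th2 : T2 -> Z) Psi z :
    measurable_fun setT w1 -> (forall o, (0 <= w1 o)%R) ->
    measurable_fun setT th1 ->
    measurable_fun setT w2 -> (forall o, (0 <= w2 o)%R) ->
    measurable_fun setT th2 -> nnm Psi ->
  step m1 w1 th1 (step m2 w2 th2 Psi) z = step m2 w2 th2 (step m1 w1 th1 Psi) z.
Proof.
move=> mw1 w10 mth1 mw2 w20 mth2 nP.
pose k o1 o2 := (w1 o1)%:E * ((w2 o2)%:E * Psi (z + th1 o1 + th2 o2)%R).
have nk : nnm (fun p => k p.1 p.2).
  apply: nnmM; first by apply: nnm_EFin => //; exact: (measurableT_comp mw1 measurable_fst).
  apply: nnmM; first by apply: nnm_EFin => //; exact: (measurableT_comp mw2 measurable_snd).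
  apply: nnm_comp nP; apply: measurable_addZ.
    by apply: measurable_addZ => //; exact: (measurableT_comp mth1 measurable_fst).
  exact: (measurableT_comp mth2 measurable_snd).
transitivity (\int[m1]_o1 \int[m2]_o2 k o1 o2).
  apply: int_eq => o1; rewrite /step -intZ//.
  exact: (nnm_step_section mw2 w20 mth2).
rewrite (int_exchange _ _ nk); apply: int_eq => o2; rewrite /step -intZ//.
  by apply: int_eq => o1; rewrite /k muleCA addrAC.
exact: (nnm_step_section mw1 w10 mth1).
Qed.

End step.

(** * Binomial coefficients and Littlewood-Offord *)

Section binomial_bounds.

Lemma leq_bin_half k l : ('C(k, l) <= 'C(k, k./2))%N.
Proof.
have up m : (m <= k./2)%N -> ('C(k, m) <= 'C(k, k./2))%N.
  move=> mk; have -> : m = (k./2 - (k./2 - m))%N by lia.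
  elim: (k./2 - m)%N => [|t IH]; first by rewrite subn0.
  have [tk|tk] := leqP k./2 t.
    by have -> : (k./2 - t.+1 = k./2 - t)%N by lia.
  apply: leq_trans IH; have -> : (k./2 - t = (k./2 - t.+1).+1)%N by lia.
  set i := (k./2 - t.+1)%N.
  have := mul_bin_left k i => E.
  rewrite -(leq_pmul2l (ltn0Sn i)) E leq_mul2r; apply/orP; right.
  by rewrite /i; lia.
have [lk|kl] := leqP l k; last by rewrite bin_small.
have [lh|lh] := leqP l k./2; first exact: up.
by rewrite -bin_sub//; apply: up; lia.
Qed.

Lemma bin_doubleS m : (m.+1 * 'C(m.+1.*2, m.+1) = 2 * (m.*2.+1 * 'C(m.*2, m)))%N.
Proof.
have E1 := mul_bin_diag (m.*2.+1) m.
have E2 := mul_bin_left (m.*2.+1) m.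
have E3 := mul_bin_diag (m.*2) m.
rewrite doubleS.
have E4 := mul_bin_diag (m.*2.+2) m; rewrite /= in E4.
have E5 := mul_bin_down (m.*2.+1) m.
have e : (m.*2.+1 - m = m.+1)%N by lia.
rewrite e /= in E5.
nia.
Qed.

Lemma bin_double_ub m : ('C(m.*2, m) ^ 2 * m.*2.+1 <= 16 ^ m)%N.
Proof.
elim: m => [|m IH]//.
have E := bin_doubleS m.
rewrite -(@leq_pmul2l (m.+1 ^ 2)) ?expn_gt0//.
rewrite mulnA -expnMn E.
have -> : ((2 * (m.*2.+1 * 'C(m.*2, m))) ^ 2 * m.+1.*2.+1 =
  ('C(m.*2, m) ^ 2 * m.*2.+1) * (4 * m.*2.+1 * m.+1.*2.+1))%N.
  by rewrite !expnMn; ring.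
rewrite (expnS 16) (_ : _ * (16 * _) = 16 ^ m * (16 * m.+1 ^ 2))%N; last by ring.
by apply: leq_mul => //; rewrite -mulnn; nia.
Qed.

Lemma bin_double_lb m : (0 < m)%N -> (16 ^ m <= 'C(m.*2, m) ^ 2 * (4 * m))%N.
Proof.
elim: m => [|m IH]// _; have [->//|m0] := posnP m.
have {}IH := IH m0; have E := bin_doubleS m.
rewrite -(@leq_pmul2l (m.+1 ^ 2)) ?expn_gt0//.
rewrite mulnA -expnMn E.
have -> : ((2 * (m.*2.+1 * 'C(m.*2, m))) ^ 2 * (4 * m.+1) =
  'C(m.*2, m) ^ 2 * (16 * (m.*2.+1) ^ 2 * m.+1))%N.
  by rewrite !expnMn; ring.
rewrite -(leq_pmul2l m0) (expnS 16).
have -> : (m * (m.+1 ^ 2 * (16 * 16 ^ m)) = 16 ^ m * (16 * m * m.+1 ^ 2))%N by ring.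
have -> : (m * ('C(m.*2, m) ^ 2 * (16 * m.*2.+1 ^ 2 * m.+1)) =
  ('C(m.*2, m) ^ 2 * (4 * m)) * (4 * m.*2.+1 ^ 2 * m.+1))%N by ring.
by apply: leq_mul => //; rewrite -!mulnn; nia.
Qed.

Lemma bin_ub k l : ('C(k, l) ^ 2 * k.+1 <= 4 ^ k)%N.
Proof.
apply: (@leq_trans ('C(k, k./2) ^ 2 * k.+1)%N).
  by rewrite leq_mul2r leq_sqr leq_bin_half orbT.
have := odd_double_half k; case: (odd k) => /= ek; last first.
  set m := k./2 in ek *; have := bin_double_ub m.
  by rewrite (_ : 16 = 4 ^ 2)%N// -expnM mul2n (_ : m.*2 = k).
set m := k./2 in ek *; have ek' : k = m.*2.+1 by lia.
have E := bin_double_ub m.+1.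
have E2 : ('C(m.+1.*2, m.+1) = 2 * 'C(k, m))%N.
  rewrite doubleS binS -ek' mul2n -addnn; congr (_ + _)%N.
  by rewrite -bin_sub ?ek'; [congr 'C(_, _); lia|lia].
have E3 : (m.+1.*2.+1 = k.+2)%N by lia.
move: E; rewrite E2 E3 expnMn (expnS 16) => E.
have -> : (4 ^ k = 4 * 16 ^ m)%N.
  by rewrite ek' expnS -mul2n expnM.
have : (4 * ('C(k, m) ^ 2 * k.+2) <= 16 * 16 ^ m)%N.
  by rewrite mulnA.
rewrite -!mulnn; nia.
Qed.

Lemma bin_half_lb k : (0 < k)%N -> (4 ^ k <= 'C(k, k./2) ^ 2 * (4 * k))%N.
Proof.
move=> k0; have := odd_double_half k; case: (odd k) => /= ek; last first.
  rewrite add0n in ek; have h0 : (0 < k./2)%N by lia.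
  apply: (@leq_trans ('C(k, k./2) ^ 2 * (4 * k./2))%N); last first.
    by rewrite leq_mul2l; apply/orP; right; lia.
  have := bin_double_lb h0; rewrite ek (_ : 16 = 4 ^ 2)%N// -expnM mul2n ek.
  by [].
set m := k./2 in ek *; have ek' : k = m.*2.+1 by lia.
have E := @bin_double_lb m.+1 isT.
have E2 : ('C(m.+1.*2, m.+1) = 2 * 'C(k, m))%N.
  rewrite doubleS binS -ek' mul2n -addnn; congr (_ + _)%N.
  by rewrite -bin_sub ?ek'; [congr 'C(_, _); lia|lia].
move: E; rewrite E2 expnMn (expnS 16) => E.
have -> : (4 ^ k = 4 * 16 ^ m)%N.
  by rewrite ek' expnS -mul2n expnM.
move: E; rewrite -!mulnn; nia.
Qed.

End binomial_bounds.

Section littlewood_offord.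
Context {R : realType}.

(* The Lubell-Yamamoto-Meshalkin inequality for the antichain g, by averaging
   over the maximal proper subsets of X. *)
Lemma lym (T : finType) (g : {set T} -> bool) :
    (forall A B : {set T}, A \proper B -> g A -> g B -> False) ->
  forall X : {set T},
    \sum_(A : {set T} | A \subset X) (g A)%:R / 'C(#|X|, #|A|)%:R <= 1 :> R.
Proof.
move=> anti X; have [n] := ubnP #|X|; elim: n X => // n IH X /ltnSE-Xn.
have [gX|gX] := boolP (g X).
  rewrite (bigD1 X)//= gX binn divr1 big1 ?addr0// => A /andP[AX nAX].
  have [gA|_] := boolP (g A); last by rewrite mul0r.
  by exfalso; apply: (anti A X) => //; rewrite finset.properEneq nAX.
have [X0|Xgt0] := posnP #|X|.
  rewrite big1 ?ler01// => A; rewrite (cards0_eq X0) finset.subset0 => /eqP->.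
  by rewrite -(cards0_eq X0) (negbTE gX) mul0r.
rewrite (bigD1 X)//= (negbTE gX) mul0r add0r.
have -> : \sum_(A : {set T} | (A \subset X) && (A != X))
      (g A)%:R / 'C(#|X|, #|A|)%:R =
    \sum_(i in X) #|X|%:R^-1 * \sum_(A : {set T} | A \subset X :\ i)
      (g A)%:R / 'C(#|X :\ i|, #|A|)%:R :> R.
  transitivity (\sum_(i in X) \sum_(A : {set T} | A \subset X :\ i)
      #|X|%:R^-1 * ((g A)%:R / 'C(#|X|.-1, #|A|)%:R) : R); last first.
    apply: eq_bigr => i iX; rewrite mulr_sumr; apply: eq_bigr => A _.
    by rewrite [#|X|](cardsD1 i) iX add1n.
  rewrite (exchange_big_dep (fun A : {set T} => (A \subset X) && (A != X)))/=.
    apply: eq_bigr => A /andP[AX nAX].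
    rewrite (eq_bigl (fun i => i \in X :\: A)); last first.
      by move=> i; rewrite subsetD1 AX/= inE andbC.
    rewrite sumr_const cardsDS// -mulr_natl.
    have AltX : (#|A| < #|X|)%N by rewrite proper_card// finset.properEneq nAX.
    have E := mul_bin_down #|X| #|A|.
    have b1 : 'C(#|X|, #|A|)%:R != 0 :> R.
      by rewrite pnatr_eq0 -lt0n bin_gt0 ltnW.
    have b2 : 'C(#|X|.-1, #|A|)%:R != 0 :> R.
      by rewrite pnatr_eq0 -lt0n bin_gt0 -ltnS prednK.
    have b3 : #|X|%:R != 0 :> R by rewrite pnatr_eq0 -lt0n.
    have b4 : (#|X| - #|A|)%:R != 0 :> R by rewrite pnatr_eq0 -lt0n subn_gt0.
    have {}E : #|X|%:R * 'C(#|X|.-1, #|A|)%:R =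
      (#|X| - #|A|)%:R * 'C(#|X|, #|A|)%:R :> R by rewrite -!natrM E.
    have -> : 'C(#|X|.-1, #|A|)%:R =
        (#|X| - #|A|)%:R * 'C(#|X|, #|A|)%:R / #|X|%:R :> R.
      by rewrite -E; field.
    by field; rewrite b1 b3 b4.
  move=> i A iX /subsetD1P[AX iA]; rewrite AX/=.
  by apply: contraNneq iA => ->.
apply: (@le_trans _ _ (\sum_(i in X) #|X|%:R^-1)).
  apply: ler_sum => i iX; rewrite ler_piMr ?invr_ge0//; apply: IH.
  by rewrite (leq_trans _ Xn)// [#|X|](cardsD1 i) iX.
by rewrite sumr_const -[leLHS]mulr_natl mulfV// pnatr_eq0 -lt0n.
Qed.

Lemma sum_subset_setU1 (T : finType) (i : T) (X : {set T}) (F : {set T} -> R) :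
    i \notin X ->
  \sum_(A : {set T} | A \subset i |: X) F A =
  \sum_(A : {set T} | A \subset X) F A +
  \sum_(A : {set T} | A \subset X) F (i |: A).
Proof.
move=> iX; rewrite (bigID (fun A : {set T} => i \in A))/= addrC; congr (_ + _).
  apply: eq_bigl => A; rewrite -subsetD1 finset.setU1K//.
rewrite (reindex_onto (fun A => i |: A) (fun A => A :\ i))/=; last first.
  by move=> A /andP[_ iA]; rewrite finset.setD1K.
apply: eq_bigl => A; rewrite finset.setU11 andbT.
have [iA|iA] := boolP (i \in A).
  rewrite (_ : _ == _ = false) ?andbF; last first.
    by apply/negP => /eqP/setP/(_ i); rewrite !inE eqxx iA.
  by apply/esym/negP => /fintype.subsetP/(_ _ iA); rewrite (negbTE iX).
rewrite finset.setU1K// eqxx andbT; apply/idP/idP; last exact: finset.setUS.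
by move=> /(finset.setSD [set i]); rewrite !finset.setU1K.
Qed.

Lemma avg_sum (T : finType) (d : T -> R) (r : seq T) (h : R * R -> R) z :
    uniq r ->
  avg (map d r) (fun z => (h z)%:E) z =
  (2^-1 ^+ size r *
   \sum_(A : {set T} | A \subset [set x in r]) h (z + (0, \sum_(i in A) d i)))%:E.
Proof.
elim: r z => [|i r IH] z /=.
  move=> _; rewrite expr0 mul1r (big_pred1 finset.set0) ?finset.big_set0 ?addr0//.
  by move=> A; rewrite finset.set_nil finset.subset0.
move=> /andP[ir ur]; rewrite !IH// set_cons sum_subset_setU1 ?inE//.
rewrite -EFinD -EFinM exprS -mulrDr mulrA; congr (_ * (_ + _))%:E.
apply: eq_bigr => A /fintype.subsetP Ar.
rewrite big_setU1/=; last by apply/negP => /Ar; rewrite inE (negbTE ir).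
by rewrite -addrA; congr (h (_ + (_, _))); rewrite addr0.
Qed.

Definition LObound (k : nat) : R := (Num.sqrt k.+1%:R)^-1.

Lemma bin_LObound k l : 2^-1 ^+ k * 'C(k, l)%:R <= LObound k.
Proof.
have s0 : 0 < Num.sqrt k.+1%:R :> R by rewrite sqrtr_gt0.
rewrite /LObound exprVn mulrC ler_pdivrMr ?exprn_gt0// [leRHS]mulrC.
rewrite ler_pdivlMr//.
rewrite -(@ler_pXn2r _ 2)// ?nnegrE ?mulr_ge0// ?exprn_ge0//.
rewrite exprMn sqr_sqrtr// -exprM mulnC exprM -[2 ^+ 2]natrX.
by rewrite -!natrX -natrM ler_nat bin_ub.
Qed.

Lemma avg_window (eta w : R) (ds : seq R) z : 0 < eta -> all (>= eta) ds ->
  (avg ds (fun z => ((w <= z.2 < w + eta)%R%:R)%:E) z <= (LObound (size ds))%:E)%E.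
Proof.
move=> eta0 /(all_nthP 0) dsP.
set k := size ds; pose dd (i : 'I_k) := ds`_i.
have -> : ds = map dd (enum 'I_k).
  apply: (@eq_from_nth _ 0); first by rewrite size_map size_enum_ord.
  move=> i ik; rewrite (nth_map (Ordinal ik)) ?size_enum_ord//.
  by rewrite /dd nth_enum_ord.
rewrite avg_sum ?enum_uniq// size_enum_ord lee_fin.
pose g (A : {set 'I_k}) := w <= z.2 + \sum_(i in A) dd i < w + eta.
have d0 (A : {set 'I_k}) : 0 <= \sum_(i in A) dd i.
  by apply: sumr_ge0 => i _; exact: le_trans (ltW eta0) (dsP i (ltn_ord i)).
have anti (A B : {set 'I_k}) : A \proper B -> g A -> g B -> False.
  move=> /properP[AB [i iB iA]] /andP[A1 _] /andP[_ B2].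
  have : \sum_(i in A) dd i + dd i <= \sum_(i in B) dd i.
    rewrite [leRHS](bigID (mem A))/= [X in _ <= X + _](eq_bigl (mem A)); last first.
      by move=> j /=; rewrite andb_idl// => /(fintype.subsetP AB).
    rewrite lerD2l (bigD1 i)/= ?iB//= lerDl sumr_ge0// => j _.
    exact: le_trans (ltW eta0) (dsP j (ltn_ord j)).
  have := dsP i (ltn_ord i); rewrite -/(dd i) => di Bi.
  lra.
have := lym anti [set: 'I_k]%SET; rewrite cardsT card_ord => H.
rewrite (eq_bigl (fun A : {set 'I_k} => A \subset [set: 'I_k]%SET)); last first.
  by move=> A; rewrite !finset.subsetT; apply/fintype.subsetP => x _; rewrite inE mem_enum.
rewrite -[leRHS]mulr1; apply: le_trans (ler_wpM2l _ H); last first.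
  by rewrite invr_ge0 sqrtr_ge0.
rewrite !mulr_sumr; apply: ler_sum => A _ /=.
have [gA|gA] := boolP (g A); last by rewrite /g in gA; rewrite (negbTE gA) mulr0 mul0r mulr0.
rewrite /g in gA; rewrite gA mulr1 mul1r ler_pdivlMr ?bin_LObound//.
by rewrite ltr0n bin_gt0 (leq_trans (max_card _))// card_ord.
Qed.

End littlewood_offord.

Section binomial_center.
Context {R : realType}.

Lemma avg_nseq_ge (k i : nat) (dl : R) (Psi : R * R -> \bar R) z :
    (i <= k)%N -> (forall z, (0 <= Psi z)%E) ->
  ((2^-1 ^+ k * 'C(k, i)%:R)%:E * Psi (z + (0, dl *+ i))%R
    <= avg (nseq k dl) Psi z)%E.
Proof.
move=> ik P0; elim: k i z ik => [|k IH] i z.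
  by rewrite leqn0 => /eqP->; rewrite expr0 mul1r mul1e mulr0n addr0.
have a0 z' : (0 <= avg (nseq k dl) Psi z')%E by exact: avg_ge0.
have c0 m n : 0 <= 2^-1 ^+ m * ('C(m, n))%:R :> R.
  by rewrite mulr_ge0// exprn_ge0// invr_ge0.
case: i => [|i] ik /=.
  have := IH 0%N z isT; rewrite !bin0 !mulr1 exprS EFinM => H.
  rewrite -muleA; apply: lee_wpmul2l; first by rewrite lee_fin invr_ge0.
  by apply: le_trans H _; rewrite leeDl.
rewrite exprS -mulrA EFinM -muleA.
apply: lee_wpmul2l; first by rewrite lee_fin invr_ge0.
rewrite binS natrD mulrDr EFinD ge0_muleDl ?lee_fin//; apply: leeD.
  have [ltik|] := ltnP i k; first exact: IH.
  by move=> ki; rewrite bin_small ?ltnS// mulr0 mul0e.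
have /(_ (z + (0, dl))) := IH i; rewrite -addrA => H.
rewrite (_ : (0, dl *+ i.+1) = (0, dl) + (0, dl *+ i)); first exact: H.
by congr pair; [rewrite addr0|rewrite mulrS].
Qed.

Lemma bin_near_half k T t : (T <= k./2)%N -> (t <= T)%N -> (0 < k)%N ->
    4 * T%:R / k%:R <= 1 :> R ->
  'C(k, k./2)%:R * (1 - 4 * T%:R / k%:R) ^+ t <= 'C(k, k./2 - t)%:R :> R.
Proof.
move=> Tk tT k0 q0; elim: t tT => [|t IH] tT; first by rewrite expr0 mulr1 subn0.
rewrite exprSr mulrA.
apply: (@le_trans _ _ ('C(k, k./2 - t)%:R * (1 - 4 * T%:R / k%:R))).
  by rewrite ler_wpM2r ?subr_ge0// IH// ltnW.
have E := mul_bin_left k (k./2 - t.+1).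
have e1 : ((k./2 - t.+1).+1 = k./2 - t)%N by lia.
rewrite e1 in E.
have den : 0 < (k - (k./2 - t.+1))%:R :> R by rewrite ltr0n; lia.
rewrite -(ler_pM2l den) -[leRHS]natrM -E natrM mulrCA mulrC ler_wpM2r//.
rewrite -subr_ge0.
have kk : (k <= k./2.*2.+1)%N by lia.
rewrite !natrB; [|lia..]; rewrite -[t.+1%:R]natr1.
have kR : k%:R <= 2 * (k./2)%:R + 1 :> R.
  by move: kk; rewrite -(ler_nat R) -natr1 -mul2n natrM.
have kR2 : 2 * (k./2)%:R <= k%:R :> R.
  by rewrite -natrM ler_nat; lia.
have tR : t%:R + 1 <= T%:R :> R by rewrite natr1 ler_nat.
have TR : T%:R <= (k./2)%:R :> R by rewrite ler_nat.
have k0R : 0 < k%:R :> R by rewrite ltr0n.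
have t0R : 0 <= t%:R :> R by [].
set kr := k%:R in kR kR2 k0R *; set j := (k./2)%:R in kR kR2 TR *.
set Tr := T%:R in tR TR *; set tr := t%:R in tR t0R *.
set x := 4 * Tr / kr.
have xk : x * kr = 4 * Tr by rewrite /x divfK// gt_eqF.
have x0 : 0 <= x by rewrite divr_ge0 ?mulr_ge0//; lra.
have : (kr - (j - (tr + 1))) * x >= kr / 2 * x.
  by apply: ler_wpM2r => //; lra.
have -> : kr / 2 * x = 2 * Tr by rewrite mulrAC [kr * x]mulrC xk; lra.
lra.
Qed.

Lemma bin_center_lb (K : R) : 0 <= K -> exists2 c : R, 0 < c &
  forall k i, (0 < k)%N -> 16 * K <= k%:R -> (i <= k)%N ->
    (k%:R - 2 * i%:R) ^+ 2 <= K * k%:R ->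
    c / Num.sqrt k%:R <= 2^-1 ^+ k * 'C(k, i)%:R.
Proof.
move=> K0; exists (2^-1 * expR (- (2 * K))).
  by rewrite mulr_gt0// ?invr_gt0// expR_gt0.
have low k i : (0 < k)%N -> 16 * K <= k%:R -> (i <= k./2)%N ->
    (k%:R - 2 * i%:R) ^+ 2 <= K * k%:R ->
    2^-1 * expR (- (2 * K)) / Num.sqrt k%:R <= 2^-1 ^+ k * 'C(k, i)%:R.
  move=> k0 kK ik ki.
  pose T := (k./2 - i)%N.
  have k0R : 0 < k%:R :> R by rewrite ltr0n.
  have TK : 4 * T%:R ^+ 2 <= K * k%:R.
    apply: le_trans ki.
    have -> : 4 * T%:R ^+ 2 = (2 * T%:R) ^+ 2 :> R by ring.
    rewrite ler_pXn2r ?nnegrE ?mulr_ge0//.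
      rewrite -!natrM -natrB; last by lia.
      by rewrite ler_nat; rewrite /T; lia.
    by rewrite -natrM -natrB ?ler0n//; lia.
  pose x := 4 * T%:R / k%:R : R.
  have x0 : 0 <= x by rewrite divr_ge0// mulr_ge0.
  have x12 : x <= 2^-1.
    rewrite -(@ler_pXn2r _ 2)// ?nnegrE ?invr_ge0//.
    rewrite /x expr_div_n ler_pdivrMr ?exprn_gt0//.
    rewrite exprMn.
    have -> : 2^-1 ^+ 2 * k%:R ^+ 2 = 4^-1 * (k%:R * k%:R) :> R by field.
    have : k%:R * (16 * K) <= k%:R * k%:R by rewrite ler_wpM2l// ltW.
    lra.
  have e1 : expR (- (2 * x)) <= 1 - x.
    rewrite expRN invf_ple ?posrE ?expR_gt0//; last by lra.
    apply: (le_trans _ (expR_ge1Dx _)).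
    by rewrite -div1r ler_pdivrMr; [nra|lra].
  have eT : expR (- (2 * K)) <= (1 - x) ^+ T.
    apply: (@le_trans _ _ (expR (- (2 * x)) ^+ T)); last first.
      by rewrite lerXn2r// ?nnegrE ?expR_ge0//; lra.
    rewrite -expRM_natl ler_expR.
    have xk : x * k%:R = 4 * T%:R by rewrite /x divfK// gt_eqF.
    rewrite mulrN lerN2 -(ler_pM2r k0R).
    have -> : T%:R * (2 * x) * k%:R = 2 * T%:R * (x * k%:R) by ring.
    rewrite xk; lra.
  have H := @bin_near_half k T T (leq_subr _ _) (leqnn _) k0.
  rewrite /T subKn// -/T in H.
  have {}H : 'C(k, k./2)%:R * (1 - x) ^+ T <= 'C(k, i)%:R :> R by apply: H; rewrite -/x; lra.
  have hb : 2^-1 / Num.sqrt k%:R <= 2^-1 ^+ k * 'C(k, k./2)%:R :> R.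
    have s0 : 0 < Num.sqrt k%:R :> R by rewrite sqrtr_gt0.
    rewrite ler_pdivrMr// exprVn -mulrA ler_pdivlMl ?exprn_gt0//.
    rewrite -(@ler_pXn2r _ 2)// ?nnegrE ?mulr_ge0// ?exprn_ge0 ?invr_ge0//.
    rewrite !exprMn sqr_sqrtr// -exprM mulnC exprM -[2 ^+ 2]natrX.
    have := bin_half_lb k0; rewrite -(ler_nat R) natrX !natrM ?natrX.
    by move=> h2; rewrite exprVn -natrX; lra.
  rewrite mulrAC; apply: (@le_trans _ _ (2^-1 ^+ k * 'C(k, k./2)%:R * (1 - x) ^+ T)).
    by apply: ler_pM => //; rewrite ?expR_ge0 ?divr_ge0 ?sqrtr_ge0 ?invr_ge0.
  by rewrite -mulrA ler_wpM2l// exprn_ge0// invr_ge0.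
move=> k i k0 kK ik ki; have [|ih] := leqP i k./2; first by move=> ih; exact: low.
rewrite -bin_sub//; apply: low => //; first by lia.
rewrite natrB//; apply: le_trans ki.
by rewrite (_ : k%:R - 2 * (k%:R - i%:R) = - (k%:R - 2 * i%:R)) ?sqrrN//; ring.
Qed.

End binomial_center.

Section lebesgue_invariance.
Context {R : realType}.
Local Notation mu := (@lebesgue_measure R).

Lemma lebesgue_measureD (c : R) (A : set R) : measurable A ->
  pushforward mu (fun x => x + c : measurableTypeR R) A = mu A.
Proof.
move=> mA.
have mD : measurable_fun [set: measurableTypeR R] (fun x => x + c).
  by apply: measurable_funD => //; exact: measurable_cst.
apply/esym/lebesgue_measure_unique => //= _ [[a b]] _ <-.
rewrite /pushforward /=.
have -> : (fun x => x + c) @^-1` `]a, b] = `](a - c), (b - c)]%classic.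
  by apply/seteqP; split=> x /=; rewrite !in_itv/= ltrBlDr lerBrDr.
by rewrite !lebesgue_measure_itv/= !lte_fin ltrD2r; case: ifP => // _;
  congr EFin; ring.
Qed.

Lemma int_addr (c : R) (phi : R -> \bar R) : nnm phi ->
  (\int[mu]_x phi (x + c)%R = \int[mu]_x phi x)%E.
Proof.
move=> [mphi phi0].
have mD : measurable_fun [set: measurableTypeR R]
    ((fun x => x + c) : _ -> measurableTypeR R).
  by apply: measurable_funD => //; exact: measurable_cst.
pose D := (fun x => x + c) : _ -> measurableTypeR R.
transitivity (\int[pushforward mu D]_x phi x)%E.
  by rewrite ge0_integral_pushforward.
by apply: eq_measure_integral => A mA _; exact: lebesgue_measureD.
Qed.

Lemma int_addl (c : R) (phi : R -> \bar R) : nnm phi ->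
  (\int[mu]_x phi (c + x)%R = \int[mu]_x phi x)%E.
Proof.
by move=> np; rewrite -(int_addr c np); apply: int_eq => x; rewrite addrC.
Qed.

Lemma int_opp (phi : R -> \bar R) : nnm phi ->
  (\int[mu]_x phi (- x)%R = \int[mu]_x phi x)%E.
Proof.
move=> [mphi phi0].
transitivity (\int[pushforward mu (-%R : _ -> measurableTypeR R)]_x phi x)%E.
  by rewrite ge0_integral_pushforward.
by apply: eq_measure_integral => A mA _; exact: lebesgue_measureN.
Qed.

End lebesgue_invariance.

(** * Anti-concentration by coin flips *)

Section flip_step.
Context {R : realType} d (T : measurableType d)
  (mu : {sigma_finite_measure set T -> \bar R}).
Local Notation Z := (R * R)%type.
Variables (w g u : T -> R) (th th1 th2 : T -> Z) (eta p : R).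
Hypotheses (mw : measurable_fun setT w) (mg : measurable_fun setT g)
  (mu_ : measurable_fun setT u).
Hypotheses (w0 : forall o, 0 <= w o) (g0 : forall o, 0 <= g o)
  (u0 : forall o, 0 <= u o).
Hypotheses (mth : measurable_fun setT th) (p0 : 0 <= p).
Hypothesis flip : forall o, u o != 0 ->
  exists2 dl, eta <= dl & th2 o = th1 o + (0, dl).
Hypothesis dec : forall Psi z, nnm Psi ->
  (step mu w th Psi z = step mu g th Psi z +
    \int[mu]_o ((u o)%:E * (Psi (z + th1 o)%R + Psi (z + th2 o)%R)))%E.
Hypothesis mass_g : (\int[mu]_o (g o)%:E <= (1 - p)%:E)%E.
Hypothesis mass_u : (\int[mu]_o (2 * u o)%:E <= p%:E)%E.
Local Notation S := (step mu w th).

(* The bound improves with the number of pending coins size ds. *)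
Definition flip_bound (b : nat -> R) (Psi : Z -> \bar R) :=
  forall ds z, all (>= eta) ds -> (avg ds Psi z <= (b (size ds))%:E)%E.

Lemma flip_bound_step b Psi : nnm Psi -> (forall j, 0 <= b j) ->
  flip_bound b Psi -> flip_bound (fun j => (1 - p) * b j + p * b j.+1) (S Psi).
Proof.
move=> nP b0 bP ds z dse; rewrite avg_step// dec; last exact: nnm_avg.
rewrite EFinD; apply: leeD.
  apply: (@le_trans _ _ (\int[mu]_o ((b (size ds))%:E * (g o)%:E))%E).
    apply: int_le => o; first by rewrite mule_ge0 ?lee_fin ?avg_ge0//; case: nP.
    by rewrite muleC lee_wpmul2r ?lee_fin// bP.
  rewrite intZ//; last exact: nnm_EFin.
  by rewrite mulrC EFinM lee_wpmul2l// lee_fin.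
apply: (@le_trans _ _ (\int[mu]_o ((b (size ds).+1)%:E * (2 * u o)%:E))%E).
  apply: int_le => o.
    by rewrite mule_ge0 ?lee_fin// adde_ge0// avg_ge0//; case: nP.
  have [->|/flip[dl dle ->]] := eqVneq (u o) 0.
    by rewrite mul0e mulr0 mule0.
  rewrite addrA; have := bP (dl :: ds) (z + th1 o).
  rewrite /= dle dse => /(_ isT) H.
  rewrite -addrA in H.
  have -> : ((b (size ds).+1)%:E * (2 * u o)%:E =
      (u o)%:E * (2%:E * (b (size ds).+1)%:E))%E.
    by rewrite -!EFinM; congr EFin; ring.
  apply: lee_wpmul2l; first by rewrite lee_fin.
  apply: le_trans (lee_wpmul2l _ H); last by rewrite lee_fin.
  by rewrite muleA -EFinM mulfV// mul1e addrA.
rewrite intZ//; last by apply: nnm_EFin => // ; [exact: measurable_funM|move=> o; rewrite mulr_ge0].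
by rewrite mulrC EFinM lee_wpmul2l// lee_fin.
Qed.

Lemma flip_bound_iter (A B : R) Psi n : 0 <= A -> 0 <= B -> nnm Psi ->
  flip_bound (fun j => A / j.+1%:R + B) Psi ->
  flip_bound (fun j => A / (j.+1%:R + n%:R * (p / 2)) + B) (iter n S Psi).
Proof.
move=> A0 B0 nP bP.
have nS m : nnm (iter m S Psi) by elim: m => // m IH; exact: nnm_step.
elim: n => [|n IH] ds z dse.
  by rewrite mul0r addr0; exact: bP.
have np0 : 0 <= n%:R * (p / 2) by rewrite mulr_ge0// divr_ge0.
have b0 (j : nat) : 0 <= A / (j.+1%:R + n%:R * (p / 2)) + B.
  by rewrite addr_ge0// divr_ge0// addr_ge0.
apply: le_trans (flip_bound_step (nS n) b0 IH z dse) _.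
rewrite lee_fin -subr_ge0.
rewrite -[(size ds).+2%:R]natr1 -[(size ds).+1%:R]natr1 -[n.+1%:R]natr1.
set x := (size ds)%:R + 1 + n%:R * (p / 2).
have x1 : 1 <= x by rewrite /x -addrA addrCA lerDl addr_ge0// ler0n.
have -> : (size ds)%:R + 1 + 1 + n%:R * (p / 2) = x + 1 by rewrite /x; ring.
have -> : (size ds)%:R + 1 + (n%:R + 1) * (p / 2) = x + p / 2 by rewrite /x; ring.
have -> : A / (x + p / 2) + B - ((1 - p) * (A / x + B) + p * (A / (x + 1) + B)) =
    A * (((p / 2 * x - p / 2) + p ^+ 2 / 2) / (x * (x + 1) * (x + p / 2))).
  by field; apply/and3P; split; rewrite gt_eqF//; have := p0; lra.
rewrite mulr_ge0// divr_ge0//.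
  by have : 0 <= p * (x - 1); [rewrite mulr_ge0//; lra|have := sqr_ge0 p; have := p0; lra].
by rewrite !mulr_ge0//; have := p0; lra.
Qed.

Lemma avg_iter_le (K : R) Psi n ds z : 0 <= K -> nnm Psi ->
    flip_bound (fun j => K * LObound j) Psi -> all (>= eta) ds ->
  (avg ds (iter n S Psi) z <= (K / Num.sqrt (1 + n%:R * (p / 2)))%:E)%E.
Proof.
move=> K0 nP bP dse.
have np0 : 0 <= n%:R * (p / 2) by rewrite mulr_ge0// divr_ge0.
set y := 1 + n%:R * (p / 2); set s := Num.sqrt y.
have y0 : 0 < y by rewrite ltr_wpDr.
have s0 : 0 < s by rewrite sqrtr_gt0.
have ss : s ^+ 2 = y by rewrite sqr_sqrtr// ltW.
have bP' : flip_bound (fun j => K / 2 * s / j.+1%:R + K / 2 / s) Psi.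
  move=> ds' z' /bP H; apply: le_trans (H z') _.
  rewrite lee_fin /LObound; set j := size ds'; set t := Num.sqrt _.
  have t0 : 0 < t by rewrite sqrtr_gt0.
  have -> : j.+1%:R = t ^+ 2 by rewrite sqr_sqrtr.
  rewrite -subr_ge0.
  have -> : K / 2 * s / t ^+ 2 + K / 2 / s - K / t =
      K / 2 * s * (t^-1 - s^-1) ^+ 2.
    by field; rewrite !gt_eqF.
  by rewrite mulr_ge0 ?sqr_ge0// mulr_ge0 ?divr_ge0// ltW.
have A0 : 0 <= K / 2 * s by rewrite mulr_ge0 ?divr_ge0// ltW.
have B0 : 0 <= K / 2 / s by rewrite divr_ge0 ?divr_ge0// ltW.
apply: le_trans (flip_bound_iter n A0 B0 nP bP' z dse) _.
rewrite lee_fin; apply: (@le_trans _ _ (K / 2 * s / y + K / 2 / s)).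
  rewrite lerD2r ler_wpM2l// lef_pV2 ?posrE ?ltr_wpDr//.
  by rewrite /y lerD2r -[(size ds).+1%:R]natr1 lerDr.
have -> : K / 2 * s / y + K / 2 / s = K / s by rewrite -ss; field; rewrite gt_eqF.
by [].
Qed.

End flip_step.

Lemma avg_int {R : realType} d (T : measurableType d)
    (mu : {sigma_finite_measure set T -> \bar R})
    (k : R * R -> T -> \bar R) ds z : nnm (fun p : _ * T => k p.1 p.2) ->
  avg ds (fun z => \int[mu]_o k z o)%E z = (\int[mu]_o avg ds (k ^~ o) z)%E.
Proof.
move=> nk.
have nk1 (g : R * R -> R * R) : measurable_fun setT g ->
    nnm (fun p : _ * T => k (g p.1) p.2).
  move=> mg; apply: (nnm_comp (h := fun p : (R * R) * T => (g p.1, p.2)) _ nk).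
  by apply: measurable_fun_pair => //; exact: (measurableT_comp mg measurable_fst).
elim: ds z k nk nk1 => [|dl ds IH] z k nk nk1 //=.
have na (g : R * R -> R * R) (mg : measurable_fun setT g) ds' :
    nnm (fun p : _ * T => avg ds' (k ^~ p.2) (g p.1)).
  elim: ds' g mg => [|dl' ds' IH'] g mg /=; first exact: nk1.
  apply: nnmM; first by apply: nnm_cst; rewrite lee_fin invr_ge0.
  apply: nnmD; first exact: IH'.
  by apply: (IH' (fun z => g z + (0, dl'))); apply: measurable_addZ.
have nz z' : nnm (fun o => avg ds (k ^~ o) z').
  apply: (nnm_comp (h := fun o => (z', o)) _ (na id _ ds)) => //.
  exact: measurable_fun_pair.
rewrite !IH// -intD// -intZ ?invr_ge0//; exact: nnmD.
Qed.

Section face_density.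
Context {R : realType}.
Local Notation mu := (@lebesgue_measure R).
Variables (f : R -> R).
Hypotheses (mf : measurable_fun [set: R] f) (f0 : forall x, 0 <= f x).

Definition conv (phi : R -> \bar R) (y : R) : \bar R :=
  (\int[mu]_x ((f x)%:E * phi (y + x)%R))%E.

Definition face_step (rho : R -> R) : (R * R -> \bar R) -> R * R -> \bar R :=
  step mu f (fun x => (x, rho x)).

Definition in2 (x : R) : R * R := (0, x).

Definition sum_step : (R * R -> \bar R) -> R * R -> \bar R := step mu f in2.

Lemma measurable_pair0 (rho : R -> R) : measurable_fun setT rho ->
  measurable_fun setT (fun x : R => (x, rho x)).
Proof. by move=> mr; apply: measurable_fun_pair. Qed.

Lemma measurable_in2 (g : R -> R) : measurable_fun setT g ->
  measurable_fun setT (fun x : R => in2 (g x)).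
Proof. by move=> mg; apply: measurable_fun_pair. Qed.

Lemma nnm_face_step rho Psi : measurable_fun setT rho -> nnm Psi ->
  nnm (face_step rho Psi).
Proof. by move=> mr nP; apply: nnm_step => //; exact: measurable_pair0. Qed.

Lemma nnm_iter_face_step rho Psi n : measurable_fun setT rho -> nnm Psi ->
  nnm (iter n (face_step rho) Psi).
Proof. by move=> mr nP; elim: n => // n IH; exact: nnm_face_step. Qed.

Lemma nnm_sum_step Psi : nnm Psi -> nnm (sum_step Psi).
Proof. by move=> nP; apply: nnm_step => //; exact: measurable_in2. Qed.

Lemma nnm_conv phi : nnm phi -> nnm (conv phi).
Proof.
move=> np; have : nnm (fun z : R * R => phi z.2) by exact: nnm_comp np.
move=> /nnm_sum_step; apply: (nnm_comp (h := in2)).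
exact: measurable_in2.
Qed.

Lemma nnm_iter_conv phi n : nnm phi -> nnm (iter n conv phi).
Proof. by move=> np; elim: n => // n; exact: nnm_conv. Qed.

Lemma conv_le phi psi y : (forall x, 0 <= phi x)%E ->
  (forall x, phi x <= psi x)%E -> (conv phi y <= conv psi y)%E.
Proof.
move=> p0 pp; apply: int_le => x; first by rewrite mule_ge0// lee_fin.
by apply: lee_wpmul2l; rewrite ?lee_fin.
Qed.

Lemma iter_conv_ge0 phi n y : (forall x, 0 <= phi x)%E ->
  (0 <= iter n conv phi y)%E.
Proof.
move=> p0; elim: n y => // n IH y; apply: int_ge0 => x.
by apply: mule_ge0; [exact: f0|exact: IH].
Qed.

Lemma iter_conv_le phi psi n y : (forall x, 0 <= phi x)%E ->
  (forall x, phi x <= psi x)%E -> (iter n conv phi y <= iter n conv psi y)%E.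
Proof.
move=> p0 pp; elim: n y => // n IH y /=.
by apply: conv_le => // x; exact: iter_conv_ge0.
Qed.

Lemma convD phi psi y : nnm phi -> nnm psi ->
  conv (fun x => phi x + psi x)%E y = (conv phi y + conv psi y)%E.
Proof.
move=> np nq; pose lift (k : R -> \bar R) (z : R * R) := k z.2.
have nl k : nnm k -> nnm (lift k) by move=> nk; exact: nnm_comp nk.
exact: (stepD mu mf f0 (measurable_in2 (@measurable_id _ _ _)) (0, y)
  (nl _ np) (nl _ nq)).
Qed.

Lemma convZ k phi y : 0 <= k -> nnm phi ->
  conv (fun x => k%:E * phi x)%E y = (k%:E * conv phi y)%E.
Proof.
move=> k0 np; pose lift (k : R -> \bar R) (z : R * R) := k z.2.
have nl k' : nnm k' -> nnm (lift k') by move=> nk; exact: nnm_comp nk.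
exact: (stepZ mu mf f0 (measurable_in2 (@measurable_id _ _ _)) (0, y) k0
  (nl _ np)).
Qed.

Lemma iter_convD phi psi n y : nnm phi -> nnm psi ->
  (iter n conv (fun x => phi x + psi x) y =
   iter n conv phi y + iter n conv psi y)%E.
Proof.
move=> np nq; elim: n y => // n IH y /=.
rewrite -convD; [|exact: nnm_iter_conv..].
by congr (conv _ _); apply/funext.
Qed.

Lemma iter_convZ k phi n y : 0 <= k -> nnm phi ->
  (iter n conv (fun x => k%:E * phi x) y = k%:E * iter n conv phi y)%E.
Proof.
move=> k0 np; elim: n y => // n IH y /=.
rewrite -convZ//; last exact: nnm_iter_conv.
by congr (conv _ _); apply/funext.
Qed.

Lemma iter_sum_step phi n z :
  iter n sum_step (fun z => phi z.2) z = iter n conv phi z.2.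
Proof.
elim: n z => // n IH z /=; rewrite /sum_step /step; apply: int_eq => x.
by rewrite IH.
Qed.

Lemma iter_face_step_fst rho phi n z :
  iter n (face_step rho) (fun z => phi z.1) z = iter n conv phi z.1.
Proof.
elim: n z => // n IH z /=; rewrite /face_step /step; apply: int_eq => x.
by rewrite IH.
Qed.

Hypothesis f1 : (\int[mu]_x (f x)%:E = 1)%E.
Variables (c h al : R).
Hypotheses (c0 : 0 < c) (h0 : 0 < h).
Hypothesis fc : forall x, al - 2 * h < x <= al + 2 * h -> c <= f x.

Let I0 (x : R) : bool := al - h < x <= al + h.
Let I1 (x : R) : bool := al - 2 * h < x <= al + 2 * h.
(* f x = rest x + bump (x + h) + bump (x - h), and [weight] is the mass of the
   two bumps. *)
Definition bump x : R := c * (I0 x)%:R.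
Definition rest x : R := f x - c * (I1 x)%:R.
Definition weight : R := 4 * c * h.

Lemma measurable_itvb (a b : R) :
  measurable_fun setT (fun x : R => (a < x <= b : bool)).
Proof.
apply: (measurable_fun_bool true); rewrite setTI.
rewrite (_ : _ @^-1` _ = `]a, b]%classic) //.
Qed.

Lemma measurable_nat_of_bool d (T : measurableType d) (A : T -> bool) :
  measurable_fun setT A -> measurable_fun setT (fun x => (A x)%:R : R).
Proof.
by move=> mA; apply/measurable_EFinP; have [] := nnm_indic R mA.
Qed.

Lemma measurable_bump : measurable_fun setT bump.
Proof.
apply: measurable_funM => //; apply: measurable_nat_of_bool.
exact: measurable_itvb.
Qed.

Lemma measurable_rest : measurable_fun setT rest.
Proof.
apply: measurable_funB => //; apply: measurable_funM => //.
by apply: measurable_nat_of_bool; exact: measurable_itvb.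
Qed.

Lemma bump_ge0 x : 0 <= bump x.
Proof. by rewrite mulr_ge0// ltW. Qed.

Lemma rest_ge0 x : 0 <= rest x.
Proof.
by rewrite /rest subr_ge0; case: (boolP (I1 x)) => [/fc|_]; rewrite ?mulr1 ?mulr0.
Qed.

Lemma I1E x : (I1 x)%:R = (I0 (x + h))%:R + (I0 (x - h))%:R :> R.
Proof.
rewrite /I1 /I0; have := h0.
case: (ltP (al - 2 * h) x); case: (leP x (al + 2 * h));
case: (ltP (al - h) (x + h)); case: (leP (x + h) (al + h));
case: (ltP (al - h) (x - h)); case: (leP (x - h) (al + h)) => /=;
  rewrite ?addr0 ?add0r//; lra.
Qed.

Lemma conv_dec phi y : nnm phi ->
  conv phi y = (\int[mu]_x ((rest x)%:E * phi (y + x)%R) +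
    \int[mu]_x ((bump x)%:E * (phi (y + (x - h))%R + phi (y + (x + h))%R)))%E.
Proof.
move=> np.
have nphi k : nnm (fun x : R => phi (y + (x + k))%R).
  by apply: nnm_comp np; apply: measurable_funD => //; exact: measurable_funD.
have nphi0 : nnm (fun x : R => phi (y + x)%R).
  by apply: nnm_comp np; apply: measurable_funD.
have mb k : measurable_fun setT (fun x : R => bump (x + k)).
  by apply: (measurableT_comp measurable_bump); exact: measurable_funD.
have nb k : nnm (fun x : R => (bump (x + k))%:E).
  by apply: nnm_EFin => // x; exact: bump_ge0.
have nb0 : nnm (fun x : R => (bump x)%:E).
  by apply: nnm_EFin => [|x]; [exact: measurable_bump|exact: bump_ge0].
have nr : nnm (fun x : R => (rest x)%:E).
  by apply: nnm_EFin => [|x]; [exact: measurable_rest|exact: rest_ge0].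
have P0 t : (0 <= phi t)%E by case: np.
transitivity (\int[mu]_x ((rest x)%:E * phi (y + x)%R +
    ((bump (x + h))%:E * phi (y + x)%R + (bump (x - h))%:E * phi (y + x)%R)))%E.
  apply: int_eq => x; rewrite -!ge0_muleDl ?lee_fin ?rest_ge0 ?bump_ge0 ?addr_ge0//; last 2 first.
    1,2: exact: bump_ge0.
  congr (_ * _)%E; rewrite -!EFinD; congr EFin.
  by rewrite /rest /bump I1E; ring.
have nbp k := nnmM (nb k) nphi0.
have nbb k := nnmM nb0 (nphi k).
rewrite intD; [|exact: nnmM nr nphi0|exact: nnmD (nbp h) (nbp (- h))].
congr (_ + _)%E; rewrite intD; [|exact: (nbp h)|exact: (nbp (- h))].
under [RHS]int_eq do rewrite ge0_muleDr//.
rewrite intD; [|exact: (nbb (- h))|exact: (nbb h)]; congr (_ + _)%E.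
  rewrite -[LHS](int_addr (- h)); last exact: (nbp h).
  by apply: int_eq => x; rewrite subrK.
rewrite -[LHS](int_addr h); last exact: (nbp (- h)).
by apply: int_eq => x; rewrite addrK.
Qed.

Lemma int_bump : (\int[mu]_x (2 * bump x)%:E = weight%:E)%E.
Proof.
under int_eq do rewrite EFinM.
rewrite intZ//; last by apply: nnm_EFin => [|x]; [exact: measurable_bump|exact: bump_ge0].
under int_eq do rewrite EFinM.
rewrite intZ ?(ltW c0)//; last by apply: nnm_indic; exact: measurable_itvb.
rewrite (_ : (fun x => _) = EFin \o \1_(`]al - h, al + h])); last first.
  by apply/funext => x /=; rewrite indicE mem_setE in_itv.
rewrite integral_indic//= setIT lebesgue_measure_itv/= lte_fin ltrD2l gtrN//.
by rewrite -!EFinM /weight; congr EFin; ring.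
Qed.

Lemma int_rest : (\int[mu]_x (rest x)%:E = (1 - weight)%:E)%E.
Proof.
have := @conv_dec (cst 1%E) 0 (nnm_cst _ lee01).
rewrite /conv; under int_eq do rewrite mule1.
rewrite f1; under [X in (_ = X + _)%E]int_eq do rewrite mule1.
under [X in (_ = _ + X)%E]int_eq do rewrite /cst -EFinD muleC -EFinM.
rewrite int_bump => E.
have : (\int[mu]_x (rest x)%:E)%E \is a fin_num.
  rewrite ge0_fin_numE; last by apply: int_ge0 => x; rewrite lee_fin rest_ge0.
  rewrite (@le_lt_trans _ _ 1%E) ?ltry// E leeDl// lee_fin.
  by rewrite /weight !mulr_ge0// ltW.
move: E => /[swap] /fineK <-; rewrite -EFinD => -[->].
by rewrite addrK.
Qed.

Lemma weight_gt0 : 0 < weight.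
Proof. by rewrite !mulr_gt0. Qed.

Lemma weight_le1 : weight <= 1.
Proof.
rewrite -subr_ge0 -lee_fin -int_rest.
by apply: int_ge0 => x; rewrite lee_fin rest_ge0.
Qed.

End face_density.

Lemma half_split N : exists n l, [/\ N = (n + l)%N,
  ((n + l).+1 <= 2 * n.+1)%N & ((n + l).+1 <= 2 * l.+1)%N].
Proof. by exists N./2, (N - N./2)%N; split; lia. Qed.

Section sum_density_bounds.
Context {R : realType}.
Local Notation mu := (@lebesgue_measure R).
Variables (f : R -> R).
Hypotheses (mf : measurable_fun [set: R] f) (f0 : forall x, 0 <= f x).
Hypothesis f1 : (\int[mu]_x (f x)%:E = 1)%E.
Variables (c h al : R).
Hypotheses (c0 : 0 < c) (h0 : 0 < h).
Hypothesis fc : forall x, al - 2 * h < x <= al + 2 * h -> c <= f x.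

Local Notation bump := (bump c h al).
Local Notation rest := (rest f c h al).
Local Notation p := (weight c h).
Local Notation conv := (conv f).

Let mb : measurable_fun setT bump. Proof. exact: measurable_bump. Qed.
Let mr : measurable_fun setT rest. Proof. exact: measurable_rest. Qed.
Let b0 x : 0 <= bump x. Proof. exact: bump_ge0. Qed.
Let r0 x : 0 <= rest x. Proof. exact: rest_ge0. Qed.
Let p0 : 0 < p. Proof. exact: weight_gt0. Qed.
Let p1 : p <= 1. Proof. exact: (weight_le1 mf f0 f1 c0 h0 fc). Qed.
Let massr : (\int[mu]_x (rest x)%:E = (1 - p)%:E)%E.
Proof. exact: int_rest. Qed.
Let massb : (\int[mu]_x (2 * bump x)%:E = p%:E)%E.
Proof. exact: int_bump. Qed.
Let mth0 : measurable_fun setT (@in2 R).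
Proof. exact: measurable_in2. Qed.

Lemma sum_step_dec Psi (z : R * R) : nnm Psi ->
  (sum_step f Psi z = step mu rest (@in2 R) Psi z +
   \int[mu]_x ((bump x)%:E *
     (Psi (z + in2 (x - h))%R + Psi (z + in2 (x + h))%R)))%E.
Proof.
move=> nP; have np : nnm (fun y : R => Psi (z + in2 y)).
  apply: (nnm_comp (h := fun y : R => z + in2 y) _ nP).
  by apply: measurable_addZ => //; exact: measurable_cst.
have := conv_dec mf f0 c0 h0 fc 0 np; rewrite /conv => E.
transitivity (\int[mu]_x ((f x)%:E * Psi (z + in2 (0 + x))%R))%E.
  by apply: int_eq => x; rewrite add0r.
rewrite E /step; congr (_ + _)%E; apply: int_eq => x; rewrite !add0r//.
Qed.

Lemma avgZ (a : \bar R) ds Psi (z : R * R) : (0 <= a)%E ->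
    (forall z, 0 <= Psi z)%E ->
  avg ds (fun z => a * Psi z)%E z = (a * avg ds Psi z)%E.
Proof.
move=> a0 P0; elim: ds z => // dl ds IH z /=.
by rewrite !IH -ge0_muleDr ?avg_ge0// muleCA.
Qed.

Definition smooth (psi : R -> \bar R) (y : R) : \bar R :=
  (\int[mu]_x ((bump x)%:E * psi (y + x)%R))%E.

Lemma nnm_smooth psi : nnm psi -> nnm (smooth psi).
Proof. by move=> np; exact: nnm_conv. Qed.

Lemma smooth_flip_bound psi w : 0 <= w -> nnm psi ->
    (\int[mu]_x psi x <= w%:E)%E ->
  flip_bound (2 * h) (fun j => w * c * LObound j) (fun z => smooth psi z.2).
Proof.
move=> w0 np pw ds z dsh.
pose win (t x : R) : bool := x - al - h <= t < x - al - h + 2 * h.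
pose k (z : R * R) x := ((c%:E * psi x) * ((win z.2 x)%:R)%:E)%E.
have kE z' : smooth psi z'.2 = (\int[mu]_x k z' x)%E.
  have nk : nnm (fun x : R => (bump (x - z'.2))%:E * psi x)%E.
    apply: nnmM => //; apply: nnm_EFin => //.
    by apply: (measurableT_comp mb); exact: measurable_funD.
  transitivity (\int[mu]_x ((bump (x - z'.2))%:E * psi x))%E.
    rewrite -(int_addl z'.2 nk); apply: int_eq => x.
    by rewrite addrAC subrr add0r.
  apply: int_eq => x; rewrite /k muleAC; congr (_ * _)%E.
  rewrite -EFinM; congr (_ * (nat_of_bool _)%:R)%:E; rewrite /win.
  by apply/idP/idP => /andP[? ?]; apply/andP; split; have := h0; lra.
have nk : nnm (fun q : (R * R) * R => k q.1 q.2).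
  apply: nnmM.
    apply: nnmM; first by apply: nnm_cst; rewrite lee_fin ltW.
    exact: (nnm_comp measurable_snd np).
  apply: nnm_indic; rewrite /win.
  have m2 : measurable_fun setT (fun q : (R * R) * R => q.1.2).
    exact: (measurableT_comp measurable_snd measurable_fst).
  apply: measurable_and.
    by apply: measurable_fun_ler => //; do 2 apply: measurable_funB => //.
  apply: measurable_fun_ltr => //; apply: measurable_funD => //.
  by do 2 apply: measurable_funB => //.
rewrite (_ : (fun z => _) = (fun z => \int[mu]_x k z x)%E); last exact/funext.
rewrite avg_int//.
apply: (@le_trans _ _ (\int[mu]_x ((c * LObound (size ds))%:E * psi x))%E).
  apply: int_le => x; first by apply: avg_ge0 => z'; case: nk => _ /(_ (z', x)).
  have P0 : (0 <= psi x)%E by case: np.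
  rewrite avgZ//; last by rewrite mule_ge0// lee_fin ltW.
  rewrite EFinM [leRHS]muleAC lee_wpmul2l//; first by rewrite mule_ge0// lee_fin ltW.
  by apply: avg_window => //; rewrite mulr_gt0.
rewrite intZ//; last by rewrite mulr_ge0 ?ltW// invr_gt0 sqrtr_gt0.
have cL : 0 <= c * LObound (size ds).
  by rewrite mulr_ge0 ?(ltW c0)// invr_ge0 sqrtr_ge0.
apply: le_trans (lee_wpmul2l _ pw) _; first by rewrite lee_fin.
by rewrite -EFinM lee_fin mulrC mulrA.
Qed.

Lemma iter_conv_smooth_le psi w n y : 0 <= w -> nnm psi ->
    (\int[mu]_x psi x <= w%:E)%E ->
  (iter n conv (smooth psi) y <= (w * c / Num.sqrt (1 + n%:R * (p / 2)))%:E)%E.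
Proof.
move=> w0 np pw.
have nl : nnm (fun z : R * R => smooth psi z.2).
  exact: (nnm_comp measurable_snd (nnm_smooth np)).
have := smooth_flip_bound w0 np pw => FB.
have := avg_iter_le (mu := mu) (th1 := fun x : R => in2 (x - h)) (th2 := fun x : R => in2 (x + h))
  (eta := 2 * h) mf mr mb f0 r0 b0 mth0 (ltW p0) _ sum_step_dec _ _ n (ds := [::])
  (in2 y) _ nl FB isT.
rewrite /= -/(sum_step f) iter_sum_step; apply.
- by move=> x _; exists (2 * h) => //; congr pair => /=; ring.
- by rewrite massr.
- by rewrite massb.
- by rewrite mulr_ge0// ltW.
Qed.

Lemma int_shifts phi w : nnm phi -> (\int[mu]_x phi x <= w%:E)%E ->
  (\int[mu]_x (phi (x - h)%R + phi (x + h)%R) <= (2 * w)%:E)%E.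
Proof.
move=> np pw; have ns k : nnm (fun x : R => phi (x + k)%R).
  by apply: nnm_comp np; exact: measurable_funD.
rewrite intD; [|exact: (ns (- h))|exact: (ns h)].
by rewrite !int_addr// mulr_natl mulr2n EFinD leeD.
Qed.

Lemma iter_conv_split phi (M w : R) n l y : nnm phi -> 0 <= M -> 0 <= w ->
    (forall x, phi x <= M%:E)%E -> (\int[mu]_x phi x <= w%:E)%E ->
  (iter (n + l) conv phi y <= ((1 - p) ^+ l * M +
      w * (2 * c / Num.sqrt (1 + n%:R * (p / 2))) / p)%:E)%E.
Proof.
set D := 2 * c / _; have D0 : 0 <= D.
  by rewrite divr_ge0 ?sqrtr_ge0// mulr_ge0// ltW.
elim: l phi M w y => [|l IH] phi M w y np M0 w0 pM pw.
  rewrite addn0 expr0 mul1r; apply: (@le_trans _ _ M%:E); last first.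
    by rewrite lee_fin lerDl divr_ge0 ?mulr_ge0// ltW.
  elim: (n) y => // n' IHn y /=.
  apply: (@le_trans _ _ (conv (fun=> M%:E) y)).
    by apply: conv_le => // x; apply: iter_conv_ge0 => //; case: np.
  rewrite /conv; under int_eq do rewrite muleC.
  by rewrite intZ//; [rewrite f1 mule1|exact: nnm_EFin].
pose phi' y := (\int[mu]_x ((rest x)%:E * phi (y + x)%R))%E.
pose psi x := (phi (x - h)%R + phi (x + h)%R)%E.
have nphi' : nnm phi' by exact: (@nnm_conv _ rest).
have npsi : nnm psi.
  by apply: nnmD; apply: nnm_comp np; exact: measurable_funD.
have convE : conv phi = (fun x => phi' x + smooth psi x)%E.
  apply/funext => x; rewrite (conv_dec mf f0 c0 h0 fc)//; congr (_ + _)%E.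
  by apply: int_eq => t; rewrite /psi !addrA.
rewrite addnS iterSr convE iter_convD//; last exact: nnm_smooth.
have q0 : 0 <= 1 - p by rewrite subr_ge0.
have phi'M x : (phi' x <= ((1 - p) * M)%:E)%E.
  apply: (@le_trans _ _ (\int[mu]_x (M%:E * (rest x)%:E))%E).
    apply: int_le => t; first by rewrite mule_ge0 ?lee_fin//; case: np.
    by rewrite muleC lee_wpmul2r// lee_fin.
  by rewrite intZ//; [rewrite massr -EFinM mulrC|exact: nnm_EFin].
have phi'w : (\int[mu]_x phi' x <= ((1 - p) * w)%:E)%E.
  have nk : nnm (fun q : R * R => (rest q.2)%:E * phi (q.1 + q.2)%R)%E.
    apply: nnmM.
      by apply: nnm_EFin => //; exact: (measurableT_comp mr measurable_snd).
    by apply: nnm_comp np; exact: measurable_funD.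
  have -> : (\int[mu]_y phi' y = \int[mu]_x \int[mu]_y ((rest x)%:E * phi (y + x)%R))%E.
    exact: (int_exchange mu mu nk).
  apply: (@le_trans _ _ (\int[mu]_x (w%:E * (rest x)%:E))%E).
    apply: int_le => t; first by apply: int_ge0 => x; rewrite mule_ge0 ?lee_fin//; case: np.
    rewrite intZ//; last by apply: nnm_comp np; exact: measurable_funD.
    by rewrite int_addr// muleC lee_wpmul2r// lee_fin.
  by rewrite intZ//; [rewrite massr -EFinM mulrC|exact: nnm_EFin].
have := IH phi' _ _ y nphi' (mulr_ge0 q0 M0) (mulr_ge0 q0 w0) phi'M phi'w => H1.
have := @iter_conv_smooth_le psi (2 * w) (n + l) y.
move=> /(_ (mulr_ge0 (ler0n R 2) w0) npsi (int_shifts np pw)) H2.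
apply: le_trans (leeD H1 H2) _; rewrite -EFinD lee_fin.
have H3 : 2 * w * c / Num.sqrt (1 + (n + l)%:R * (p / 2)) <= w * D.
  have -> : w * D = 2 * w * c / Num.sqrt (1 + n%:R * (p / 2)) by rewrite /D; ring.
  have hp : 0 <= p / 2 by rewrite divr_ge0// ltW.
  rewrite ler_wpM2l//; first by rewrite !mulr_ge0// ltW.
  have hk (k : nat) : 0 < Num.sqrt (1 + k%:R * (p / 2)).
    by rewrite sqrtr_gt0 ltr_wpDr// mulr_ge0.
  rewrite lef_pV2 ?posrE//.
  by rewrite ler_wsqrtr// lerD2l ler_wpM2r// ler_nat leq_addr.
apply: (@le_trans _ _ ((1 - p) ^+ l * ((1 - p) * M) + (1 - p) * w * D / p + w * D)).
  by rewrite lerD2l.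
have pn0 : p != 0 by rewrite gt_eqF.
have E : (1 - p) * w * D / p + w * D = w * D / p by field.
by rewrite -addrA E exprSr !mulrA.
Qed.

Lemma iter_conv_sup phi (M w : R) : nnm phi -> 0 <= M -> 0 <= w ->
    (forall x, phi x <= M%:E)%E -> (\int[mu]_x phi x <= w%:E)%E ->
  exists2 C : R, 0 < C &
    forall n y, (iter n conv phi y <= (C / Num.sqrt n.+1%:R)%:E)%E.
Proof.
move=> np M0 w0 pM pw.
pose q := p / 4; have q0 : 0 < q by rewrite divr_gt0.
have q1 : q <= 1 by rewrite ler_pdivrMr// mul1r (le_trans p1)// ler1n.
exists ((M + w * (2 * c) / p + 1) / Num.sqrt q).
  rewrite divr_gt0 ?sqrtr_gt0// ltr_pwDr// addr_ge0// divr_ge0 ?(ltW p0)//.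
  by rewrite !mulr_ge0// ltW.
move=> N y; have [n [l [-> nl1 nl2]]] := half_split N.
apply: le_trans (iter_conv_split n l y np M0 w0 pM pw) _; rewrite lee_fin.
have nlR : (n + l).+1%:R <= 2 * (n%:R + 1) :> R.
  by rewrite natr1 -natrM ler_nat.
have nlR2 : (n + l).+1%:R <= 2 * (l%:R + 1) :> R.
  by rewrite natr1 -natrM ler_nat.
set X := (n + l).+1%:R in nlR nlR2 *.
have X0 : 0 < X by rewrite /X ltr0n.
have s1 : Num.sqrt q * Num.sqrt X <= Num.sqrt (1 + n%:R * (p / 2)).
  rewrite -sqrtrM ?(ltW q0)// ler_wsqrtr//.
  have : q * X <= q * (2 * (n%:R + 1)) by rewrite ler_pM2l.
  rewrite /q; have := p1; lra.
have sX0 : 0 < Num.sqrt X by rewrite sqrtr_gt0.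
have sq0 : 0 < Num.sqrt q by rewrite sqrtr_gt0.
have s2 : (1 - p) ^+ l <= (Num.sqrt q * Num.sqrt X)^-1.
  have e1 : (1 - p) ^+ l * (1 + p * l%:R) <= 1.
    elim: (l) => [|l' IH]; first by rewrite expr0 mul1r mulr0 addr0.
    apply: le_trans IH; rewrite exprSr -mulrA ler_wpM2l ?exprn_ge0 ?subr_ge0//.
    have l'0 : 0 <= l'%:R :> R by [].
    have : 0 <= p * p * (l'%:R + 1) by rewrite !mulr_ge0 ?addr_ge0// ltW.
    rewrite -[l'.+1%:R]natr1; lra.
  have d0 : 0 < 1 + p * l%:R by rewrite ltr_wpDr// mulr_ge0// ltW.
  apply: (@le_trans _ _ (1 + p * l%:R)^-1).
    by rewrite -[leRHS]mul1r ler_pdivlMr.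
  rewrite lef_pV2 ?posrE ?mulr_gt0//.
  rewrite -sqrtrM ?(ltW q0)//.
  have qX : q * X <= 1 + p * l%:R.
    have : q * X <= q * (2 * (l%:R + 1)) by rewrite ler_pM2l.
    have : 0 <= p * l%:R by rewrite mulr_ge0// ltW.
    rewrite /q; have := p1; lra.
  have one : 1 <= 1 + p * l%:R by rewrite lerDl mulr_ge0// ltW.
  apply: le_trans (ler_wsqrtr qX) _.
  rewrite -[leRHS]ger0_norm ?(ltW d0)// -sqrtr_sqr ler_wsqrtr// expr2.
  by rewrite ler_peMl// ltW.
have s3 : (1 - p) ^+ l * M <= M / (Num.sqrt q * Num.sqrt X).
  by rewrite mulrC ler_wpM2l.
have s4 : w * (2 * c / Num.sqrt (1 + n%:R * (p / 2))) / p <=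
    w * (2 * c) / p / (Num.sqrt q * Num.sqrt X).
  rewrite [X in X / p]mulrA mulrAC ler_wpM2l//.
    by rewrite divr_ge0 ?(ltW p0)// mulr_ge0// mulr_ge0// ltW.
  by rewrite lef_pV2 ?posrE ?mulr_gt0// (lt_le_trans _ s1) ?mulr_gt0.
have s5 : 0 <= (Num.sqrt q * Num.sqrt X)^-1 by rewrite invr_ge0 mulr_ge0 ?sqrtr_ge0.
have -> : (M + w * (2 * c) / p + 1) / Num.sqrt q / Num.sqrt X =
  M / (Num.sqrt q * Num.sqrt X) + w * (2 * c) / p / (Num.sqrt q * Num.sqrt X) +
  (Num.sqrt q * Num.sqrt X)^-1 by field; rewrite !gt_eqF.
by lra.
Qed.

End sum_density_bounds.

(** * Lower bound for the density of a sum *)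

Section sum_density_lower_bound.
Context {R : realType}.
Local Notation mu := (@lebesgue_measure R).
Variables (f : R -> R).
Hypotheses (mf : measurable_fun [set: R] f) (f0 : forall x, 0 <= f x).
Hypothesis f1 : (\int[mu]_x (f x)%:E = 1)%E.
Variables (c h al : R).
Hypotheses (c0 : 0 < c) (h0 : 0 < h).
Hypothesis fc : forall x, al - 2 * h < x <= al + 2 * h -> c <= f x.

Local Notation bump := (bump c h al).
Local Notation rest := (rest f c h al).
Local Notation p := (weight c h).
Local Notation conv := (conv f).

Let mb : measurable_fun setT bump. Proof. exact: measurable_bump. Qed.
Let mr : measurable_fun setT rest. Proof. exact: measurable_rest. Qed.
Let b0 x : 0 <= bump x. Proof. exact: bump_ge0. Qed.
Let r0 x : 0 <= rest x. Proof. exact: rest_ge0. Qed.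
Let p0 : 0 < p. Proof. exact: weight_gt0. Qed.
Let p1 : p <= 1. Proof. exact: (weight_le1 mf f0 f1 c0 h0 fc). Qed.
Let massr : (\int[mu]_x (rest x)%:E = (1 - p)%:E)%E.
Proof. exact: int_rest. Qed.
Let massb : (\int[mu]_x (2 * bump x)%:E = p%:E)%E.
Proof. exact: int_bump. Qed.
Let mth0 : measurable_fun setT (@in2 R).
Proof. exact: measurable_in2. Qed.

Local Notation flips k := (nseq k (2 * h)).

Hypothesis f2 : forall t : R, (\int[mu]_x ((f x)%:E * ((t + x) ^+ 2)%:E) =
  (t ^+ 2 + 1)%:E)%E.

Let nnm_sqr t : nnm (fun x : R => ((t + x) ^+ 2)%:E).
Proof.
apply: nnm_EFin => [|x]; last exact: sqr_ge0.
by apply: measurable_funX; exact: measurable_funD.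
Qed.

Let nrest : nnm (fun x : R => (rest x)%:E). Proof. exact: nnm_EFin. Qed.
Let nbump : nnm (fun x : R => (2 * bump x)%:E).
Proof. by apply: nnm_EFin => [|x]; [exact: measurable_funM|rewrite mulr_ge0]. Qed.

Lemma rest_bump_sqr t :
  (\int[mu]_x ((rest x)%:E * ((t + x) ^+ 2)%:E) +
   \int[mu]_x ((2 * bump x)%:E * ((t + x) ^+ 2)%:E) <= (t ^+ 2 + 1)%:E)%E.
Proof.
rewrite -f2.
have := conv_dec mf f0 c0 h0 fc t (nnm_sqr 0); rewrite /conv.
under [X in (X = _)%E -> _]int_eq do rewrite add0r.
under [X in (_ = X + _)%E -> _]int_eq do rewrite add0r.
move=> ->; apply: leeD => //; apply: int_le => x.
  by apply: mule_ge0; rewrite lee_fin ?sqr_ge0// mulr_ge0.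
rewrite -EFinD -!EFinM lee_fin [2 * _]mulrC -mulrA ler_wpM2l// !add0r.
rewrite -subr_ge0; set r := (X in 0 <= X).
have -> : r = 2 * h ^+ 2 by rewrite /r; ring.
by rewrite mulr_ge0 ?sqr_ge0.
Qed.

(* Chebyshev's inequality one face at a time: t is the coin-free sum and k the
   number of coins so far; a face adds at most 1 and p to their variances. *)
Lemma conv_lower_invariant phi (C a b N : R) : nnm phi -> 0 <= C -> 0 < a ->
    0 < b ->
    (forall k t, (1 <= C%:E * avg (flips k) (fun z => phi z.2)
        (in2 (t - k%:R * h)%R) +
      (t ^+ 2 / a + (k%:R - p * N) ^+ 2 / b)%:E)%E) ->
  forall i k t, (1 <= C%:E * avg (flips k) (fun z => iter i conv phi z.2)
      (in2 (t - k%:R * h)%R) +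
    (t ^+ 2 / a + (k%:R - p * (N - i%:R)) ^+ 2 / b +
      i%:R * (a^-1 + p / b))%:E)%E.
Proof.
move=> np C0 a0 bb0 H0; elim=> [|i IH] k t.
  by rewrite subr0 mul0r addr0; exact: H0.
pose Av k t := avg (flips k) (fun z => iter i conv phi z.2) (in2 (t - k%:R * h)%R).
have nl : nnm (fun z : R * R => iter i conv phi z.2).
  exact: (nnm_comp measurable_snd (nnm_iter_conv mf f0 i np)).
have nAv k' : nnm (Av k').
  apply: (nnm_comp _ (nnm_avg (flips k') nl)).
  by apply: measurable_in2; exact: measurable_funB.
have nAvt k' : nnm (fun x : R => Av k' (t + x)).
  by apply: nnm_comp (nAv k'); exact: measurable_funD.
have Av0 k' x : (0 <= Av k' x)%E by case: (nAv k').
have E1 : (avg (flips k) (fun z => iter i.+1 conv phi z.2)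
    (in2 (t - k%:R * h)%R) = \int[mu]_x ((rest x)%:E * Av k (t + x)%R) +
    \int[mu]_x ((2 * bump x)%:E * Av k.+1 (t + x)%R))%E.
  have -> : (fun z : R * R => iter i.+1 conv phi z.2) =
      sum_step f (fun z => iter i conv phi z.2).
    by apply/funext => z; rewrite /sum_step /step /= /conv; apply: int_eq.
  rewrite /sum_step avg_step// -/(sum_step f) (sum_step_dec mf f0 c0 h0 fc); last exact: nnm_avg.
  congr (_ + _)%E.
    apply: int_eq => x; congr (_ * avg _ _ _)%E; rewrite /in2; congr pair => /=; ring.
  apply: int_eq => x; have -> : ((2 * bump x)%:E = (bump x)%:E * 2%:E)%E.
    by rewrite -EFinM mulrC.
  rewrite -muleA; congr (_ * _)%E.
  rewrite /Av /= muleA -EFinM mulfV// mul1e.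
  by congr (avg _ _ _ + avg _ _ _)%E; rewrite /in2; congr pair => /=;
    rewrite -?natr1; ring.
pose K (k : nat) := (k%:R - p * (N - i%:R)) ^+ 2 / b + i%:R * (a^-1 + p / b).
have K0 k' : 0 <= K k'.
  by rewrite addr_ge0 ?divr_ge0 ?sqr_ge0 ?mulr_ge0 ?addr_ge0 ?invr_ge0 ?divr_ge0// ltW.
have part (wt : R -> R) (m : R) k' : (forall x, 0 <= wt x) ->
    nnm (fun x => (wt x)%:E) -> (\int[mu]_x (wt x)%:E = m%:E)%E ->
  (m%:E <= C%:E * \int[mu]_x ((wt x)%:E * Av k' (t + x)%R) +
    ((a^-1)%:E * \int[mu]_x ((wt x)%:E * ((t + x) ^+ 2)%:E) + (m * K k')%:E))%E.
  move=> wt0 nwt wtm.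
  have ai0 : 0 <= a^-1 by rewrite invr_ge0 ltW.
  have n1 : nnm (fun x : R => (wt x)%:E * Av k' (t + x)%R)%E by exact: nnmM.
  have n2 : nnm (fun x : R => (wt x)%:E * ((t + x) ^+ 2)%:E)%E.
    by apply: nnmM => //; exact: nnm_sqr.
  have nZ (r : R) (g : R -> \bar R) : 0 <= r -> nnm g -> nnm (fun x => r%:E * g x)%E.
    by move=> r0' ng; apply: nnmM => //; apply: nnm_cst; rewrite lee_fin.
  apply: (@le_trans _ _ (\int[mu]_x (C%:E * ((wt x)%:E * Av k' (t + x)%R) +
      ((a^-1)%:E * ((wt x)%:E * ((t + x) ^+ 2)%:E) + (K k')%:E * (wt x)%:E)))%E).
    rewrite -wtm; apply: int_le => x; first by rewrite lee_fin.
    have := IH k' (t + x); rewrite -/(Av k' (t + x)) -addrA EFinD -/(K k') => H1.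
    rewrite -[leLHS]mule1 (le_trans (lee_wpmul2l _ H1)) ?lee_fin//.
    have q0 : (0 <= ((t + x) ^+ 2 / a)%:E)%E.
      by rewrite lee_fin divr_ge0 ?sqr_ge0// ltW.
    have A0 : (0 <= C%:E * Av k' (t + x)%R)%E by rewrite mule_ge0.
    have Kk0 : (0 <= (K k')%:E)%E by rewrite lee_fin.
    rewrite ge0_muleDr ?adde_ge0// muleCA leeD2l// ge0_muleDr//.
    rewrite [((K k')%:E * _)%E]muleC leeD2r//.
    by rewrite -!EFinM lee_fin le_eqVlt; apply/orP; left; apply/eqP; ring.
  rewrite intD; [|exact: nZ|by apply: nnmD; exact: nZ].
  rewrite intD; [|exact: nZ..].
  by rewrite !intZ// wtm -EFinM [(K k' * m)%R]mulrC.
have q0 : 0 <= 1 - p by rewrite subr_ge0.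
have P1 := part rest (1 - p) k r0 nrest massr.
have P2 := part (fun x => 2 * bump x) p k.+1
  (fun x => mulr_ge0 (ler0n R 2) (b0 x)) nbump massb.
have E2 : (1%:E = (1 - p)%:E + p%:E)%E by rewrite -EFinD subrK.
rewrite E2; apply: le_trans (leeD P1 P2) _.
have ai0 : 0 <= a^-1 by rewrite invr_ge0 ltW.
have comb (I1 I2 J1 J2 : \bar R) (X u v : R) : (0 <= I1 -> 0 <= I2 -> 0 <= J1 ->
    0 <= J2 -> J1 + J2 <= X%:E ->
    C%:E * I1 + ((a^-1)%:E * J1 + u%:E) + (C%:E * I2 + ((a^-1)%:E * J2 + v%:E)) <=
    C%:E * (I1 + I2) + (a^-1 * X + (u + v))%:E)%E.
  move=> I10 I20 J10 J20 JX.
  rewrite addeACA -ge0_muleDr// leeD2l// addeACA -ge0_muleDr// !EFinD leeD2r//.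
  by rewrite EFinM lee_wpmul2l// lee_fin.
rewrite E1; apply: le_trans (comb _ _ _ _ _ _ _ _ _ _ _ (rest_bump_sqr t)) _.
- by apply: int_ge0 => x; apply: mule_ge0; rewrite ?lee_fin.
- by apply: int_ge0 => x; apply: mule_ge0; rewrite // lee_fin mulr_ge0.
- by apply: int_ge0 => x; apply: mule_ge0; rewrite lee_fin// sqr_ge0.
- by apply: int_ge0 => x; apply: mule_ge0; rewrite lee_fin ?sqr_ge0// mulr_ge0.
apply: leeD => //.
rewrite lee_fin /K -subr_ge0 -[k.+1%:R]natr1 -[i.+1%:R]natr1.
set r := (X in 0 <= X).
have -> : r = p ^+ 2 / b by rewrite /r; field; rewrite !gt_eqF.
by rewrite divr_ge0 ?sqr_ge0// ltW.
Qed.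

Lemma window_flips (j0 t : R) (k : nat) (n : R) : 0 < n ->
    (`|j0| + h) ^+ 2 <= n -> t ^+ 2 <= 4 * n -> p * n / 2 <= k%:R ->
    20 / (p * h ^+ 2) <= k%:R ->
  exists i : nat, [/\ (i <= k)%N,
    j0 - h <= t - k%:R * h + 2 * h *+ i < j0 + h &
    (k%:R - 2 * i%:R) ^+ 2 <= 20 / (p * h ^+ 2) * k%:R].
Proof.
move=> n0 jn tn kn kK.
set i := Num.ceil ((j0 - h - t + k%:R * h) / (2 * h)).
have h2 : 0 < 2 * h by rewrite mulr_gt0.
have i1 : j0 - h - t + k%:R * h <= i%:~R * (2 * h).
  by rewrite -ler_pdivrMr// ceil_ge.
have i2 : (i%:~R - 1) * (2 * h) < j0 - h - t + k%:R * h.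
  by rewrite -ltr_pdivlMr//; have := ceilB1_lt ((j0 - h - t + k%:R * h) / (2 * h));
    rewrite intrB.
pose e : R := 2 * i%:~R - k%:R.
have eh : `|e * h| <= `|j0| + h + `|t|.
  have := ler_norm j0; have := lerNnormlW (lexx `|j0|).
  have := ler_norm t; have := lerNnormlW (lexx `|t|).
  by rewrite ler_norml /e; have := h0; move=> *; apply/andP; split; lra.
have eh2 : (e * h) ^+ 2 <= 10 * n.
  rewrite -[leLHS]real_normK ?num_real//.
  apply: (@le_trans _ _ ((`|j0| + h + `|t|) ^+ 2)).
    by rewrite ler_pXn2r ?nnegrE ?addr_ge0// ltW.
  apply: (@le_trans _ _ (2 * ((`|j0| + h) ^+ 2 + t ^+ 2))); last by lra.
  rewrite -[t ^+ 2]real_normK ?num_real// -subr_ge0.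
  have -> : 2 * ((`|j0| + h) ^+ 2 + `|t| ^+ 2) - (`|j0| + h + `|t|) ^+ 2 =
    (`|j0| + h - `|t|) ^+ 2 by ring.
  exact: sqr_ge0.
have ph : 0 < p * h ^+ 2 by rewrite mulr_gt0// exprn_gt0.
have eK : e ^+ 2 <= 20 / (p * h ^+ 2) * k%:R.
  rewrite mulrAC ler_pdivlMr//.
  have : p * (e * h) ^+ 2 <= p * (10 * n) by rewrite ler_pM2l.
  have -> : e ^+ 2 * (p * h ^+ 2) = p * (e * h) ^+ 2 by ring.
  lra.
have ek : `|e| <= k%:R.
  rewrite -(@ler_pXn2r _ 2)// ?nnegrE// real_normK ?num_real//.
  by apply: le_trans eK _; rewrite expr2 ler_wpM2r.
move: ek; rewrite ler_norml => /andP[ek1 ek2].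
have i0 : 0 <= i by rewrite -(ler0z R); rewrite /e in ek1; lra.
have [i' ii'] : exists i' : nat, i = i'%:Z by exists `|i|%N; rewrite gez0_abs.
move: i1 i2 ek1 ek2 eK; rewrite /e ii' => i1 i2 ek1 ek2 eK.
have i1' : j0 - h - t + k%:R * h <= i'%:R * (2 * h) by exact: i1.
have i2' : (i'%:R - 1) * (2 * h) < j0 - h - t + k%:R * h by exact: i2.
have ek2' : 2 * i'%:R - k%:R <= k%:R :> R by exact: ek2.
exists i'; split.
- by rewrite -(ler_nat R); lra.
- by rewrite -mulr_natr; apply/andP; split; lra.
- by rewrite -sqrrN opprB; exact: eK.
Qed.

Lemma conv_lower (j0 : R) : exists2 c1 : R, 0 < c1 & exists N0, forall n, (N0 <= n)%N ->
  ((c1 / Num.sqrt n.+1%:R)%:E <=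
    iter n conv (fun y => ((j0 - h <= y < j0 + h)%R%:R)%:E) 0%R)%E.
Proof.
pose K := 20 / (p * h ^+ 2).
have K0 : 0 < K by rewrite divr_gt0// mulr_gt0// exprn_gt0.
have [cc cc0 ccP] := @bin_center_lb R K (ltW K0).
pose phi (y : R) : \bar R := ((j0 - h <= y < j0 + h)%R%:R)%:E.
have nphi : nnm phi.
  apply: nnm_indic; apply: measurable_and.
    exact: measurable_fun_ler.
  exact: measurable_fun_ltr.
exists (cc / (2 * Num.sqrt 2)); first by rewrite divr_gt0// mulr_gt0// sqrtr_gt0.
pose B := (`|j0| + h) ^+ 2 + 16 / p + 2 * (K + 16 * K + 1) / p.
have b1 : 0 <= 16 / p by rewrite divr_ge0// ltW.
have b2 : 0 <= 2 * (K + 16 * K + 1) / p by rewrite divr_ge0 ?(ltW p0)//; lra.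
exists (Num.truncn B).+1 => n nB; rewrite -/phi.
have {}nB : B <= n%:R.
  apply: (@le_trans _ _ (Num.truncn B).+1%:R); first exact/ltW/truncnS_gt.
  by rewrite ler_nat.
have pB : p * B <= p * n%:R by rewrite ler_pM2l.
have pBE : p * B = p * (`|j0| + h) ^+ 2 + 16 + 2 * (K + 16 * K + 1).
  by rewrite /B; field; rewrite gt_eqF.
have jB : (`|j0| + h) ^+ 2 <= n%:R.
  by apply: le_trans nB; rewrite /B -addrA lerDl addr_ge0.
have jp : 0 <= p * (`|j0| + h) ^+ 2 by rewrite mulr_ge0 ?sqr_ge0// ltW.
have n0 : 0 < n%:R :> R.
  by rewrite -(pmulr_rgt0 _ p0); lra.
have pn16 : 16 <= p * n%:R by lra.
have pnK : 2 * (K + 16 * K + 1) <= p * n%:R by lra.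
pose C := Num.sqrt (2 * n%:R) / cc.
have s2n : 0 < Num.sqrt (2 * n%:R) :> R by rewrite sqrtr_gt0 mulr_gt0.
have C0 : 0 < C by rewrite divr_gt0.
have pn0 : 0 < p * n%:R by rewrite mulr_gt0.
have base k t : (1 <= C%:E * avg (flips k) (fun z => phi z.2) (in2 (t - k%:R * h)%R) +
    (t ^+ 2 / (4 * n%:R) + (k%:R - p * n%:R) ^+ 2 / (4 * (p * n%:R)))%:E)%E.
  have a0 : (0 <= C%:E * avg (flips k) (fun z => phi z.2) (in2 (t - k%:R * h)%R))%E.
    by rewrite mule_ge0 ?lee_fin ?(ltW C0)// avg_ge0// => z; case: nphi.
  have t0 : 0 <= t ^+ 2 / (4 * n%:R) by rewrite divr_ge0 ?sqr_ge0// mulr_ge0.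
  have k0 : 0 <= (k%:R - p * n%:R) ^+ 2 / (4 * (p * n%:R)).
    by rewrite divr_ge0 ?sqr_ge0// mulr_ge0// ltW.
  have [tn|tn] := leP (4 * n%:R) (t ^+ 2).
    apply: le_trans (leeD a0 (lexx _)); rewrite add0e lee_fin.
    have : 1 <= t ^+ 2 / (4 * n%:R) by rewrite ler_pdivlMr ?mul1r// mulr_gt0.
    lra.
  have [kn|kn] := leP (4 * (p * n%:R)) ((k%:R - p * n%:R) ^+ 2).
    apply: le_trans (leeD a0 (lexx _)); rewrite add0e lee_fin.
    have : 1 <= (k%:R - p * n%:R) ^+ 2 / (4 * (p * n%:R)).
      by rewrite ler_pdivlMr ?mul1r// mulr_gt0.
    lra.
  have pp : 16 * (p * n%:R) <= (p * n%:R) ^+ 2 by rewrite expr2 ler_pM2r.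
  have k1 : p * n%:R / 2 <= k%:R.
    rewrite leNgt; apply/negP => kl.
    have : (p * n%:R / 2) ^+ 2 <= (p * n%:R - k%:R) ^+ 2.
      by rewrite ler_pXn2r ?nnegrE//; lra.
    have -> : (p * n%:R - k%:R) ^+ 2 = (k%:R - p * n%:R) ^+ 2 by ring.
    have -> : (p * n%:R / 2) ^+ 2 = (p * n%:R) ^+ 2 / 4 by field.
    lra.
  have k2 : k%:R <= 2 * n%:R :> R.
    apply: (@le_trans _ _ (2 * (p * n%:R))); last first.
      by rewrite ler_pM2l// ler_piMl// ltW.
    rewrite leNgt; apply/negP => kl.
    have : (p * n%:R) ^+ 2 <= (k%:R - p * n%:R) ^+ 2.
      by rewrite ler_pXn2r ?nnegrE//; lra.
    lra.
  have kK : K <= k%:R by have := K0; lra.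
  have [i [ik iJ iK]] := window_flips n0 jB (ltW tn) k1 kK.
  apply: (@le_trans _ _ (C * (cc / Num.sqrt (2 * n%:R)))%:E).
    by rewrite lee_fin /C mulrA divfK ?divff ?gt_eqF.
  rewrite -[leLHS]adde0; apply: leeD; last by rewrite lee_fin addr_ge0.
  rewrite EFinM lee_wpmul2l ?lee_fin ?(ltW C0)//.
  have P0 (z : R * R) : (0 <= phi z.2)%E by case: nphi.
  have := avg_nseq_ge (Psi := fun z => phi z.2) (2 * h) (in2 (t - k%:R * h)) ik P0.
  rewrite {1}/phi /= iJ mule1; apply: le_trans; rewrite lee_fin.
  have k0N : (0 < k)%N by rewrite -(ltr_nat R); have := K0; lra.
  apply: le_trans (ccP k i k0N _ ik iK); last by lra.
  have sk : 0 < Num.sqrt k%:R :> R by rewrite sqrtr_gt0 ltr0n.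
  by rewrite ler_wpM2l ?(ltW cc0)// lef_pV2 ?posrE// ler_wsqrtr.
have n40 : 0 < 4 * n%:R :> R by rewrite mulr_gt0.
have bb0 : 0 < 4 * (p * n%:R) by rewrite mulr_gt0.
have := conv_lower_invariant nphi (ltW C0) n40 bb0 base n 0%N 0.
rewrite /= mul0r !subr0 subrr mulr0 subr0 expr0n /= !mul0r !add0r.
have -> : n%:R * ((4 * n%:R)^-1 + p / (4 * (p * n%:R))) = 2^-1.
  by field; rewrite !gt_eqF.
have CE : cc / (2 * Num.sqrt 2) / Num.sqrt n.+1%:R <= 2^-1 / C.
  have -> : 2^-1 / C = cc / (2 * Num.sqrt (2 * n%:R)).
    by rewrite /C; field; rewrite !gt_eqF.
  have posA : 0 < 2 * Num.sqrt (2 * n%:R) :> R by rewrite mulr_gt0.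
  have posB : 0 < 2 * Num.sqrt 2 * Num.sqrt n.+1%:R :> R.
    by rewrite !mulr_gt0 ?sqrtr_gt0.
  rewrite -mulrA ler_wpM2l ?(ltW cc0)// -invfM lef_pV2 ?posrE//.
  by rewrite -mulrA ler_pM2l// -sqrtrM// ler_wsqrtr// ler_pM2l// ler_nat.
have : (0 <= iter n conv phi 0%R)%E by apply: iter_conv_ge0 => // x; case: nphi.
case: (iter n conv phi 0) => [r _|_ _|]//; last by rewrite leey.
rewrite -EFinM -EFinD !lee_fin => H; apply: le_trans CE _.
rewrite ler_pdivrMr//; lra.
Qed.

End sum_density_lower_bound.

(** * Concentration of the sum of the F(a_i) *)

Section lebesgue_plane.
Context {R : realType}.

Definition lebesgue2 := (@lebesgue_measure R \x @lebesgue_measure R)%E.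

HB.instance Definition _ := Measure.on lebesgue2.

Lemma lebesgue2_sigma_finite : sigma_finite setT lebesgue2.
Proof.
have /sigma_finiteP[B [TB ndB Bfin]] := sigma_finiteT (@lebesgue_measure R).
exists (fun n => B n `*` B n) => [|n].
  apply/esym; rewrite -subTset => -[x y] _.
  have [n _ Bx] : (\bigcup_n B n) x by rewrite -TB.
  have [m _ By] : (\bigcup_n B n) y by rewrite -TB.
  exists (maxn n m) => //; split => /=.
    by move: x Bx; exact/subsetPset/ndB/leq_maxl.
  by move: y By; exact/subsetPset/ndB/leq_maxr.
have [mB Bn] := Bfin n; split; first exact: measurableX.
by rewrite /lebesgue2 product_measure1E//= lte_mul_pinfty// ge0_fin_numE.
Qed.

HB.instance Definition _ := Measure_isSigmaFinite.Build _ _ _ lebesgue2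
  lebesgue2_sigma_finite.

End lebesgue_plane.

Section pair_flips.
Context {R : realType}.
Local Notation mu := (@lebesgue_measure R).
Local Notation mu2 := (@lebesgue2 R).
Variables (f F : R -> R).
Hypotheses (mf : measurable_fun [set: R] f) (f0 : forall x, 0 <= f x).
Hypothesis f1 : (\int[mu]_x (f x)%:E = 1)%E.
Hypothesis mF : measurable_fun [set: R] F.
Variables (c h al be eta : R).
Hypotheses (c0 : 0 < c) (h0 : 0 < h) (eta0 : 0 < eta).
Hypothesis fal : forall x, al - 2 * h < x <= al + 2 * h -> c <= f x.
Hypothesis fbe : forall x, be - 2 * h < x <= be + 2 * h -> c <= f x.
Hypothesis flipF : forall x y, al - h < x <= al + h -> be - h < y <= be + h ->
  eta <= F (x + h) + F (y - h) - (F (x - h) + F (y + h)).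

Local Notation ba := (bump c h al).
Local Notation bb := (bump c h be).
Local Notation p := (weight c h ^+ 2 / 2).

Definition pair_state (r s : R -> R) (o : R * R) : R * R :=
  (o.1 + o.2, F (r o.1) + F (s o.2)).
Definition pair_weight (o : R * R) : R := f o.1 * f o.2.
Definition pair_bump (o : R * R) : R := ba o.1 * bb o.2.
Definition pair_rest (o : R * R) : R :=
  f o.1 * f o.2 - ba (o.1 + h) * bb (o.2 - h) - ba (o.1 - h) * bb (o.2 + h).

Let mbump a k : measurable_fun setT (fun x : R => bump c h a (x + k)).
Proof. by apply: (measurableT_comp (measurable_bump c h a)); exact: measurable_funD. Qed.

Let m1 (g : R -> R) : measurable_fun setT g ->
  measurable_fun setT (fun o : R * R => g o.1).
Proof. by move=> mg; exact: (measurableT_comp mg measurable_fst). Qed.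

Let m2 (g : R -> R) : measurable_fun setT g ->
  measurable_fun setT (fun o : R * R => g o.2).
Proof. by move=> mg; exact: (measurableT_comp mg measurable_snd). Qed.

Lemma measurable_pair_state r s : measurable_fun setT r -> measurable_fun setT s ->
  measurable_fun setT (pair_state r s).
Proof.
move=> mr ms; apply: measurable_fun_pair; first exact: measurable_funD.
apply: measurable_funD; first exact: (m1 (measurableT_comp mF mr)).
exact: (m2 (measurableT_comp mF ms)).
Qed.

Lemma measurable_pair_weight : measurable_fun setT pair_weight.
Proof. by apply: measurable_funM; [exact: m1|exact: m2]. Qed.

Lemma measurable_pair_bump : measurable_fun setT pair_bump.
Proof.
apply: measurable_funM; first exact: (m1 (measurable_bump c h al)).
exact: (m2 (measurable_bump c h be)).
Qed.

Lemma measurable_pair_rest : measurable_fun setT pair_rest.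
Proof.
apply: measurable_funB; first apply: measurable_funB.
- exact: measurable_pair_weight.
- apply: measurable_funM; first exact: (m1 (mbump al h)).
  exact: (m2 (mbump be (- h))).
- apply: measurable_funM; first exact: (m1 (mbump al (- h))).
  exact: (m2 (mbump be h)).
Qed.

Lemma pair_weight_ge0 o : 0 <= pair_weight o.
Proof. by rewrite mulr_ge0. Qed.

Lemma pair_bump_ge0 o : 0 <= pair_bump o.
Proof. by rewrite mulr_ge0// bump_ge0. Qed.

Lemma pair_rest_ge0 o : 0 <= pair_rest o.
Proof.
case: o => x y; rewrite /pair_rest /=.
have bE a t : bump c h a t = 0 \/ bump c h a t = c /\ a - h < t <= a + h.
  rewrite /bump; case: (boolP (a - h < t <= a + h)) => _.
    by right; rewrite mulr1.
  by left; rewrite mulr0.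
have := h0; have := c0 => c0' h0'.
have [->|[-> /andP[x1 x2]]] := bE al (x + h).
  have [->|[-> /andP[x1 x2]]] := bE al (x - h).
    by rewrite !mul0r !subr0 mulr_ge0.
  have [->|[-> /andP[y1 y2]]] := bE be (y + h).
    by rewrite !mul0r mulr0 !subr0 mulr_ge0.
  rewrite mul0r subr0 subr_ge0 ler_pM ?(ltW c0)//; [apply: fal|apply: fbe]; apply/andP; split; lra.
have -> : ba (x - h) = 0.
  by have [//|[_ /andP[x3 x4]]] := bE al (x - h); lra.
rewrite mul0r subr0.
have [->|[-> /andP[y1 y2]]] := bE be (y - h).
  by rewrite mulr0 subr0 mulr_ge0.
rewrite subr_ge0 ler_pM ?(ltW c0)//; [apply: fal|apply: fbe]; apply/andP; split; lra.
Qed.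

Lemma int2_addr (a b : R) (Phi : R * R -> \bar R) : nnm Phi ->
  (\int[mu2]_o Phi (o.1 + a, o.2 + b)%R = \int[mu2]_o Phi o)%E.
Proof.
move=> nP.
have nab : nnm (fun o : R * R => Phi (o.1 + a, o.2 + b)%R).
  apply: nnm_comp nP; apply: measurable_fun_pair.
    by apply: (m1 (g := fun x => x + a)); exact: measurable_funD.
  by apply: (m2 (g := fun x => x + b)); exact: measurable_funD.
have nsec (x : R) : nnm (fun y : R => Phi (x, y)).
  by apply: (nnm_comp _ nP); exact: measurable_fun_pair.
case: (nP) => mP P0; case: (nab) => mab ab0.
transitivity (\int[mu]_x \int[mu]_y Phi (x + a, y + b)%R)%E.
  exact: (fubini_tonelli1 (m1 := mu) (m2 := mu) _ mab ab0).
transitivity (\int[mu]_x \int[mu]_y Phi (x, y))%E; last first.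
  exact/esym/(fubini_tonelli1 (m1 := mu) (m2 := mu) _ mP P0).
transitivity (\int[mu]_x \int[mu]_y Phi (x + a, y)%R)%E.
  by apply: int_eq => x; rewrite (int_addr b (nsec (x + a))).
have ni : nnm (fun x : R => \int[mu]_y Phi (x, y))%E.
  by apply: nnm_int; apply: nnm_comp nP; exact: measurable_fun_pair.
exact: (int_addr a ni).
Qed.

Lemma pair_step_dec Psi z : nnm Psi ->
  (step mu2 pair_weight (pair_state id id) Psi z =
   step mu2 pair_rest (pair_state id id) Psi z +
   \int[mu2]_o ((pair_bump o)%:E *
     (Psi (z + pair_state (fun x => x - h) (fun y => y + h) o)%R +
      Psi (z + pair_state (fun x => x + h) (fun y => y - h) o)%R)))%E.
Proof.
move=> nP.
have nPs r s : measurable_fun setT r -> measurable_fun setT s ->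
    nnm (fun o : R * R => Psi (z + pair_state r s o)%R).
  move=> mr ms; apply: nnm_comp nP; apply: measurable_addZ => //.
  exact: measurable_pair_state.
have P0 t : (0 <= Psi t)%E by case: nP.
have mD k : measurable_fun setT (fun x : R => x + k) by exact: measurable_funD.
have nbp : nnm (fun o : R * R => (pair_bump o)%:E).
  by apply: nnm_EFin; [exact: measurable_pair_bump|exact: pair_bump_ge0].
have nr : nnm (fun o : R * R => (pair_rest o)%:E).
  by apply: nnm_EFin; [exact: measurable_pair_rest|exact: pair_rest_ge0].
have nid := nPs id id (@measurable_id _ _ _) (@measurable_id _ _ _).
pose A (a b : R) (o : R * R) := ((ba (o.1 + a) * bb (o.2 + b))%:E *
  Psi (z + pair_state id id o)%R)%E.
have nA a b : nnm (A a b).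
  apply: nnmM => //; apply: nnm_EFin => [|o]; last by rewrite mulr_ge0 ?bump_ge0.
  by apply: measurable_funM; [exact: (m1 (mbump al a))|exact: (m2 (mbump be b))].
transitivity (\int[mu2]_o ((pair_rest o)%:E * Psi (z + pair_state id id o)%R +
    (A h (- h)%R o + A (- h)%R h o)))%E.
  apply: int_eq => o; rewrite /A -!ge0_muleDl ?lee_fin ?pair_rest_ge0//.
  - rewrite -!EFinD; congr ((_)%:E * _)%E; rewrite /pair_rest /pair_weight; ring.
  - by rewrite addr_ge0// mulr_ge0 ?bump_ge0.
  - by rewrite mulr_ge0 ?bump_ge0.
  - by rewrite mulr_ge0 ?bump_ge0.
rewrite intD; [|exact: (nnmM nr nid)|exact: (nnmD (nA h (- h)) (nA (- h) h))].
congr (_ + _)%E; rewrite intD; [|exact: nA..].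
have nbA := nnmM nbp (nPs _ _ (mD (- h)) (mD h)).
have nbB := nnmM nbp (nPs _ _ (mD h) (mD (- h))).
transitivity (\int[mu2]_o
    ((pair_bump o)%:E * Psi (z + pair_state (fun x => x - h) (fun y => y + h) o)%R +
     (pair_bump o)%:E * Psi (z + pair_state (fun x => x + h) (fun y => y - h) o)%R))%E;
  last by apply: int_eq => o; rewrite ge0_muleDr.
rewrite intD// -(int2_addr (- h) h (nA h (- h)))
  -(int2_addr h (- h) (nA (- h) h)).
congr (_ + _)%E; apply: int_eq => o; rewrite /A /pair_bump /pair_state /=.
  by rewrite subrK addrK; congr (_ * Psi (_ + (_, _))%R)%E; ring.
by rewrite subrK addrK; congr (_ * Psi (_ + (_, _))%R)%E; ring.
Qed.

Lemma int2_prod (g k : R -> R) (m n : R) :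
    measurable_fun setT g -> measurable_fun setT k ->
    (forall x, 0 <= g x) -> (forall x, 0 <= k x) ->
    (\int[mu]_x (g x)%:E = m%:E)%E -> (\int[mu]_x (k x)%:E = n%:E)%E ->
  (\int[mu2]_o (g o.1 * k o.2)%:E = (m * n)%:E)%E.
Proof.
move=> mg mk g0 k0 gm kn.
have n0 : 0 <= n by rewrite -lee_fin -kn; apply: int_ge0 => x; rewrite lee_fin.
have ngk : nnm (fun o : R * R => (g o.1 * k o.2)%:E).
  apply: nnm_EFin => [|o]; last by rewrite mulr_ge0.
  by apply: measurable_funM; [exact: m1|exact: m2].
case: ngk => mgk gk0.
transitivity (\int[mu]_x \int[mu]_y (g x * k y)%:E)%E.
  exact: (fubini_tonelli1 (m1 := mu) (m2 := mu) _ mgk gk0).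
transitivity (\int[mu]_x ((g x)%:E * n%:E))%E.
  apply: int_eq => x; under int_eq do rewrite EFinM.
  by rewrite intZ ?kn//; exact: nnm_EFin.
by rewrite intZr ?gm//; exact: nnm_EFin.
Qed.

Lemma int_pair_bump : (\int[mu2]_o (2 * pair_bump o)%:E = p%:E)%E.
Proof.
transitivity (\int[mu2]_o ((2^-1)%:E * ((2 * ba o.1) * (2 * bb o.2))%:E))%E.
  by apply: int_eq => o; rewrite -EFinM /pair_bump; congr EFin; field.
have mb a : measurable_fun setT (fun x => 2 * bump c h a x).
  by apply: measurable_funM => //; exact: measurable_bump.
have b0 a x : 0 <= 2 * bump c h a x by rewrite mulr_ge0 ?bump_ge0.
rewrite intZ ?invr_ge0//; last first.
  apply: nnm_EFin => [|o]; last by rewrite mulr_ge0.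
  by apply: measurable_funM; [exact: (m1 (mb al))|exact: (m2 (mb be))].
have -> := int2_prod (mb al) (mb be) (b0 al) (b0 be) (int_bump al c0 h0)
  (int_bump be c0 h0).
by rewrite -EFinM; congr EFin; field.
Qed.

Lemma int_pair_rest : (\int[mu2]_o (pair_rest o)%:E = (1 - p)%:E)%E.
Proof.
have := @pair_step_dec (cst 1%E) 0 (nnm_cst _ lee01); rewrite /step.
under int_eq do rewrite mule1.
rewrite (int2_prod mf mf f0 f0 f1 f1) mulr1.
under [X in (_ = X + _)%E]int_eq do rewrite mule1.
under [X in (_ = _ + X)%E]int_eq do rewrite /cst -EFinD muleC -EFinM.
rewrite int_pair_bump => E.
have : (\int[mu2]_o (pair_rest o)%:E)%E \is a fin_num.
  rewrite ge0_fin_numE; last by apply: int_ge0 => x; rewrite lee_fin pair_rest_ge0.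
  rewrite (@le_lt_trans _ _ 1%E) ?ltry// E leeDl// lee_fin.
  by rewrite divr_ge0// exprn_ge0// ltW// weight_gt0.
move: E => /[swap] /fineK <-; rewrite -EFinD => -[E].
by congr EFin; lra.
Qed.

Lemma pair_stepE Psi z : nnm Psi ->
  step mu2 pair_weight (pair_state id id) Psi z = face_step f F (face_step f F Psi) z.
Proof.
move=> nP.
have mps := measurable_pair_state (@measurable_id _ _ _) (@measurable_id _ _ _).
have [ms s0] := nnm_step_section measurable_pair_weight pair_weight_ge0 mps z nP.
transitivity (\int[mu]_x \int[mu]_y ((pair_weight (x, y))%:E *
    Psi (z + pair_state id id (x, y))%R))%E.
  exact: (fubini_tonelli1 (m1 := mu) (m2 := mu) _ ms s0).
apply: int_eq => x /=; rewrite -intZ//; last first.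
  by apply: nnm_step_section => //; exact: measurable_pair0.
apply: int_eq => y; rewrite /pair_weight /= EFinM muleA; congr (_ * Psi _)%E.
by rewrite -addrA.
Qed.

Lemma iter_pair_step Psi n z : nnm Psi ->
  iter n (step mu2 pair_weight (pair_state id id)) Psi z =
  iter (n + n) (face_step f F) Psi z.
Proof.
move=> nP; elim: n z => // n IH z; rewrite addnS /=.
rewrite -pair_stepE; last exact: nnm_iter_face_step.
by congr (step _ _ _ _ _); apply/funext.
Qed.

Lemma avg_fst ds Psi Phi (s t : R) : (forall t, Psi (s, t) = Phi (s, t)) ->
  avg ds Psi (s, t) = avg ds Phi (s, t).
Proof.
move=> E; elim: ds t => [|dl ds IH] t //=; rewrite IH.
have -> : (s, t) + (0, dl) = (s, t + dl) by congr pair; rewrite /= addr0.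
by rewrite IH.
Qed.

Lemma avg_windows (w : R) N ds (z : R * R) : all (>= eta) ds ->
  (avg ds (fun z => ((w <= z.2 < w + N%:R * eta)%R%:R)%:E) z <=
    (N%:R * LObound (size ds))%:E)%E.
Proof.
move=> dse; elim: N => [|N IH].
  rewrite mul0r addr0; apply: (@le_trans _ _ (avg ds (fun=> 0%E) z)).
    apply: avg_le => z'; rewrite (_ : (_ && _) = false)//.
    by apply/negP => /andP[? ?]; lra.
  rewrite mul0r.
  by elim: ds {dse} z => // dl ds IH z /=; rewrite -[leRHS](mule0 (2^-1)%:E)
    lee_wpmul2l ?lee_fin// -[leRHS]add0e leeD.
apply: (@le_trans _ _ (avg ds (fun z =>
   (((w <= z.2 < w + N%:R * eta)%R%:R)%:E +
    ((w + N%:R * eta <= z.2 < w + N%:R * eta + eta)%R%:R)%:E)%E) z)).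
  apply: avg_le => z'; rewrite -EFinD lee_fin -natrD ler_nat.
  rewrite -natr1; have := eta0; have : 0 <= N%:R * eta by rewrite mulr_ge0// ltW.
  case: (leP w z'.2); case: (ltP z'.2 (w + N%:R * eta));
  case: (ltP z'.2 (w + (N%:R + 1) * eta)); case: (ltP z'.2 (w + N%:R * eta + eta)) => //=; lra.
rewrite avgD// -natr1 mulrDl mul1r EFinD leeD//.
exact: avg_window.
Qed.

(* The last face of a die of face-sum 0 is minus the sum of the other ones. *)
Definition phi0 (y : R) : \bar R := (f (- y))%:E.

Definition conc (x K : R) (z : R * R) : \bar R :=
  (phi0 z.1 * ((`|z.2 + F (- z.1) - x| <= K)%R%:R)%:E)%E.

Lemma nnm_phi0 : nnm phi0.
Proof.
by apply: nnm_EFin => [|y]//; exact: (measurableT_comp mf (@oppr_measurable _ _)).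
Qed.

Lemma nnm_conc x K : nnm (conc x K).
Proof.
apply: nnmM; first exact: (nnm_comp measurable_fst nnm_phi0).
apply: nnm_indic; apply: measurable_fun_ler => //.
apply: (measurableT_comp (@normr_measurable _ _)).
apply: measurable_funB => //; apply: measurable_funD => //.
apply: (m1 (g := fun s => F (- s))).
exact: (measurableT_comp mF (@oppr_measurable _ _)).
Qed.

Lemma iter_conc_le (x K D : R) n l z : 0 <= D ->
    (forall y, iter l (conv f) phi0 y <= D%:E)%E ->
  (iter (n + n + l) (face_step f F) (conc x K) z <=
    ((Num.truncn (2 * K / eta)).+1%:R * D / Num.sqrt (1 + n%:R * (p / 2)))%:E)%E.
Proof.
move=> D0 Dl; set N := (Num.truncn (2 * K / eta)).+1.
have nc := nnm_conc x K.
have nl : nnm (iter l (face_step f F) (conc x K)) by exact: nnm_iter_face_step.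
have N0 : 0 <= N%:R * D by rewrite mulr_ge0.
rewrite iterD -iter_pair_step//.
have FB : flip_bound eta (fun j => N%:R * D * LObound j)
    (iter l (face_step f F) (conc x K)).
  move=> ds z' dse.
  have -> : avg ds (iter l (face_step f F) (conc x K)) z' =
      iter l (face_step f F) (avg ds (conc x K)) z'.
    elim: (l) z' => // l' IH z' /=; rewrite avg_step//; last 2 first.
      exact: measurable_pair0.
      exact: nnm_iter_face_step.
    by congr (step _ _ _ _ _); apply/funext.
  have L0 : 0 <= LObound (size ds) :> R by rewrite invr_ge0 sqrtr_ge0.
  pose C := N%:R * @LObound R (size ds).
  have C0 : 0 <= C by rewrite mulr_ge0.
  have av s : (avg ds (conc x K) s <= C%:E * phi0 s.1)%E.
    case: s => s t.
    rewrite (avg_fst ds (Phi := fun z => (phi0 s * ((`|z.2 + F (- s) - x| <= K)%R%:R)%:E)%E))//.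
    have p0 : (0 <= phi0 s)%E by case: nnm_phi0.
    rewrite avgZ// muleC lee_wpmul2r//.
    apply: le_trans (avg_windows (x - F (- s) - K) N _ dse).
    apply: avg_le => z''; rewrite lee_fin ler_nat.
    case: (boolP (`|_| <= K)) => // /[!ler_norml] /andP[k1 k2].
    rewrite lt0n; apply/eqP => /eqP; rewrite eqb0 => /negP; apply.
    apply/andP; split; first by lra.
    have : 2 * K < N%:R * eta by rewrite -ltr_pdivrMr// truncnS_gt.
    lra.
  apply: (@le_trans _ _ (iter l (face_step f F) (fun z => C%:E * phi0 z.1)%E z')).
    elim: (l) z' => // l' IH z' /=; apply: step_le => // z''.
    by case: (nnm_iter_face_step mf f0 l' mF (nnm_avg ds nc)).
  rewrite (iter_face_step_fst f F (fun y => C%:E * phi0 y)%E).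
  rewrite iter_convZ//; last exact: nnm_phi0.
  apply: le_trans (lee_wpmul2l _ (Dl _)) _; first by rewrite lee_fin.
  by rewrite -EFinM lee_fin /C mulrAC.
have := avg_iter_le (mu := mu2) (th := pair_state id id)
  (th1 := pair_state (fun x => x - h) (fun y => y + h))
  (th2 := pair_state (fun x => x + h) (fun y => y - h)) (eta := eta) (p := p)
  measurable_pair_weight measurable_pair_rest measurable_pair_bump
  pair_weight_ge0 pair_rest_ge0 pair_bump_ge0
  (measurable_pair_state (@measurable_id _ _ _) (@measurable_id _ _ _))
  _ _ pair_step_dec _ _ n (ds := [::]) z N0 nl FB isT.
apply.
- by rewrite divr_ge0// exprn_ge0// ltW// weight_gt0.
- case=> s t; rewrite /pair_bump /bump /=.
  case: (boolP (al - h < s <= al + h)) => [sI|_]; last by rewrite mulr0 mul0r eqxx.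
  case: (boolP (be - h < t <= be + h)) => [tI|_]; last by rewrite !mulr0 eqxx.
  move=> _; exists (F (s + h) + F (t - h) - (F (s - h) + F (t + h))).
    exact: flipF.
  by rewrite /pair_state /=; congr pair; rewrite /= ?addr0//; ring.
- by rewrite int_pair_rest.
- by rewrite int_pair_bump.
Qed.

End pair_flips.

(** * Second moments given a zero face-sum *)

Section second_moment.
Context {R : realType}.
Local Notation mu := (@lebesgue_measure R).
Variables (f : R -> R).
Hypotheses (mf : measurable_fun [set: R] f) (f0 : forall x, 0 <= f x).
Hypothesis f1 : (\int[mu]_x (f x)%:E = 1)%E.

Section iter_face_step.
Variable rho : R -> R.
Hypothesis mrho : measurable_fun setT rho.
Local Notation S := (face_step f rho).

Lemma iter_face_step_ge0 Psi n z : nnm Psi -> (0 <= iter n S Psi z)%E.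
Proof. by move=> nP; case: (nnm_iter_face_step mf f0 n mrho nP). Qed.

Lemma iter_face_step_le Psi Phi n z : nnm Psi ->
  (forall z, Psi z <= Phi z)%E -> (iter n S Psi z <= iter n S Phi z)%E.
Proof.
move=> nP PQ; elim: n z => // n IH z /=.
by apply: step_le => // z'; exact: iter_face_step_ge0.
Qed.

Lemma iter_face_stepD Psi Phi n z : nnm Psi -> nnm Phi ->
  (iter n S (fun z => Psi z + Phi z) z = iter n S Psi z + iter n S Phi z)%E.
Proof.
move=> nP nQ; elim: n z => // n IH z /=.
rewrite /face_step -stepD//; last 3 first.
- exact: measurable_pair0.
- exact: nnm_iter_face_step.
- exact: nnm_iter_face_step.
by congr (step _ _ _ _ _); apply/funext.
Qed.

Lemma iter_face_stepZ k Psi n z : 0 <= k -> nnm Psi ->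
  (iter n S (fun z => k%:E * Psi z) z = k%:E * iter n S Psi z)%E.
Proof.
move=> k0 nP; elim: n z => // n IH z /=.
rewrite /face_step -stepZ//; last 2 first.
- exact: measurable_pair0.
- exact: nnm_iter_face_step.
by congr (step _ _ _ _ _); apply/funext.
Qed.

Lemma iter_face_step_shift Psi n c z :
  iter n S (fun z => Psi (z + c)) z = iter n S Psi (z + c).
Proof.
elim: n z => // n IH z /=; rewrite /face_step -step_shift.
by congr (step _ _ _ _ _); apply/funext.
Qed.

End iter_face_step.

Lemma iter_face_step_exchange rho1 rho2 Psi m n z :
    measurable_fun setT rho1 -> measurable_fun setT rho2 -> nnm Psi ->
  iter m (face_step f rho1) (iter n (face_step f rho2) Psi) z =
  iter n (face_step f rho2) (iter m (face_step f rho1) Psi) z.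
Proof.
move=> mr1 mr2 nP.
have one Phi z' : nnm Phi ->
    face_step f rho1 (iter n (face_step f rho2) Phi) z' =
    iter n (face_step f rho2) (face_step f rho1 Phi) z'.
  move=> nQ; elim: n z' => // n' IH z' /=.
  rewrite [LHS]step_exchange//; last 3 first.
  - exact: measurable_pair0.
  - exact: measurable_pair0.
  - exact: nnm_iter_face_step.
  by congr (step _ _ _ _ _); apply/funext.
elim: m z => // m IH z /=.
rewrite -one; last exact: nnm_iter_face_step.
by congr (step _ _ _ _ _); apply/funext.
Qed.

Lemma iter_face_step0 Psi n s t :
  iter n (face_step f (fun=> 0)) Psi (s, t) =
  iter n (conv f) (fun s => Psi (s, t)) s.
Proof.
elim: n s => // n IH s /=; rewrite /face_step /step /conv; apply: int_eq => x.
have -> : (s, t) + (x, 0) = (s + x, t) by congr pair; rewrite /= addr0.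
by rewrite IH.
Qed.

Variables (rho : R -> R) (v : R).
Hypothesis mrho : measurable_fun setT rho.
Hypothesis v0 : 0 <= v.
Hypothesis rho2 : forall t : R,
  (\int[mu]_x ((f x)%:E * ((t + rho x) ^+ 2)%:E) = (t ^+ 2 + v)%:E)%E.
Local Notation S := (face_step f rho).

Definition sqr2 (z : R * R) : \bar R := (z.2 ^+ 2)%:E.

Lemma nnm_sqr2 : nnm sqr2.
Proof.
apply: nnm_EFin => [|z]; last exact: sqr_ge0.
by apply: measurable_funX; exact: measurable_snd.
Qed.

Lemma iter_sqr2 n z : iter n S sqr2 z = (z.2 ^+ 2 + n%:R * v)%:E.
Proof.
elim: n z => [|n IH] z; first by rewrite mul0r addr0.
rewrite iterS /face_step /step.
have nv : 0 <= n%:R * v by rewrite mulr_ge0.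
transitivity (\int[mu]_x ((f x)%:E * ((z.2 + rho x) ^+ 2)%:E +
    (n%:R * v)%:E * (f x)%:E))%E.
  apply: int_eq => x; rewrite IH EFinD ge0_muleDr ?lee_fin ?sqr_ge0//.
  by congr (_ + _)%E; rewrite muleC.
have nf : nnm (fun x : R => (f x)%:E) by exact: nnm_EFin.
rewrite intD; last 2 first.
- apply: nnmM => //; apply: nnm_EFin => [|x]; last exact: sqr_ge0.
  by apply: measurable_funX; exact: measurable_funD.
- by apply: nnmM => //; apply: nnm_cst; rewrite lee_fin.
rewrite rho2 intZ// f1 mule1 -EFinD; congr EFin.
by rewrite -natr1; ring.
Qed.

Let nphi0 : nnm (phi0 f). Proof. exact: nnm_phi0. Qed.

Definition moment (z : R * R) : \bar R :=
  (phi0 f z.1 * ((z.2 + rho (- z.1)) ^+ 2)%:E)%E.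

Lemma nnm_moment : nnm moment.
Proof.
apply: nnmM; first exact: (nnm_comp measurable_fst nphi0).
apply: nnm_EFin => [|z]; last exact: sqr_ge0.
apply: measurable_funX; apply: measurable_funD; first exact: measurable_snd.
have mr : measurable_fun setT (fun s : R => rho (- s)).
  exact: (measurableT_comp mrho (@oppr_measurable _ _)).
exact: (measurableT_comp mr measurable_fst).
Qed.

Lemma iter_moment_le (B D1 D2 : R) n1 n2 : 0 <= D1 -> 0 <= D2 ->
    (forall x, `|rho x| <= B) ->
    (forall y, iter n1 (conv f) (phi0 f) y <= D1%:E)%E ->
    (forall y, iter n2 (conv f) (phi0 f) y <= D2%:E)%E ->
  (iter (n1 + n2) S moment (0%R, 0%R) <=
    (3 * (D2 * (n1%:R * v) + D1 * (n2%:R * v)))%:E +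
    (3 * B ^+ 2)%:E * iter (n1 + n2) (conv f) (phi0 f) 0%R)%E.
Proof.
move=> D10 D20 rB H1 H2.
pose Q (z : R * R) := (phi0 f z.1 * sqr2 z)%E.
have nph1 : nnm (fun z : R * R => phi0 f z.1).
  exact: (nnm_comp measurable_fst nphi0).
have nQ : nnm Q by apply: nnmM => //; exact: nnm_sqr2.
pose chi (s : R) := iter n2 S Q (s, 0 : R).
have nchi : nnm chi.
  apply: (nnm_comp _ (nnm_iter_face_step mf f0 n2 mrho nQ)).
  exact: measurable_fun_pair.
have B20 : 0 <= 3 * B ^+ 2 by rewrite mulr_ge0// sqr_ge0.
have c30 : 0 <= 3 :> R by [].
have nZ (k : R) (Phi : R * R -> \bar R) : 0 <= k -> nnm Phi ->
    nnm (fun z => k%:E * Phi z)%E.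
  by move=> k0 nP; apply: nnmM => //; apply: nnm_cst; rewrite lee_fin.
have stepA s t : (iter n2 S moment (s, t) <=
    (3 * D2)%:E * sqr2 (s, t) + ((3 * B ^+ 2)%:E * iter n2 (conv f) (phi0 f) s +
      3%:E * chi s))%E.
  have -> : (s, t) = (s, 0) + (0, t) by congr pair; rewrite /= ?addr0 ?add0r.
  rewrite -iter_face_step_shift.
  have t20 : 0 <= 3 * t ^+ 2 + 3 * B ^+ 2 by rewrite addr_ge0// mulr_ge0// sqr_ge0.
  apply: (@le_trans _ _ (iter n2 S (fun z =>
      (3 * t ^+ 2 + 3 * B ^+ 2)%:E * phi0 f z.1 + 3%:E * Q z)%E (s, 0))).
    apply: iter_face_step_le => //.
      by apply: nnm_shift; exact: nnm_moment.
    case=> s' t'; rewrite /moment /Q /sqr2 /phi0 /= addr0.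
    rewrite -!EFinM -EFinD lee_fin.
    have := rB (- s'); rewrite ler_norml => /andP[r1 r2].
    set r := rho (- s') in r1 r2 *; have fs : 0 <= f (- s') by [].
    have rB2 : r ^+ 2 <= B ^+ 2.
      have Bp : 0 <= B by exact: le_trans (normr_ge0 _) (rB (- s')).
      by rewrite -real_normK ?num_real// ler_pXn2r ?nnegrE//; exact: rB.
    have : (t' + t + r) ^+ 2 <= 3 * t ^+ 2 + 3 * B ^+ 2 + 3 * t' ^+ 2.
      apply: (@le_trans _ _ (3 * (t ^+ 2 + r ^+ 2 + t' ^+ 2))); last by lra.
      rewrite -subr_ge0; set d := (X in 0 <= X).
      have -> : d = (t - r) ^+ 2 + (t - t') ^+ 2 + (r - t') ^+ 2 by rewrite /d; ring.
      by rewrite !addr_ge0// sqr_ge0.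
    move=> H; apply: le_trans (ler_wpM2l fs H) _.
    by rewrite le_eqVlt; apply/orP; left; apply/eqP; ring.
  rewrite iter_face_stepD//; [|exact: nZ|exact: nZ].
  rewrite !iter_face_stepZ//.
  rewrite (iter_face_step_fst f rho (phi0 f)) /=.
  rewrite addeA; apply: leeD => //.
  have tt : 0 <= 3 * t ^+ 2 by rewrite mulr_ge0// sqr_ge0.
  rewrite EFinD ge0_muleDl ?lee_fin//; apply: leeD => //.
  rewrite muleC; apply: (@le_trans _ _ (D2%:E * (3 * t ^+ 2)%:E)%E).
    by apply: lee_wpmul2r => //; rewrite lee_fin mulr_ge0// sqr_ge0.
  by rewrite /sqr2 /= add0r -!EFinM lee_fin le_eqVlt; apply/orP; left; apply/eqP; ring.
have nc2 : nnm (fun z : R * R => iter n2 (conv f) (phi0 f) z.1).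
  exact: (nnm_comp measurable_fst (nnm_iter_conv mf f0 n2 nphi0)).
have nch1 : nnm (fun z : R * R => chi z.1).
  exact: (nnm_comp measurable_fst nchi).
have chiE : (iter n1 (conv f) chi 0%R <= (D1 * (n2%:R * v))%:E)%E.
  have m0 : measurable_fun setT (fun _ : R => (0 : R)) by [].
  rewrite -(iter_face_step0 (iter n2 S Q) n1 0 0).
  rewrite iter_face_step_exchange//.
  apply: (@le_trans _ _ (iter n2 S (fun z => D1%:E * sqr2 z)%E (0, 0))).
    apply: iter_face_step_le => //.
      exact: nnm_iter_face_step.
    case=> s t; rewrite iter_face_step0 /Q /sqr2 /=.
    have -> : (fun s => phi0 f s * (t ^+ 2)%:E)%E = (fun s => (t ^+ 2)%:E * phi0 f s)%E.
      by apply/funext => s'; rewrite muleC.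
    by rewrite iter_convZ ?sqr_ge0// muleC lee_wpmul2r// lee_fin sqr_ge0.
  rewrite iter_face_stepZ//; last exact: nnm_sqr2.
  by rewrite iter_sqr2 /= expr0n add0r -EFinM.
rewrite iterD.
apply: (@le_trans _ _ (iter n1 S (fun z => (3 * D2)%:E * sqr2 z +
    ((3 * B ^+ 2)%:E * iter n2 (conv f) (phi0 f) z.1 + 3%:E * chi z.1))%E (0, 0))).
  apply: iter_face_step_le => //; last by case=> s t; exact: stepA.
  by apply: nnm_iter_face_step => //; exact: nnm_moment.
have n1' := nZ (3 * D2) _ (mulr_ge0 c30 D20) nnm_sqr2.
have n2' := nZ _ _ B20 nc2.
have n3' := nZ _ _ c30 nch1.
rewrite iter_face_stepD//; last exact: nnmD.
have d20 : 0 <= 3 * D2 by rewrite mulr_ge0.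
have ns := nnm_sqr2.
rewrite iter_face_stepD// !iter_face_stepZ//.
rewrite iter_sqr2 (iter_face_step_fst f rho) (iter_face_step_fst f rho chi) /=.
rewrite expr0n/= add0r -iterD.
set b := (X in (_ + (X + _) <= _)%E); rewrite (addeC b) addeA.
apply: leeD => //; rewrite mulrDr [leRHS]EFinD; apply: leeD.
  by rewrite -EFinM lee_fin mulrA.
by rewrite [leRHS]EFinM lee_wpmul2l.
Qed.

End second_moment.

(** * Integrals over dice of face-sum zero *)

Section tuple_integral.
Context {R : realType}.
Local Notation mu := (@lebesgue_measure R).
Local Notation ti := tuple_integral.

Lemma measurable_cons_pair d (Y : measurableType d) m (x : Y -> R)
    (v : Y -> m.-tuple R) : measurable_fun setT x -> measurable_fun setT v ->
  measurable_fun setT (fun y => [tuple of x y :: v y]).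
Proof. exact: measurable_cons. Qed.

Lemma nnm_cons m (g : m.+1.-tuple R -> \bar R) x : nnm g ->
  nnm (fun v : m.-tuple R => g [tuple of x :: v]).
Proof. by apply: nnm_comp; exact: measurable_cons_pair. Qed.

Lemma nnm_ti d (Y : measurableType d) m (g : Y -> m.-tuple R -> \bar R) :
  nnm (fun p : Y * m.-tuple R => g p.1 p.2) -> nnm (fun y => ti (g y)).
Proof.
elim: m d Y g => [|m IH] d Y g ng /=.
  apply: (nnm_comp (h := fun y => (y, [tuple])) _ ng).
  exact: measurable_fun_pair.
apply: nnm_int; apply: (IH _ _ (fun q v => g q.1 [tuple of q.2 :: v])).
apply: (nnm_comp (h := fun q : (Y * R) * m.-tuple R =>
  (q.1.1, [tuple of q.1.2 :: q.2])) _ ng).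
apply: measurable_fun_pair.
  exact: (measurableT_comp measurable_fst measurable_fst).
apply: measurable_cons_pair => //.
exact: (measurableT_comp measurable_snd measurable_fst).
Qed.

Lemma nnm_ti_cons m (g : m.+1.-tuple R -> \bar R) : nnm g ->
  nnm (fun x : R => ti (fun v : m.-tuple R => g [tuple of x :: v])).
Proof.
move=> ng; apply: nnm_ti.
apply: (nnm_comp (h := fun q : R * m.-tuple R => [tuple of q.1 :: q.2]) _ ng).
exact: measurable_cons_pair.
Qed.

Lemma ti_ge0 m (g : m.-tuple R -> \bar R) :
  (forall v, 0 <= g v)%E -> (0 <= ti g)%E.
Proof.
by elim: m g => [|m IH] g g0 //=; apply: int_ge0 => x; exact: IH.
Qed.

Lemma ti_le m (g k : m.-tuple R -> \bar R) : (forall v, 0 <= g v)%E ->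
  (forall v, g v <= k v)%E -> (ti g <= ti k)%E.
Proof.
elim: m g k => [|m IH] g k g0 gk //=.
by apply: int_le => x; [exact: ti_ge0|exact: IH].
Qed.

Lemma ti_eq m (g k : m.-tuple R -> \bar R) : g =1 k -> ti g = ti k.
Proof. by move=> /funext ->. Qed.

Lemma tiD m (g k : m.-tuple R -> \bar R) : nnm g -> nnm k ->
  ti (fun v => g v + k v)%E = (ti g + ti k)%E.
Proof.
elim: m g k => [|m IH] g k ng nk //=.
rewrite -intD; [|exact: nnm_ti_cons..].
by apply: int_eq => x; rewrite -IH//; exact: nnm_cons.
Qed.

Lemma tiZ m (c : R) (g : m.-tuple R -> \bar R) : 0 <= c -> nnm g ->
  ti (fun v => c%:E * g v)%E = (c%:E * ti g)%E.
Proof.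
move=> c0; elim: m g => [|m IH] g ng //=.
rewrite -intZ//; last exact: nnm_ti_cons.
by apply: int_eq => x; rewrite -IH//; exact: nnm_cons.
Qed.

Lemma ti_int_exchange m (g : m.-tuple R -> R -> \bar R) :
  nnm (fun p : m.-tuple R * R => g p.1 p.2) ->
  ti (fun v => \int[mu]_y g v y)%E = (\int[mu]_y ti (g ^~ y))%E.
Proof.
elim: m g => [|m IH] g ng //=.
transitivity (\int[mu]_x \int[mu]_y
    ti (fun v : m.-tuple R => g [tuple of x :: v] y))%E.
  apply: int_eq => x; rewrite IH//.
  apply: (nnm_comp (h := fun q : m.-tuple R * R => ([tuple of x :: q.1], q.2)) _ ng).
  by apply: measurable_fun_pair => //; exact: measurable_cons_pair.
rewrite (int_exchange mu mu (g := fun x y => ti (fun v : m.-tuple R =>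
  g [tuple of x :: v] y)))//.
apply: (nnm_ti (g := fun (q : R * R) (v : m.-tuple R) => g [tuple of q.1 :: v] q.2)).
apply: (nnm_comp (h := fun q : (R * R) * m.-tuple R =>
  ([tuple of q.1.1 :: q.2], q.1.2)) _ ng).
apply: measurable_fun_pair.
  apply: measurable_cons_pair => //.
  exact: (measurableT_comp measurable_fst measurable_fst).
exact: (measurableT_comp measurable_snd measurable_fst).
Qed.

Lemma ti_iter (f rho : R -> R) m k Psi z : measurable_fun setT f ->
    (forall x, 0 <= f x) -> measurable_fun setT rho -> 0 <= k -> nnm Psi ->
  ti (fun v : m.-tuple R => ((k * \prod_(i < m) f (tnth v i))%:E *
    Psi (z + (\sum_(i < m) tnth v i, \sum_(i < m) rho (tnth v i)))%R)%E) =
  (k%:E * iter m (face_step f rho) Psi z)%E.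
Proof.
move=> mf f0 mr + nP; elim: m k z => [|m IH] k z k0.
  rewrite /= !big_ord0 mulr1; congr (_ * Psi _)%E.
  by case: z => s t; congr pair; rewrite /= addr0.
rewrite iterS /face_step /step -intZ//; last first.
  apply: nnm_step_section => //; first exact: measurable_pair0.
  exact: nnm_iter_face_step.
apply: int_eq => x; rewrite muleA -EFinM -IH ?mulr_ge0//.
apply: ti_eq => v; rewrite !big_ord_recl !tnth0 mulrA.
congr ((_ * _)%:E * Psi _)%E.
  by apply: eq_bigr => i _; rewrite tnthS.
rewrite -addrA; congr (_ + (_, _))%R; congr (_ + _);
  by apply: eq_bigr => i _; rewrite tnthS.
Qed.

Lemma big_die_of (V : nmodType) m (v : m.-tuple R) s (g : R -> V) :
  \sum_(i < m.+1) g (tnth (die_of v s) i) =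
  \sum_(i < m) g (tnth v i) + g (s - \sum_(i < m) tnth v i).
Proof.
rewrite big_ord_recr /=; congr (_ + _).
  apply: eq_bigr => i _; congr g.
  by rewrite !(tnth_nth 0)/= nth_rcons size_tuple ltn_ord.
by congr g; rewrite (tnth_nth 0)/= nth_rcons size_tuple ltnn eqxx.
Qed.

Lemma die_density_die_of (f : R -> R) m (v : m.-tuple R) s :
  die_density f (die_of v s) =
  (\prod_(i < m) f (tnth v i)) * f (s - \sum_(i < m) tnth v i).
Proof.
rewrite /die_density big_ord_recr /=; congr (_ * _).
  apply: eq_bigr => i _; congr f.
  by rewrite !(tnth_nth 0)/= nth_rcons size_tuple ltn_ord.
by congr f; rewrite (tnth_nth 0)/= nth_rcons size_tuple ltnn eqxx.
Qed.

Lemma measurable_sum_tnth m (g : R -> R) : measurable_fun setT g ->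
  measurable_fun setT (fun v : m.-tuple R => \sum_(i < m) g (tnth v i)).
Proof.
move=> mg; apply: measurable_sum => i.
exact: (measurableT_comp mg (measurable_tnth i)).
Qed.

Lemma measurable_die_of m :
  measurable_fun setT (fun v : m.-tuple R => die_of v 0).
Proof.
apply/measurable_fun_tnthP => i.
have [im|im] := ltnP i m.
  rewrite (_ : _ \o _ = fun v : m.-tuple R => tnth v (Ordinal im)).
    exact: measurable_tnth.
  by apply/funext => v /=; rewrite !(tnth_nth 0)/= nth_rcons size_tuple im.
rewrite (_ : _ \o _ = fun v : m.-tuple R => 0 - \sum_(j < m) tnth v j).
  apply: measurable_funB => //.
  exact: (measurable_sum_tnth (@measurable_id _ _ _)).
apply/funext => v /=; rewrite !(tnth_nth 0)/= nth_rcons size_tuple ltnNge im/=.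
have -> : i = m :> nat by apply/eqP; rewrite eqn_leq im -ltnS ltn_ord.
by rewrite eqxx.
Qed.

Lemma measurable_die_density (f : R -> R) m : measurable_fun setT f ->
  measurable_fun setT (fun a : m.-tuple R => die_density f a).
Proof.
move=> mf; apply: measurable_prod => i _.
exact: (measurableT_comp mf (measurable_tnth i)).
Qed.

End tuple_integral.

Section zero_sum.
Context {R : realType}.
Local Notation mu := (@lebesgue_measure R).
Local Notation ti := tuple_integral.
Variables (f : R -> R).
Hypotheses (mf : measurable_fun [set: R] f) (f0 : forall x, 0 <= f x).

Lemma die_density_ge0 n (a : die R n) : 0 <= die_density f a.
Proof. exact: prodr_ge0. Qed.

(* Integral of H over dice of face-sum 0: the expectation of H given a zero
   face-sum, times the density [zmass] of the face-sum at 0. *)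
Definition zs m (H : die R m.+1 -> \bar R) : \bar R :=
  ti (fun v : m.-tuple R => ((die_density f (die_of v 0))%:E * H (die_of v 0))%E).

Let mdd m : measurable_fun setT (fun v : m.-tuple R => die_density f (die_of v 0)).
Proof.
apply: (measurableT_comp (f := fun a : m.+1.-tuple R => die_density f a)
  (g := fun v : m.-tuple R => die_of v 0 : m.+1.-tuple R)).
  exact: measurable_die_density.
exact: measurable_die_of.
Qed.

Lemma nnm_zs_integrand m H : nnm H ->
  nnm (fun v : m.-tuple R => ((die_density f (die_of v 0))%:E * H (die_of v 0))%E).
Proof.
move=> nH; apply: nnmM.
  by apply: nnm_EFin => [|v]; [exact: mdd|exact: die_density_ge0].
exact: (nnm_comp (@measurable_die_of R m) nH).
Qed.

Lemma nnm_zs d (Y : measurableType d) m (H : Y -> die R m.+1 -> \bar R) :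
  nnm (fun p : Y * m.+1.-tuple R => H p.1 p.2) -> nnm (fun y => zs (H y)).
Proof.
move=> nH; apply: (nnm_ti (g := fun y (v : m.-tuple R) =>
  ((die_density f (die_of v 0))%:E * H y (die_of v 0))%E)).
apply: nnmM.
  apply: nnm_EFin => [|p]; last exact: die_density_ge0.
  exact: (measurableT_comp (@mdd m) measurable_snd).
apply: (nnm_comp (h := fun p : Y * m.-tuple R => (p.1, die_of p.2 0)) _ nH).
apply: measurable_fun_pair => //.
exact: (measurableT_comp (@measurable_die_of R m) measurable_snd).
Qed.

Lemma zs_ge0 m (H : die R m.+1 -> \bar R) : (forall a, 0 <= H a)%E -> (0 <= zs H)%E.
Proof.
by move=> H0; apply: ti_ge0 => v; rewrite mule_ge0// lee_fin die_density_ge0.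
Qed.

Lemma zs_le m (H K : die R m.+1 -> \bar R) : (forall a, 0 <= H a)%E ->
  (forall a, H a <= K a)%E -> (zs H <= zs K)%E.
Proof.
move=> H0 HK; apply: ti_le => v.
  by rewrite mule_ge0// lee_fin die_density_ge0.
by rewrite lee_wpmul2l// lee_fin die_density_ge0.
Qed.

Lemma zs_eq m (H K : die R m.+1 -> \bar R) : H =1 K -> zs H = zs K.
Proof. by move=> /funext ->. Qed.

Lemma zsD m (H K : die R m.+1 -> \bar R) : nnm H -> nnm K ->
  zs (fun a => H a + K a)%E = (zs H + zs K)%E.
Proof.
move=> nH nK; rewrite /zs -tiD; [|exact: nnm_zs_integrand..].
by apply: ti_eq => v; rewrite ge0_muleDr//; [case: nH|case: nK].
Qed.

Lemma zsZ m c (H : die R m.+1 -> \bar R) : 0 <= c -> nnm H ->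
  zs (fun a => c%:E * H a)%E = (c%:E * zs H)%E.
Proof.
move=> c0 nH; rewrite /zs -tiZ//; last exact: nnm_zs_integrand.
by apply: ti_eq => v; rewrite muleCA.
Qed.

Lemma zs_int_exchange m (H : die R m.+1 -> R -> \bar R) :
  nnm (fun p : m.+1.-tuple R * R => H p.1 p.2) ->
  zs (fun a => \int[mu]_y H a y)%E = (\int[mu]_y zs (H ^~ y))%E.
Proof.
move=> nH; rewrite /zs.
have nH' : nnm (fun p : m.-tuple R * R => H (die_of p.1 0) p.2).
  apply: (nnm_comp (h := fun p : m.-tuple R * R => (die_of p.1 0, p.2)) _ nH).
  apply: measurable_fun_pair => //.
  exact: (measurableT_comp (@measurable_die_of R m) measurable_fst).
rewrite -ti_int_exchange.
  apply: ti_eq => v; rewrite -intZ//; first exact: die_density_ge0.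
  by apply: (nnm_comp (h := fun y : R => (v, y)) _ nH'); exact: measurable_fun_pair.
apply: nnmM => //; apply: nnm_EFin => [|p]; last exact: die_density_ge0.
exact: (measurableT_comp (@mdd m) measurable_fst).
Qed.

Definition zmass m : \bar R := iter m (conv f) (phi0 f) 0.

Let m0 : measurable_fun setT (fun _ : R => (0 : R)). Proof. by []. Qed.
Let nphi0 : nnm (phi0 f). Proof. exact: nnm_phi0. Qed.

Lemma zs_last m (rho : R -> R) (Phi : R -> R -> \bar R) : measurable_fun setT rho ->
    nnm (fun z : R * R => phi0 f z.1 * Phi z.2 (- z.1)%R)%E ->
  ti (fun v : m.-tuple R => ((die_density f (die_of v 0))%:E *
    Phi (\sum_(i < m) rho (tnth v i))%R (0 - \sum_(i < m) tnth v i)%R)%E) =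
  iter m (face_step f rho) (fun z => phi0 f z.1 * Phi z.2 (- z.1)%R)%E (0, 0).
Proof.
move=> mr nP; have := ti_iter m (0, 0) mf f0 mr ler01 nP; rewrite mul1e => <-.
apply: ti_eq => v; rewrite die_density_die_of EFinM -muleA mul1r.
by congr (_ * _)%E; rewrite /phi0 /= !add0r.
Qed.

Lemma zs_moment m (rho : R -> R) : measurable_fun setT rho ->
  zs (fun a : die R m.+1 => ((\sum_(i < m.+1) rho (tnth a i)) ^+ 2)%:E) =
  iter m (face_step f rho) (moment f rho) (0, 0).
Proof.
move=> mr; rewrite -(zs_last m (Phi := fun t s => ((t + rho s) ^+ 2)%:E) mr).
  by apply: ti_eq => v; rewrite (big_die_of v 0 rho).
exact: nnm_moment.
Qed.

Lemma zs_conc m (F : R -> R) (x K : R) : measurable_fun setT F ->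
  zs (fun a : die R m.+1 =>
    ((`|\sum_(i < m.+1) F (tnth a i) - x| <= K)%R%:R)%:E) =
  iter m (face_step f F) (conc f F x K) (0, 0).
Proof.
move=> mF; rewrite -(zs_last m (Phi := fun t s => ((`|t + F s - x| <= K)%R%:R)%:E) mF).
  by apply: ti_eq => v; rewrite (big_die_of v 0 F).
exact: nnm_conc.
Qed.

Lemma face_sum_densityE m s : face_sum_density f m s = iter m (conv f) (phi0 f) (- s).
Proof.
have n1 : nnm (fun z : R * R => phi0 f z.1).
  exact: (nnm_comp measurable_fst nphi0).
have := ti_iter m (- s, 0) mf f0 m0 ler01 n1; rewrite mul1e.
rewrite (iter_face_step_fst f (fun=> 0) (phi0 f)) /= => <-.
apply: ti_eq => v; rewrite die_density_die_of EFinM mul1r.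
by congr (_ * _)%E; rewrite /phi0 opprD opprK.
Qed.

Lemma zs1 m : zs (fun _ : die R m.+1 => 1%E) = zmass m.
Proof.
rewrite /zmass -oppr0 -face_sum_densityE; apply: ti_eq => v.
by rewrite mule1.
Qed.

End zero_sum.

Lemma quarter_split m : exists n l, [/\ m = (n + n + l)%N,
  (m <= 2 * l + 1)%N & (m.+1 <= 4 * n.+1)%N].
Proof. by exists (m %/ 4)%N, (m - m %/ 4 - m %/ 4)%N; split; lia. Qed.

Section conditional_bounds.
Context {R : realType}.
Local Notation mu := (@lebesgue_measure R).
Variables (f : R -> R).
Hypotheses (mf : measurable_fun [set: R] f) (f0 : forall x, 0 <= f x).
Hypothesis f1 : (\int[mu]_x (f x)%:E = 1)%E.
Hypothesis f2 : forall t : R, (\int[mu]_x ((f x)%:E * ((t + x) ^+ 2)%:E) =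
  (t ^+ 2 + 1)%:E)%E.
Variables (c h al : R).
Hypotheses (c0 : 0 < c) (h0 : 0 < h).
Hypothesis fal : forall x, al - 2 * h < x <= al + 2 * h -> c <= f x.
Variables (m0 : nat) (M : R).
Hypothesis fM : forall y, (iter m0 (conv f) (phi0 f) y <= M%:E)%E.

Let nphi0 : nnm (phi0 f). Proof. exact: nnm_phi0. Qed.

Lemma int_conv phi : nnm phi -> (\int[mu]_x conv f phi x = \int[mu]_x phi x)%E.
Proof.
move=> np.
have nk : nnm (fun q : R * R => (f q.2)%:E * phi (q.1 + q.2)%R)%E.
  apply: nnmM; last by apply: nnm_comp np; exact: measurable_funD.
  by apply: nnm_EFin => //; exact: (measurableT_comp mf measurable_snd).
transitivity (\int[mu]_x \int[mu]_y ((f x)%:E * phi (y + x)%R))%E.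
  exact: (int_exchange mu mu nk).
have [mp p0] := np.
have P0 : (0 <= \int[mu]_y phi y)%E by exact: int_ge0.
transitivity (\int[mu]_x ((f x)%:E * \int[mu]_y phi y))%E.
  apply: int_eq => x; rewrite intZ ?int_addr//.
  by apply: nnm_comp np; exact: measurable_funD.
by rewrite ge0_integralZr// ?f1 ?mul1e//; [exact/measurable_EFinP|move=> x _; rewrite lee_fin].
Qed.

Lemma int_iter_conv n : (\int[mu]_x iter n (conv f) (phi0 f) x = 1)%E.
Proof.
elim: n => [|n IH] /=; last by rewrite int_conv//; exact: nnm_iter_conv.
have nf : nnm (fun x : R => (f x)%:E) by exact: nnm_EFin.
by rewrite /phi0 (int_opp nf).
Qed.

Lemma conv_sup_bound : exists2 C : R, 0 < C & forall m l y, (4 * m0 <= m)%N ->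
  (m <= 2 * l + 1)%N ->
  (iter l (conv f) (phi0 f) y <= (C / Num.sqrt m.+1%:R)%:E)%E.
Proof.
have M0 : 0 <= M.
  by rewrite -lee_fin (le_trans _ (fM 0))//; apply: iter_conv_ge0 => // x; case: nphi0.
have npm : nnm (iter m0 (conv f) (phi0 f)) by exact: nnm_iter_conv.
have i1 : (\int[mu]_x iter m0 (conv f) (phi0 f) x <= 1%:E)%E by rewrite int_iter_conv.
have [C C0 CP] := iter_conv_sup mf f0 f1 c0 h0 fal npm M0 ler01 fM i1.
exists (2 * C) => [|m l y mm lm]; first by rewrite mulr_gt0.
have lE : l = (l - m0 + m0)%N by lia.
have lm' : (m.+1 <= 4 * (l - m0).+1)%N by lia.
rewrite lE iterD; apply: le_trans (CP _ _) _.
have s0 : 0 < Num.sqrt m.+1%:R :> R by rewrite sqrtr_gt0.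
have s1 : 0 < Num.sqrt (l - m0).+1%:R :> R by rewrite sqrtr_gt0.
rewrite lee_fin ler_pdivrMr// mulrAC ler_pdivlMr//.
rewrite [2 * C]mulrC -mulrA ler_pM2l//.
have -> : 2 = Num.sqrt (2 ^+ 2) :> R by rewrite sqrtr_sqr ger0_norm.
rewrite -sqrtrM ?sqr_ge0// ler_wsqrtr//.
by rewrite -natrX -natrM ler_nat.
Qed.

Lemma zmass_fin m : (4 * m0 <= m)%N -> zmass f m \is a fin_num.
Proof.
have [C C0 CP] := conv_sup_bound => mm.
rewrite ge0_fin_numE; last by apply: iter_conv_ge0 => // x; case: nphi0.
by apply: le_lt_trans (CP m m 0 mm _) (ltry _); lia.
Qed.

Lemma zmass_ge : exists2 c1 : R, 0 < c1 & exists N, forall m, (N <= m)%N ->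
  ((c1 / Num.sqrt m.+1%:R)%:E <= zmass f m)%E.
Proof.
pose phi (y : R) : \bar R := ((- al - h <= y < - al + h)%R%:R)%:E.
have [c1 c10 [N NP]] := conv_lower mf f0 f1 c0 h0 fal f2 (- al).
exists (c * c1); first by rewrite mulr_gt0.
exists N => m /NP mN.
have nphi : nnm phi.
  apply: nnm_indic; apply: measurable_and.
    exact: measurable_fun_ler.
  exact: measurable_fun_ltr.
apply: (@le_trans _ _ (iter m (conv f) (fun y => c%:E * phi y)%E 0)).
  rewrite iter_convZ ?(ltW c0)// -mulrA EFinM lee_wpmul2l// lee_fin ltW//.
apply: iter_conv_le => // y.
  by rewrite mule_ge0 ?lee_fin ?(ltW c0).
rewrite /phi /phi0 -EFinM lee_fin.
case: (boolP (- al - h <= y < - al + h)) => [/andP[y1 y2]|_]; last by rewrite mulr0.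
by rewrite mulr1; apply: fal; have := h0; move=> h0'; apply/andP; split; lra.
Qed.

Lemma sup_le_zmass : exists2 C : R, 0 < C & exists N, forall m, (N <= m)%N ->
  exists D, [/\ 0 <= D, (D%:E <= C%:E * zmass f m)%E &
    forall l y, (m <= 2 * l + 1)%N -> (iter l (conv f) (phi0 f) y <= D%:E)%E].
Proof.
have [C C0 CP] := conv_sup_bound.
have [c1 c10 [N NP]] := zmass_ge.
exists (C / c1); first by rewrite divr_gt0.
exists (maxn N (4 * m0)) => m; rewrite geq_max => /andP[Nm mm].
exists (C / Num.sqrt m.+1%:R); split.
- by rewrite divr_ge0 ?sqrtr_ge0// ltW.
- apply: le_trans (lee_wpmul2l _ (NP _ Nm)); last by rewrite lee_fin divr_ge0// ltW.
  by rewrite -EFinM lee_fin mulrA divfK// gt_eqF.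
- by move=> l y lm; exact: CP.
Qed.

Lemma zs_moment_le : exists2 CV : R, 0 <= CV & exists N, forall m, (N <= m)%N ->
  forall (rho : R -> R) (v B : R), measurable_fun setT rho -> 0 <= v ->
    (forall t : R, (\int[mu]_x ((f x)%:E * ((t + rho x) ^+ 2)%:E) =
      (t ^+ 2 + v)%:E)%E) ->
    (forall x, `|rho x| <= B) ->
  (zs f (fun a : die R m.+1 => ((\sum_(i < m.+1) rho (tnth a i)) ^+ 2)%:E) <=
    (CV * (m%:R * v + B ^+ 2))%:E * zmass f m)%E.
Proof.
have [C C0 [N NP]] := sup_le_zmass.
exists (3 * C + 3); first by rewrite addr_ge0// mulr_ge0// ltW.
exists N => m /NP[D [D0 DZ DP]] rho v B mr v0 rho2 rB.
have Z0 : (0 <= zmass f m)%E by apply: iter_conv_ge0 => // x; case: nphi0.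
rewrite zs_moment//.
have mE : m = (m./2 + (m - m./2))%N by lia.
have l1 : (m <= 2 * m./2 + 1)%N by lia.
have l2 : (m <= 2 * (m - m./2) + 1)%N by lia.
have := iter_moment_le mf f0 f1 mr v0 rho2 D0 D0 rB (fun y => DP _ y l1)
  (fun y => DP _ y l2).
rewrite -mE -/(zmass f m) => H; apply: le_trans H _.
rewrite -mulrDr -mulrDl -natrD -mE.
have mv : 0 <= m%:R * v by rewrite mulr_ge0.
have B2 : 0 <= B ^+ 2 by rewrite sqr_ge0.
apply: (@le_trans _ _ ((3 * (m%:R * v))%:E * (C%:E * zmass f m) +
    (3 * B ^+ 2)%:E * zmass f m)%E).
  apply: leeD => //.
  have -> : 3 * (D * (m%:R * v)) = (3 * (m%:R * v)) * D by ring.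
  by rewrite EFinM lee_wpmul2l// lee_fin mulr_ge0.
have a1 : 0 <= 3 * (m%:R * v) * C by rewrite mulr_ge0 ?(ltW C0)// mulr_ge0.
have a2 : 0 <= 3 * B ^+ 2 by rewrite mulr_ge0.
rewrite muleA -EFinM -ge0_muleDl ?lee_fin//.
rewrite -EFinD lee_wpmul2r// lee_fin.
have : 0 <= C * B ^+ 2 by rewrite mulr_ge0// ltW.
have -> : (3 * C + 3) * (m%:R * v + B ^+ 2) = 3 * (m%:R * v) * C + 3 * B ^+ 2 +
  3 * (C * B ^+ 2) + 3 * (m%:R * v) by ring.
lra.
Qed.

Variables (F : R -> R) (be eta : R).
Hypothesis mF : measurable_fun [set: R] F.
Hypothesis eta0 : 0 < eta.
Hypothesis fbe : forall x, be - 2 * h < x <= be + 2 * h -> c <= f x.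
Hypothesis flipF : forall x y, al - h < x <= al + h -> be - h < y <= be + h ->
  eta <= F (x + h) + F (y - h) - (F (x - h) + F (y + h)).

Lemma zs_conc_le K : exists2 CK : R, 0 <= CK & exists N, forall m, (N <= m)%N ->
  forall x, (zs f (fun a : die R m.+1 =>
    ((`|\sum_(i < m.+1) F (tnth a i) - x| <= K)%R%:R)%:E) <=
    (CK / Num.sqrt m.+1%:R)%:E * zmass f m)%E.
Proof.
have [C C0 [N NP]] := sup_le_zmass.
set p := weight c h ^+ 2 / 2.
have w0 : 0 < weight c h by exact: weight_gt0.
have w1 : weight c h <= 1 by exact: (weight_le1 mf f0 f1 c0 h0 fal).
have p0 : 0 < p by rewrite divr_gt0// exprn_gt0.
have p1 : p <= 1.
  rewrite ler_pdivrMr// mul1r; apply: (@le_trans _ _ 1); last by rewrite ler1n.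
  by rewrite expr_le1// ltW.
pose NK : R := (Num.truncn (2 * K / eta)).+1%:R.
have NK0 : 0 <= NK by rewrite /NK.
exists (NK * C / Num.sqrt (p / 8)); first by rewrite divr_ge0 ?sqrtr_ge0// mulr_ge0// ltW.
exists N => m /NP[D [D0 DZ DP]] x.
have Z0 : (0 <= zmass f m)%E by apply: iter_conv_ge0 => // y; case: nphi0.
rewrite zs_conc//.
have [n [l [mE lm nm]]] : exists n l, [/\ m = (n + n + l)%N, (m <= 2 * l + 1)%N &
    (m.+1 <= 4 * n.+1)%N].
  exact: quarter_split.
have := iter_conc_le mf f0 f1 mF c0 h0 eta0 fal fbe flipF x K n (0, 0) D0
  (fun y => DP l y lm).
rewrite -mE -/p -/NK => H; apply: le_trans H _.
have p80 : 0 < p / 8 by exact: divr_gt0.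
have s1 : 0 < Num.sqrt (p / 8) by rewrite sqrtr_gt0.
have s2 : 0 < Num.sqrt m.+1%:R :> R by rewrite sqrtr_gt0.
have np : 0 <= n%:R * (p / 2) by rewrite mulr_ge0// divr_ge0// ltW.
have s3 : Num.sqrt (p / 8) * Num.sqrt m.+1%:R <= Num.sqrt (1 + n%:R * (p / 2)).
  have p8 : 0 <= p / 8 by rewrite divr_ge0// ltW.
  rewrite -sqrtrM// ler_wsqrtr//.
  have H' : p / 8 * m.+1%:R <= p / 8 * (4 * (n%:R + 1)).
    by rewrite ler_pM2l// natr1 -natrM ler_nat.
  apply: le_trans H' _.
  have -> : p / 8 * (4 * (n%:R + 1)) = p / 2 + n%:R * (p / 2) by field.
  by rewrite lerD2r; lra.
have s4 : (Num.sqrt (1 + n%:R * (p / 2)))^-1 <= (Num.sqrt (p / 8) * Num.sqrt m.+1%:R)^-1.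
  rewrite lef_pV2 ?posrE ?mulr_gt0//.
  by rewrite (lt_le_trans _ s3)// mulr_gt0.
apply: (@le_trans _ _ ((NK / (Num.sqrt (p / 8) * Num.sqrt m.+1%:R))%:E * D%:E)%E).
  rewrite -EFinM lee_fin mulrAC ler_wpM2r// ler_wpM2l//.
apply: (@le_trans _ _ ((NK / (Num.sqrt (p / 8) * Num.sqrt m.+1%:R))%:E *
    (C%:E * zmass f m))%E).
  by rewrite lee_wpmul2l// lee_fin divr_ge0// mulr_ge0 ?sqrtr_ge0.
rewrite muleA -EFinM lee_wpmul2r// lee_fin le_eqVlt; apply/orP; left; apply/eqP.
by field; rewrite !gt_eqF.
Qed.

End conditional_bounds.

(** * The law of a face *)

Section layer_cake.
Context {R : realType}.
Local Notation mu := (@lebesgue_measure R).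

Lemma int_itv (a b : R) : a <= b ->
  (\int[mu]_t (((a < t <= b)%R : bool)%:R)%:E = (b - a)%:E)%E.
Proof.
move=> ab; rewrite (_ : (fun t => _) = EFin \o \1_(`]a, b])); last first.
  by apply/funext => t /=; rewrite indicE mem_setE in_itv.
rewrite integral_indic//= setIT lebesgue_measure_itv/= lte_fin.
case: ltP => // ba; rewrite (_ : b = a) ?subrr//.
by apply/eqP; rewrite eq_le ba.
Qed.

Lemma nnm_layer d (T : measurableType d) (g : T -> R) : measurable_fun setT g ->
  nnm (fun p : T * R => (((0 < p.2 <= g p.1)%R : bool)%:R : R)%:E).
Proof.
move=> mg; apply: nnm_indic; apply: measurable_and.
  exact: measurable_fun_ltr.
apply: measurable_fun_ler => //.
exact: (measurableT_comp mg measurable_fst).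
Qed.

End layer_cake.

Section law_with_density.
Context {R : realType}.
Local Notation mu := (@lebesgue_measure R).
Context d (T : measurableType d) (P : probability T R) (X : {RV P >-> R}).
Variable f : R -> R.
Hypothesis hf : has_density X f.

Let mf : measurable_fun [set: R] f. Proof. by case: hf. Qed.
Let f0 x : 0 <= f x. Proof. by case: hf. Qed.
Let nf : nnm (fun x : R => (f x)%:E). Proof. exact: nnm_EFin. Qed.
Let mX : measurable_fun setT X. Proof. exact: measurable_funPT. Qed.

Lemma density_indic (A : R -> bool) : measurable_fun setT A ->
  (\int[P]_o ((A (X o))%:R)%:E = \int[mu]_x ((f x)%:E * ((A x)%:R)%:E))%E.
Proof.
move=> mA; have mA' : measurable [set x | A x].
  by rewrite -[W in measurable W]setTI; exact: mA.
have -> : (\int[mu]_x ((f x)%:E * ((A x)%:R)%:E) =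
    \int[mu]_(x in [set x | A x]) (f x)%:E)%E.
  rewrite [RHS]integral_mkcond; apply: int_eq => x; rewrite /patch.
  have -> : (x \in [set y | A y]) = A x by apply/idP/idP; rewrite inE.
  by case: (A x); rewrite ?mule1 ?mule0.
have mXA : measurable (X @^-1` [set x | A x]) by exact: measurable_funPTI.
have [_ _ hA] := hf; rewrite -(hA _ mA') /distribution /pushforward.
rewrite -[W in _ = P W]setIT -integral_indic//.
by apply: int_eq => o; rewrite indicE mem_setE.
Qed.

Lemma density_ge0 (g : R -> R) : measurable_fun setT g -> (forall x, 0 <= g x) ->
  (\int[P]_o (g (X o))%:E = \int[mu]_x ((f x)%:E * (g x)%:E))%E.
Proof.
move=> mg g0.
have ngX := nnm_layer (measurableT_comp mg mX).
have ng := nnm_layer mg.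
transitivity (\int[P]_o \int[mu]_t (((0 < t <= g (X o))%R : bool)%:R)%:E)%E.
  by apply: int_eq => o; rewrite int_itv ?subr0.
transitivity (\int[mu]_t \int[P]_o (((0 < t <= g (X o))%R : bool)%:R)%:E)%E.
  exact: (int_exchange P mu ngX).
transitivity (\int[mu]_t \int[mu]_x
    ((f x)%:E * (((0 < t <= g x)%R : bool)%:R)%:E))%E.
  apply: int_eq => t; apply: (density_indic (A := fun x => 0 < t <= g x)).
  by apply: measurable_and; [exact: measurable_cst|exact: measurable_fun_ler].
have nfg : nnm (fun p : R * R => (f p.1)%:E *
    (((0 < p.2 <= g p.1)%R : bool)%:R : R)%:E)%E.
  apply: nnmM => //; apply: nnm_EFin => //.
  exact: (measurableT_comp mf measurable_fst).
transitivity (\int[mu]_x \int[mu]_t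
    ((f x)%:E * (((0 < t <= g x)%R : bool)%:R)%:E))%E.
  exact/esym/(int_exchange mu mu nfg).
apply: int_eq => x; rewrite intZ ?int_itv ?subr0//.
by apply: (nnm_comp (h := fun t : R => (x, t)) _ ng); exact: measurable_fun_pair.
Qed.

Lemma density_int1 : (\int[mu]_x (f x)%:E = 1)%E.
Proof. by have [_ _ <-//] := hf; exact: probability_setT. Qed.

Lemma int_sqr_shift (Y : T -> R) (v t : R) :
    P.-integrable setT (EFin \o Y) ->
    (\int[P]_o (Y o)%:E = 0)%E -> (\int[P]_o ((Y o) ^+ 2)%:E = v%:E)%E ->
  (\int[P]_o ((t + Y o) ^+ 2)%:E = (t ^+ 2 + v)%:E)%E.
Proof.
move=> iY Y1 Y2.
have mY : measurable_fun setT Y by apply/measurable_EFinP; case/integrableP: iY.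
have iY2 : P.-integrable setT (EFin \o (fun o => Y o ^+ 2)).
  apply/integrableP; split; first by apply/measurable_EFinP; exact: measurable_funX.
  rewrite (_ : (\int[P]_x _ = v%:E)%E) ?ltry// -Y2.
  by apply: int_eq => o /=; rewrite ger0_norm// sqr_ge0.
have it2 : P.-integrable setT (EFin \o cst (t ^+ 2)).
  exact: finite_measure_integrable_cst.
have i2t : P.-integrable setT (fun o => (2 * t)%:E * (EFin \o Y) o)%E.
  exact: integrableZl.
transitivity (\int[P]_o ((Y o ^+ 2)%:E + ((2 * t)%:E * (Y o)%:E + (t ^+ 2)%:E)))%E.
  by apply: int_eq => o; rewrite -EFinM -!EFinD; congr EFin; ring.
rewrite integralD//; last exact: integrableD.
rewrite integralD// integralZl// Y1 mule0 add0e Y2.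
by rewrite integral_cst//= probability_setT mule1 -EFinD addrC.
Qed.

Hypotheses (hmean : ('E_P[X] = 0)%E) (hvar : ('V_P[X] = 1)%E).
Hypothesis hmoments : (X : T -> R) \in Lfun P 6%:E.

Lemma face_integrable : P.-integrable setT (EFin \o X).
Proof.
apply/Lfun1_integrable; apply: Lfun_subset hmoments => //.
- by rewrite lee_fin ler1n.
- exact: fin_num_measure.
- by rewrite lee_fin ler1n.
Qed.

Lemma face_second_moment t :
  (\int[mu]_x ((f x)%:E * ((t + x) ^+ 2)%:E) = (t ^+ 2 + 1)%:E)%E.
Proof.
rewrite -(density_ge0 (g := fun x => (t + x) ^+ 2)); last 2 first.
- by apply: measurable_funX; exact: measurable_funD.
- by move=> x; exact: sqr_ge0.
apply: int_sqr_shift; first exact: face_integrable.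
- by rewrite -hmean expectation_def.
- rewrite -hvar /variance covariance.unlock hmean expectation.unlock.
  apply: int_eq => o; congr EFin.
  by rewrite -[RHS]/((X o - 0) * (X o - 0)) subr0 expr2.
Qed.

Definition centered (Y : T -> R) :=
  P.-integrable setT (EFin \o Y) /\ (\int[P]_o (Y o)%:E = 0)%E.

Lemma centered_sum (I : Type) (s : seq I) (Y : I -> T -> R) :
  (forall i, centered (Y i)) -> centered (fun o => \sum_(i <- s) Y i o).
Proof.
move=> cY; elim: s => [|i s [iS S0]].
  rewrite (_ : (fun o => _) = cst 0); last by apply/funext => o; rewrite big_nil.
  split; last by rewrite integral0_eq.
  exact: finite_measure_integrable_cst.
have [iY Y0] := cY i; pose Z o := \sum_(i <- s) Y i o.
rewrite (_ : (fun o => _) = (fun o => Y i o + Z o)); last first.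
  by apply/funext => o; rewrite big_cons.
split; first exact: (integrableD measurableT iY iS).
transitivity (\int[P]_o ((Y i o)%:E + (Z o)%:E))%E; first by apply: int_eq => o.
by rewrite (integralD measurableT iY iS) Y0 S0 adde0.
Qed.

Lemma centered_second_moment (rho : R -> R) (B : R) : measurable_fun setT rho ->
    (forall x, `|rho x| <= B) -> centered (rho \o X) ->
  exists2 v : R, 0 <= v & (\int[mu]_x ((f x)%:E * (rho x ^+ 2)%:E) = v%:E)%E /\
    forall t, (\int[mu]_x ((f x)%:E * ((t + rho x) ^+ 2)%:E) = (t ^+ 2 + v)%:E)%E.
Proof.
move=> mr rB [iY Y0].
have mr2 t : measurable_fun setT (fun x => (t + rho x) ^+ 2).
  by apply: measurable_funX; exact: measurable_funD.
have mr20 : measurable_fun setT (fun x => rho x ^+ 2) by exact: measurable_funX.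
pose I := (\int[mu]_x ((f x)%:E * (rho x ^+ 2)%:E))%E.
have B2 : 0 <= B ^+ 2 by rewrite sqr_ge0.
have IB : (I <= (B ^+ 2)%:E)%E.
  apply: (@le_trans _ _ (\int[mu]_x ((B ^+ 2)%:E * (f x)%:E))%E); last first.
    by rewrite intZ// density_int1 mule1.
  apply: int_le => x; first by rewrite mule_ge0 ?lee_fin ?sqr_ge0.
  rewrite muleC lee_wpmul2r ?lee_fin// -real_normK ?num_real//.
  by rewrite ler_pXn2r ?nnegrE ?(le_trans (normr_ge0 _) (rB x)).
have I0 : (0 <= I)%E.
  by apply: int_ge0 => x; rewrite mule_ge0 ?lee_fin ?sqr_ge0.
have If : I \is a fin_num by rewrite ge0_fin_numE// (le_lt_trans IB) ?ltry.
exists (fine I); first by rewrite fine_ge0.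
split => [|t]; first by rewrite fineK.
rewrite -(density_ge0 (mr2 t)); last by move=> x; exact: sqr_ge0.
apply: (int_sqr_shift t iY Y0).
by rewrite (density_ge0 mr20) ?fineK// => x; exact: sqr_ge0.
Qed.

Variable F : R -> R.
Hypothesis hF : forall x, cdf X x = (F x)%:E.

Lemma cdf_F_ge0 (x : R) : 0 <= F x. Proof. by rewrite -lee_fin -hF. Qed.

Lemma cdf_F_le1 (x : R) : F x <= 1.
Proof. by rewrite -lee_fin -hF; exact: cdf_le1. Qed.

Lemma measurable_cdf_F : measurable_fun setT F.
Proof.
have -> : F = fine \o cdf X by apply/funext => x; rewrite /= hF.
by apply: measurableT_comp => //; exact: cdf_measurable.
Qed.

Lemma density_le (x : R) : (\int[mu]_y ((f y)%:E * (((y <= x)%R : bool)%:R)%:E) = (F x)%:E)%E.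
Proof.
rewrite -hF /cdf; have [_ _ ->//] := hf.
rewrite [RHS]integral_mkcond; apply: int_eq => y; rewrite /patch.
rewrite mem_setE in_itv /=.
by case: (y <= x); rewrite ?mule1 ?mule0.
Qed.

Lemma density_lt (x : R) : (\int[mu]_y ((f y)%:E * (((y < x)%R : bool)%:R)%:E) = (F x)%:E)%E.
Proof.
rewrite -density_le; apply: ae_eq_integral => //.
- apply: emeasurable_funM; first exact/measurable_EFinP.
  by have [] := nnm_indic R (measurable_fun_ltr (@measurable_id _ R setT) (measurable_cst x)).
- apply: emeasurable_funM; first exact/measurable_EFinP.
  by have [] := nnm_indic R (measurable_fun_ler (@measurable_id _ R setT) (measurable_cst x)).
- exists [set x]; split => //; first exact: lebesgue_measure_set1.
  move=> y /= /not_implyP[_]; apply: contra_notP => /eqP yx.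
  by rewrite le_eqVlt (negbTE yx).
Qed.

Lemma density_gt (x : R) :
  (\int[mu]_y ((f y)%:E * (((x < y)%R : bool)%:R)%:E) = (1 - F x)%:E)%E.
Proof.
have E : (1%:E = \int[mu]_y ((f y)%:E * (((x < y)%R : bool)%:R)%:E) + (F x)%:E)%E.
  rewrite -density_le -intD; last 2 first.
  - by apply: nnmM => //; apply: nnm_indic; exact: measurable_fun_ltr.
  - by apply: nnmM => //; apply: nnm_indic; exact: measurable_fun_ler.
  rewrite -density_int1; apply: int_eq => y.
  by case: ltP => _; rewrite !mule1 !mule0 ?adde0 ?add0e.
have J0 : (0 <= \int[mu]_y ((f y)%:E * (((x < y)%R : bool)%:R)%:E))%E.
  by apply: int_ge0 => y; rewrite mule_ge0 ?lee_fin.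
move: E J0; case: (\int[mu]_y _)%E => [r|//|//] [E] _.
by rewrite E addrK.
Qed.

Lemma density_F : (\int[mu]_x ((f x)%:E * (F x)%:E) = (2^-1)%:E)%E.
Proof.
set J := (X in X = _).
have nF : nnm (fun x : R => (F x)%:E).
  by apply: nnm_EFin; [exact: measurable_cdf_F|exact: cdf_F_ge0].
have nk : nnm (fun p : R * R => (f p.1)%:E *
    ((f p.2)%:E * (((p.2 <= p.1)%R : bool)%:R : R)%:E))%E.
  apply: nnmM.
    by apply: nnm_EFin => //; exact: (measurableT_comp mf measurable_fst).
  apply: nnmM; last by apply: nnm_indic; exact: measurable_fun_ler.
  by apply: nnm_EFin => //; exact: (measurableT_comp mf measurable_snd).
have J1 : (J = \int[mu]_x ((f x)%:E * (1 - F x)%:E))%E.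
  transitivity (\int[mu]_x \int[mu]_y ((f x)%:E *
      ((f y)%:E * (((y <= x)%R : bool)%:R)%:E)))%E.
    apply: int_eq => x; rewrite intZ ?density_le//.
    by apply: nnmM => //; apply: nnm_indic; exact: measurable_fun_ler.
  transitivity (\int[mu]_y \int[mu]_x ((f x)%:E *
      ((f y)%:E * (((y <= x)%R : bool)%:R)%:E)))%E.
    exact: (int_exchange mu mu nk).
  apply: int_eq => y.
  transitivity (\int[mu]_x ((f y)%:E * ((f x)%:E * (((y <= x)%R : bool)%:R)%:E)))%E.
    by apply: int_eq => x; rewrite muleCA.
  rewrite intZ//; last by apply: nnmM => //; apply: nnm_indic; exact: measurable_fun_ler.
  congr (_ * _)%E; rewrite -density_gt; apply: ae_eq_integral => //.
  - apply: emeasurable_funM; first exact/measurable_EFinP.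
    by have [] := nnm_indic R (measurable_fun_ler (measurable_cst y) (@measurable_id _ R setT)).
  - apply: emeasurable_funM; first exact/measurable_EFinP.
    by have [] := nnm_indic R (measurable_fun_ltr (measurable_cst y) (@measurable_id _ R setT)).
  - exists [set y]; split => //; first exact: lebesgue_measure_set1.
    move=> x /= /not_implyP[_]; apply: contra_notP => /eqP yx.
    by rewrite le_eqVlt eq_sym (negbTE yx).
have J2 : (J + J = 1%:E)%E.
  rewrite [X in (_ + X)%E]J1 -intD; last 2 first.
  - exact: nnmM.
  - apply: nnmM => //; apply: nnm_EFin => [|x]; last by rewrite subr_ge0 cdf_F_le1.
    by apply: measurable_funB => //; exact: measurable_cdf_F.
  rewrite -density_int1; apply: int_eq => x.
  by rewrite -!EFinM -EFinD -mulrDr addrC subrK mulr1.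
have : (0 <= J)%E by apply: int_ge0 => x; rewrite mule_ge0 ?lee_fin ?cdf_F_ge0.
move: J2; case: J {J1} => [r|//|//] [E] _; congr EFin; lra.
Qed.

Definition residual (x y : R) : R :=
  ((y < x)%R : bool)%:R - ((x < y)%R : bool)%:R - 2 * F x + 2 * F y.

Lemma residual_le x y : `|residual x y| <= 3.
Proof.
have := cdf_F_ge0 x; have := cdf_F_le1 x; have := cdf_F_ge0 y; have := cdf_F_le1 y.
rewrite /residual ler_norml; case: (ltgtP x y) => _ /= *; apply/andP; split; lra.
Qed.

Lemma residualC x y : residual y x = - residual x y.
Proof. by rewrite /residual; ring. Qed.

Lemma measurable_residual : measurable_fun setT (fun p : R * R => residual p.1 p.2).
Proof.
have m1 := measurableT_comp measurable_cdf_F (@measurable_fst _ _ R R).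
have m2 := measurableT_comp measurable_cdf_F (@measurable_snd _ _ R R).
apply: measurable_funD; last exact: measurable_funM.
apply: measurable_funB; last exact: measurable_funM.
apply: measurable_funB; apply: measurable_nat_of_bool; exact: measurable_fun_ltr.
Qed.

Lemma centered_residual y : centered (fun o => residual (X o) y).
Proof.
have mr : measurable_fun setT (fun o => residual (X o) y).
  have := @measurable_fun_pair _ _ _ T R R _ _ mX (measurable_cst y).
  exact: (measurableT_comp measurable_residual).
have bnd (Y : T -> R) (B : R) : measurable_fun setT Y -> (forall o, `|Y o| <= B) ->
    P.-integrable setT (EFin \o Y).
  move=> mY YB.
  have iB := finite_measure_integrable_cst P B measurableT.
  apply: (le_integrable measurableT _ _ iB).
    exact/measurable_EFinP.
  by move=> o _ /=; rewrite lee_fin (le_trans (YB o))// ler_norm.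
split; first by apply: (bnd _ 3) => // o; exact: residual_le.
pose A x : R := ((y < x)%R : bool)%:R + 2 * F y.
pose C x : R := ((x < y)%R : bool)%:R + 2 * F x.
have mA : measurable_fun setT A.
  by apply: measurable_funD => //; apply: measurable_nat_of_bool; exact: measurable_fun_ltr.
have mC : measurable_fun setT C.
  apply: measurable_funD; first by apply: measurable_nat_of_bool; exact: measurable_fun_ltr.
  by apply: measurable_funM => //; exact: measurable_cdf_F.
have F0 := cdf_F_ge0; have F1 := cdf_F_le1.
have A0 x : 0 <= A x by rewrite addr_ge0// mulr_ge0.
have C0 x : 0 <= C x by rewrite addr_ge0// mulr_ge0.
have AE : (\int[P]_o (A (X o))%:E = (1 + F y)%:E)%E.
  rewrite (density_ge0 mA A0).
  transitivity (\int[mu]_x ((f x)%:E * (((y < x)%R : bool)%:R)%:E +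
      (2 * F y)%:E * (f x)%:E))%E.
    apply: int_eq => x; rewrite EFinD ge0_muleDr ?lee_fin ?mulr_ge0//.
    by congr (_ + _)%E; rewrite muleC.
  rewrite intD; last 2 first.
  - by apply: nnmM => //; apply: nnm_indic; exact: measurable_fun_ltr.
  - by apply: nnmM => //; apply: nnm_cst; rewrite lee_fin mulr_ge0.
  rewrite density_gt intZ ?mulr_ge0// density_int1 mule1 -EFinD; congr EFin; ring.
have CE : (\int[P]_o (C (X o))%:E = (1 + F y)%:E)%E.
  rewrite (density_ge0 mC C0).
  have nfF : nnm (fun x : R => (f x)%:E * (F x)%:E)%E.
    by apply: nnmM => //; apply: nnm_EFin => //; exact: measurable_cdf_F.
  transitivity (\int[mu]_x ((f x)%:E * (((x < y)%R : bool)%:R)%:E +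
      2%:E * ((f x)%:E * (F x)%:E)))%E.
    apply: int_eq => x; rewrite EFinD ge0_muleDr ?lee_fin ?mulr_ge0//.
    by congr (_ + _)%E; rewrite EFinM muleCA.
  rewrite intD; last 2 first.
  - by apply: nnmM => //; apply: nnm_indic; exact: measurable_fun_ltr.
  - by apply: nnmM.
  rewrite density_lt intZ// density_F -EFinM -EFinD; congr EFin.
  by rewrite mulfV// addrC.
transitivity (\int[P]_o ((A (X o))%:E - (C (X o))%:E))%E.
  by apply: int_eq => o; rewrite -EFinB; congr EFin; rewrite /residual /A /C; ring.
rewrite integralB//.
- by rewrite AE CE -EFinB subrr.
- apply: (bnd _ 3); first exact: measurableT_comp mA mX.
  move=> o; rewrite ger0_norm// /A; have := F1 y; case: (y < X o) => /=; lra.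
- apply: (bnd _ 3); first exact: measurableT_comp mC mX.
  move=> o; rewrite ger0_norm// /C; have := F1 (X o); case: (X o < y) => /=; lra.
Qed.

End law_with_density.

Section nonuniform.
Context {R : realType}.
Local Notation mu := (@lebesgue_measure R).

Lemma int_itv_sqr (A B t : R) : A < B ->
  (\int[mu]_(x in `[A, B]) ((t + x) ^+ 2)%:E =
   (((t + B) ^+ 3 - (t + A) ^+ 3) / 3)%:E)%E.
Proof.
move=> AB; pose G (x : R) := (t + x) ^+ 3 / 3.
have dG (x : R) : is_derive x (1 : R) G ((t + x) ^+ 2).
  rewrite /G; apply: is_derive_eq.
  by rewrite /GRing.scale /=; field.
have cG (x : R) : {for x, continuous G}.
  by apply: differentiable_continuous; apply/derivable1_diffP; case: (dG x).
rewrite (@continuous_FTC2 _ _ G)//; last 3 first.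
- apply: continuous_subspaceT => x.
  by apply: differentiable_continuous; apply/derivable1_diffP; exact: ex_derive.
- split=> [x _||].
  + by case: (dG x).
  + by apply: cvg_at_right_filter; exact: cG.
  + by apply: cvg_at_left_filter; exact: cG.
- by move=> x _; rewrite derive1E; apply: derive_val.
by rewrite -EFinB /G mulrBl.
Qed.

Context d (T : measurableType d) (P : probability T R) (X : {RV P >-> R}).
Variables f F : R -> R.
Hypothesis hf : has_density X f.

Let mf : measurable_fun [set: R] f. Proof. by case: hf. Qed.
Let f0 x : 0 <= f x. Proof. by case: hf. Qed.
Let nf : nnm (fun x : R => (f x)%:E). Proof. exact: nnm_EFin. Qed.

Lemma mass_le1 (a b c : R) : a <= b -> 0 <= c -> (forall x, a < x <= b -> c <= f x) ->
  c * (b - a) <= 1.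
Proof.
move=> ab c0 cf; rewrite -lee_fin; have [_ <-] := (erefl (0 : R), density_int1 hf).
rewrite EFinM -(int_itv ab) -intZ//.
  apply: int_le => x; first by rewrite -EFinM lee_fin mulr_ge0.
  rewrite -EFinM lee_fin; case: (boolP (a < x <= b)) => [/cf|_] /=; first by rewrite mulr1.
  by rewrite mulr0.
by apply: nnm_indic; apply: measurable_and; [exact: measurable_fun_ltr|exact: measurable_fun_ler].
Qed.

Hypothesis hF : forall x, cdf X x = (F x)%:E.

Lemma cdf_F_sub a b : a <= b ->
  (\int[mu]_x ((f x)%:E * (((a < x <= b)%R : bool)%:R)%:E) = (F b - F a)%:E)%E.
Proof.
move=> ab.
have E : ((F b)%:E = \int[mu]_x ((f x)%:E * (((a < x <= b)%R : bool)%:R)%:E) + (F a)%:E)%E.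
  rewrite -!(density_le hf hF) -intD; last 2 first.
  - apply: nnmM => //; apply: nnm_indic; apply: measurable_and.
      exact: measurable_fun_ltr.
    exact: measurable_fun_ler.
  - by apply: nnmM => //; apply: nnm_indic; exact: measurable_fun_ler.
  apply: int_eq => x; case: (leP x a) => [xa|ax] /=.
    by rewrite (le_trans xa ab) mule0 add0e.
  by rewrite mule0 adde0.
move: E; set J := (\int[mu]_x _)%E => E.
have J0 : (0 <= J)%E by apply: int_ge0 => x; rewrite mule_ge0 ?lee_fin.
by move: E J0; case: J => [r|//|//] [->] _; rewrite addrK.
Qed.

Lemma cdf_F_sub_ge a b c : a <= b -> 0 <= c -> (forall x, a < x <= b -> c <= f x) ->
  c * (b - a) <= F b - F a.
Proof.
move=> ab c0 cf; rewrite -lee_fin -(cdf_F_sub ab) EFinM -(int_itv ab) -intZ//.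
  apply: int_le => x; first by rewrite -EFinM lee_fin mulr_ge0.
  rewrite -!EFinM lee_fin; case: (boolP (a < x <= b)) => [/cf|_] /=; first by rewrite !mulr1.
  by rewrite !mulr0.
by apply: nnm_indic; apply: measurable_and; [exact: measurable_fun_ltr|exact: measurable_fun_ler].
Qed.

Lemma cdf_F_sub_le a b c : a <= b -> 0 <= c -> (forall x, a < x <= b -> f x <= c) ->
  F b - F a <= c * (b - a).
Proof.
move=> ab c0 cf; rewrite -lee_fin -(cdf_F_sub ab) EFinM -(int_itv ab) -intZ//.
  apply: int_le => x; first by rewrite -EFinM lee_fin mulr_ge0.
  rewrite -!EFinM lee_fin; case: (boolP (a < x <= b)) => [/cf|_] /=; first by rewrite !mulr1.
  by rewrite !mulr0.
by apply: nnm_indic; apply: measurable_and; [exact: measurable_fun_ltr|exact: measurable_fun_ler].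
Qed.

Lemma flip_of_lt (x0 y0 : R) : {for x0, continuous f} -> {for y0, continuous f} ->
    0 < f y0 -> f y0 < f x0 ->
  exists c h eta, [/\ 0 < c, 0 < h, 0 < eta,
    (forall x, x0 - 2 * h < x <= x0 + 2 * h -> c <= f x) /\
    (forall y, y0 - 2 * h < y <= y0 + 2 * h -> c <= f y)
  & forall x y, x0 - h < x <= x0 + h -> y0 - h < y <= y0 + h ->
    eta <= F (x + h) + F (y - h) - (F (x - h) + F (y + h))].
Proof.
move=> cx cy fy xy.
pose a := (2 * f x0 + f y0) / 3; pose b := (f x0 + 2 * f y0) / 3.
have ba : b < a by rewrite /a /b; lra.
have ax : a < f x0 by rewrite /a; lra.
have yb : f y0 < b by rewrite /b; lra.
have cy2 : f y0 / 2 < f y0 by lra.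
have [r r0 rP] := (nbhs_ballP _ _).1 (cvgr_gt _ cx _ ax).
have [s s0 sP] := (nbhs_ballP _ _).1 (cvgr_gt _ cy _ cy2).
have [u u0 uP] := (nbhs_ballP _ _).1 (cvgr_lt _ cy _ yb).
pose h := Num.min r (Num.min s u) / 4.
have m0 : 0 < Num.min r (Num.min s u) by rewrite !lt_min r0 s0 u0.
have h0 : 0 < h by rewrite /h; lra.
have [hr hs hu] : [/\ 2 * h < r, 2 * h < s & 2 * h < u].
  have : 2 * h < Num.min r (Num.min s u) by rewrite /h; lra.
  by rewrite !lt_min => /and3P[].
have inb z x e : 2 * h < e -> z - 2 * h < x <= z + 2 * h -> ball z e x.
  move=> he /andP[zx xz]; rewrite /ball /= ltr_norml; apply/andP; split; lra.
have fa x : x0 - 2 * h < x <= x0 + 2 * h -> a <= f x.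
  by move=> xx; apply/ltW/rP/inb.
have fb y : y0 - 2 * h < y <= y0 + 2 * h -> f y <= b.
  by move=> xx; apply/ltW/uP/inb.
exists (f y0 / 2), h, (2 * h * (a - b)); split => //.
- by rewrite divr_gt0.
- by rewrite mulr_gt0 ?subr_gt0// mulr_gt0.
- split=> x xx; last by apply/ltW/sP/inb.
  by apply: le_trans (fa _ xx); lra.
- move=> x y /andP[x1 x2] /andP[y1 y2].
  have b0 : 0 <= b by lra.
  have a0 : 0 <= a by lra.
  have := @cdf_F_sub_ge (x - h) (x + h) a.
  have -> : (x + h - (x - h)) = 2 * h by ring.
  move=> /(_ _ a0) F1.
  have := @cdf_F_sub_le (y - h) (y + h) b.
  have -> : (y + h - (y - h)) = 2 * h by ring.
  move=> /(_ _ b0) F2.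
  have {}F1 : a * (2 * h) <= F (x + h) - F (x - h).
    apply: F1; first by lra.
    by move=> z /andP[z1 z2]; apply: fa; apply/andP; split; lra.
  have {}F2 : F (y + h) - F (y - h) <= b * (2 * h).
    apply: F2; first by lra.
    by move=> z /andP[z1 z2]; apply: fb; apply/andP; split; lra.
  lra.
Qed.

Hypotheses (hmean : ('E_P[X] = 0)%E) (hvar : ('V_P[X] = 1)%E).
Hypothesis hmoments : (X : T -> R) \in Lfun P 6%:E.

Lemma const_density_uniform (A B l : R) : A < B ->
    (forall x, A < x < B -> f x = l) -> (forall x, ~~ (A <= x <= B) -> f x = 0) ->
  forall U, measurable U -> distribution P X U = uniform_prob (sqrt3_itv R) U.
Proof.
move=> AB fl fo.
have l0 : 0 <= l by rewrite -(fl ((A + B) / 2)) ?midf_lt.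
have neg : mu.-negligible ([set A] `|` [set B]).
  by apply: negligibleU; apply/negligibleP => //; exact: lebesgue_measure_set1.
have fae (x : R) : x <> A -> x <> B -> f x = if A <= x <= B then l else 0.
  move=> xA xB; case: ifPn => [/andP[Ax xB']|]; last exact: fo.
  by apply: fl; rewrite !lt_neqAle Ax xB' (introN eqP xB) eq_sym (introN eqP xA).
have intf (g : R -> R) : measurable_fun setT g -> (forall x, 0 <= g x) ->
    (\int[mu]_x ((f x)%:E * (g x)%:E) = l%:E * \int[mu]_(x in `[A, B]) (g x)%:E)%E.
  move=> mg g0; rewrite -ge0_integralZl//; last 2 first.
  - exact/measurable_EFinP/measurable_funTS.
  - by move=> x _; rewrite lee_fin.
  rewrite [RHS]integral_mkcond; apply: ae_eq_integral => //.
  - by apply: emeasurable_funM; exact/measurable_EFinP.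
  - apply/(measurable_restrictT _ _).1 => //.
    by apply: emeasurable_funM => //; exact/measurable_EFinP/measurable_funTS.
  - apply: negligibleS neg => x /= /not_implyP[_]; apply: contra_notP => /not_orP[xA xB].
    rewrite fae// /patch mem_setE in_itv /=.
    by case: ifP => // _; rewrite mul0e.
have m2 t : l * (((t + B) ^+ 3 - (t + A) ^+ 3) / 3) = t ^+ 2 + 1.
  apply: EFin_inj; rewrite -(face_second_moment hf hmean hvar hmoments) intf.
  - by rewrite int_itv_sqr// EFinM.
  - by apply: measurable_funX; exact: measurable_funD.
  - by move=> x; exact: sqr_ge0.
have lBA : l * (B - A) = 1.
  apply: EFin_inj; rewrite -(density_int1 hf).
  transitivity (\int[mu]_x ((f x)%:E * 1%:E))%E; last first.
    by apply: int_eq => x; rewrite mule1.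
  rewrite intf// integral_cst//= lebesgue_measure_itv/= lte_fin AB mul1e.
  by rewrite -EFinB -EFinM.
have [A3 B3] : A = - Num.sqrt 3 /\ B = Num.sqrt 3.
  have E1 : A ^+ 2 + 1 = (B - A) ^+ 2 / 3.
    rewrite -[A ^+ 2]sqrrN -m2 addNr expr0n subr0.
    transitivity (l * (B - A) * ((B - A) ^+ 2 / 3)); first by field.
    by rewrite lBA mul1r.
  have E2 : B ^+ 2 + 1 = (B - A) ^+ 2 / 3.
    rewrite -[B ^+ 2]sqrrN -m2 addNr expr0n sub0r.
    transitivity (l * (B - A) * ((B - A) ^+ 2 / 3)); first by field.
    by rewrite lBA mul1r.
  have AB2 : (A + B) * (B - A) = 0.
    have -> : (A + B) * (B - A) = (B ^+ 2 + 1) - (A ^+ 2 + 1) by ring.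
    by rewrite E1 E2 subrr.
  have E3 : A = - B.
    move/eqP: AB2; rewrite mulf_eq0 subr_eq0 (gt_eqF AB) orbF.
    by rewrite addr_eq0 => /eqP.
  have B0 : 0 < B by lra.
  have B2 : B ^+ 2 = 3 by move: E2; rewrite E3 => E2; lra.
  have BE : B = Num.sqrt 3 by rewrite -B2 sqrtr_sqr gtr0_norm.
  by rewrite E3 BE.
move=> U mU; have [_ _ ->//] := hf; rewrite /uniform_prob.
apply: ae_eq_integral => //.
- exact/measurable_EFinP/measurable_funTS.
- by apply/measurable_EFinP; apply: measurable_funTS; exact: measurable_uniform_pdf.
- apply: negligibleS neg => x /= /not_implyP[_]; apply: contra_notP => /not_orP[xA xB].
  rewrite fae// /uniform_pdf -A3 -B3; case: ifP => // _; congr EFin.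
  have BA0 : B - A != 0 by rewrite subr_eq0 gt_eqF.
  by apply: (mulIf BA0); rewrite lBA mulVf.
Qed.

Hypothesis hsupp : is_interval (supp f).
Hypothesis hcont : {within supp f, continuous f}.
Hypothesis hunif : ~ forall A : set R, measurable A ->
  distribution P X A = uniform_prob (sqrt3_itv R) A.

Let inner x := exists a b, [/\ supp f a, supp f b & a < x < b].

Let inner_cvg x : inner x -> {for x, continuous f}.
Proof.
move=> [a [b [Sa Sb /andP[ax xb]]]].
apply: (@within_continuous_continuous _ _ _ a b); first exact: lt_trans ax xb.
  apply: continuous_subspaceW hcont => z /=; rewrite in_itv /=.
  exact: hsupp.
by rewrite in_itv /= ax xb.
Qed.

Let supp_neq0 x : f x != 0 -> supp f x.
Proof. by move=> fx; exact: subset_closure. Qed.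

Lemma two_values : exists x0 y0, [/\ inner x0, inner y0, 0 < f y0 & f y0 < f x0].
Proof.
apply: contrapT => H; apply: hunif.
have two : exists a b, [/\ supp f a, supp f b & a < b].
  apply: contrapT => H2.
  have H1 a x : f a != 0 -> f x != 0 -> x = a.
    move=> /supp_neq0 Sa /supp_neq0 Sx.
    case: (ltgtP x a) => // xa; exfalso; apply: H2; first by exists x, a.
    by exists a, x.
  have : (\int[mu]_x (f x)%:E = 0)%E.
    have [[a fa]|f00] := pselect (exists a, f a != 0); last first.
      rewrite integral0_eq// => x _; congr EFin; apply: contrapT => fx.
      by apply: f00; exists x; apply/eqP.
    rewrite (ae_eq_integral (cst 0%E))//; first by rewrite integral0.
      exact/measurable_EFinP.
    exists [set a]; split => //; first exact: lebesgue_measure_set1.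
    move=> x /= /not_implyP[_]; apply: contra_notP => xa; congr EFin.
    by apply: contrapT => /eqP fx; apply: xa; exact: H1.
  by rewrite (density_int1 hf) => -[] /eqP; rewrite oner_eq0.
have [a [b [Sa Sb ab]]] := two.
have [z zab fz] : exists2 z, a < z < b & 0 < f z.
  have Sm : supp f ((a + b) / 2) by apply: (hsupp Sa Sb); have := ab; lra.
  have : nbhs ((a + b) / 2) [set` `]a, b[].
    by apply: open_nbhs_nbhs; split; [exact: interval_open|rewrite /= in_itv /= !midf_lt].
  move=> /Sm[z []] /= fz; rewrite in_itv /= => zab.
  by exists z => //; rewrite lt_neqAle eq_sym fz f0.
have iz : inner z by exists a, b.
pose l := f z.
have pos x : inner x -> 0 < f x -> f x = l.
  move=> ix fx; rewrite /l; case: (ltgtP (f x) (f z)) => // fxz; exfalso; apply: H.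
    by exists z, x.
  by exists x, z.
have fl x : inner x -> f x = l.
  move=> ix; have := f0 x; rewrite le_eqVlt => /predU1P[fx|]; last exact: pos.
  have ivt u v : inner u -> inner v -> u <= v -> Num.min (f u) (f v) = 0 ->
      Num.max (f u) (f v) = l -> False.
    move=> iu iv uv mn mx.
    have [a' [_ [Sa' _ /andP[a'u _]]]] := iu.
    have [_ [b' [_ Sb' /andP[_ vb']]]] := iv.
    have iuv w : u <= w <= v -> inner w.
      move=> /andP[uw wv]; exists a', b'; split => //.
      by rewrite (lt_le_trans a'u uw) (le_lt_trans wv vb').
    have [||w] := @IVT _ f u v (l / 2) uv.
    - apply: continuous_subspaceW hcont => w /=; rewrite in_itv /= => /andP[uw wv].
      apply: (hsupp Sa' Sb'); apply/andP; split; apply/ltW.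
        exact: lt_le_trans a'u uw.
      exact: le_lt_trans wv vb'.
    - by rewrite mn mx /l; have := fz; lra.
    - rewrite in_itv /= => /iuv iw fw.
      have lp : 0 < l by exact: fz.
      have fw0 : 0 < f w by rewrite fw divr_gt0.
      by have := pos _ iw fw0; rewrite fw; lra.
  have fz0 := ltW fz.
  exfalso; have [xz|zx] := leP x z.
    by apply: (ivt x z) => //; rewrite -fx; [exact: min_l|exact: max_r].
  by apply: (ivt z x) => //; rewrite ?(ltW zx)// -fx; [exact: min_r|exact: max_l].
have lp : 0 < l by exact: fz.
have wid u v : supp f u -> supp f v -> u < v -> l * (v - u) <= 1.
  move=> Su Sv uv.
  have wid' w : u < w -> w < v -> l * (w - u) <= 1.
    move=> uw wv; apply: mass_le1; [exact: ltW|exact: ltW|].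
    move=> x /andP[ux xw]; rewrite fl//; exists u, v; split => //.
    by rewrite ux (le_lt_trans xw wv).
  rewrite leNgt; apply/negP => lvu.
  pose w := (v + u + l^-1) / 2.
  have li : 0 < l^-1 by rewrite invr_gt0.
  have lvu' : l^-1 < v - u by rewrite -[l^-1]mul1r ltr_pdivrMr// mulrC.
  have := wid' w; rewrite /w => /(_ ltac:(lra) ltac:(lra)).
  have -> : l * ((v + u + l^-1) / 2 - u) = (l * (v - u) + 1) / 2.
    by field; rewrite gt_eqF.
  lra.
have hs : has_sup (supp f).
  split; first by exists a.
  exists (b + l^-1) => x Sx.
  have li : 0 < l^-1 by rewrite invr_gt0.
  have [xb|bx] := leP x b; first by lra.
  have := wid _ _ Sb Sx bx; rewrite -ler_pdivlMl// mulr1; lra.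
have hi : has_inf (supp f).
  split; first by exists a.
  exists (a - l^-1) => x Sx.
  have li : 0 < l^-1 by rewrite invr_gt0.
  have [xa|ax] := leP a x; first by lra.
  have := wid _ _ Sx Sa ax; rewrite -ler_pdivlMl// mulr1; lra.
have Sle x : supp f x -> inf (supp f) <= x <= sup (supp f).
  by move=> Sx; rewrite ge_inf ?ub_le_sup//; [case: hs|case: hi].
apply: (@const_density_uniform (inf (supp f)) (sup (supp f)) l).
- have /andP[ia _] := Sle _ Sa; have /andP[_ bs] := Sle _ Sb.
  by apply: le_lt_trans ia (lt_le_trans ab bs).
- move=> x /andP[ix xs]; apply: fl.
  have [u Su ux] := inf_lt hi.1 ix.
  have [v Sv xv] := sup_gt hs.1 xs.
  by exists u, v; rewrite ux xv.
- move=> x xo; apply/eqP; apply: contraNT xo => /supp_neq0; exact: Sle.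
Qed.

Lemma nonuniform_flip : exists al be c h eta, [/\ 0 < c, 0 < h, 0 < eta,
    (forall x, al - 2 * h < x <= al + 2 * h -> c <= f x) /\
    (forall y, be - 2 * h < y <= be + 2 * h -> c <= f y)
  & forall x y, al - h < x <= al + h -> be - h < y <= be + h ->
    eta <= F (x + h) + F (y - h) - (F (x - h) + F (y + h))].
Proof.
have [x0 [y0 [/inner_cvg cx /inner_cvg cy fy fxy]]] := two_values.
by exists x0, y0; exact: flip_of_lt.
Qed.

End nonuniform.

(** * Comparing dice *)

Section pairwise_comparison.
Context {R : realType}.
Variable F : R -> R.

Definition cdf_sum n (a : die R n) : R := \sum_(i < n) F (tnth a i).

Definition residual_sum n (a b : die R n) : R :=
  \sum_(i < n) \sum_(j < n) residual F (tnth a i) (tnth b j).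

Lemma sign_sumE n (a b : die R n) :
  (\sum_(i < n) \sum_(j < n)
     ((tnth b j < tnth a i)%R%:Z - (tnth a i < tnth b j)%R%:Z))%:~R =
  residual_sum a b + 2 * n%:R * (cdf_sum a - cdf_sum b).
Proof.
have -> : 2 * n%:R * (cdf_sum a - cdf_sum b) =
    \sum_(i < n) \sum_(j < n) (2 * F (tnth a i) - 2 * F (tnth b j)).
  have E x (b' : die R n) :
      \sum_(j < n) (2 * x - 2 * F (tnth b' j)) = n%:R * (2 * x) - 2 * cdf_sum b'.
    by rewrite sumrB sumr_const card_ord -[W in W - _ = _]mulr_natl -mulr_sumr.
  under eq_bigr do rewrite E.
  rewrite sumrB sumr_const card_ord -mulr_sumr -mulr_sumr -/(cdf_sum a) -mulr_natl; ring.
rewrite -big_split rmorph_sum; apply: eq_bigr => i _.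
rewrite -big_split rmorph_sum; apply: eq_bigr => j _ /=.
rewrite /residual rmorphB /= -!pmulrn; ring.
Qed.

Lemma residual_sumC n (a b : die R n) : residual_sum b a = - residual_sum a b.
Proof.
rewrite /residual_sum exchange_big -sumrN; apply: eq_bigr => i _.
by rewrite -sumrN; apply: eq_bigr => j _; exact: residualC.
Qed.

Lemma not_beats_self n (a : die R n) : ~ beats a a.
Proof.
rewrite /beats -(ltr0z R) sign_sumE subrr mulr0 addr0.
have := residual_sumC a a => E H.
have : residual_sum a a = 0 by lra.
by move=> E0; rewrite E0 ltxx in H.
Qed.

Definition off n (K : R) (a b : die R n) : bool :=
  (2 * n%:R * K <= `|residual_sum a b|) || (`|cdf_sum a - cdf_sum b| <= K).

Lemma offC n K (a b : die R n) : off K a b = off K b a.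
Proof. by rewrite /off residual_sumC normrN distrC. Qed.

Lemma beatsP n K (a b : die R n) : (0 < n)%N -> ~~ off K a b ->
  beats a b <-> cdf_sum b < cdf_sum a.
Proof.
move=> n0; rewrite negb_or -!ltNge ltr_norml => /andP[/andP[r1 r2] cK].
rewrite /beats -(ltr0z R) sign_sumE.
have n0' : 0 < 2 * n%:R :> R by rewrite mulr_gt0// ltr0n.
split=> [s|ba].
- rewrite ltNge; apply/negP => ab; move: cK.
  rewrite ler0_norm ?subr_le0// opprB => cK.
  have : 2 * n%:R * K < 2 * n%:R * (cdf_sum b - cdf_sum a) by rewrite ltr_pM2l.
  rewrite !mulrBr in s *; lra.
- move: cK; rewrite ger0_norm ?subr_ge0 1?ltW// => cK.
  have : 2 * n%:R * K < 2 * n%:R * (cdf_sum a - cdf_sum b) by rewrite ltr_pM2l.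
  lra.
Qed.

Lemma transitive_diceP n K (S : set (die R n)) : (0 < n)%N ->
    (forall a b, S a -> S b -> a <> b -> ~~ off K a b) -> 0 <= K ->
  transitive_dice S.
Proof.
move=> n0 S_off K0.
have bP a b : S a -> S b -> beats a b <-> cdf_sum b < cdf_sum a.
  move=> Sa Sb; have [->|ab] := eqVneq a b.
    by rewrite ltxx; split=> // /not_beats_self.
  by apply: (beatsP n0 (K := K)); apply: S_off => //; exact/eqP.
split.
- by move=> a _; exact: not_beats_self.
- move=> a b c Sa Sb Sc /bP => /(_ Sa Sb) ba /bP => /(_ Sb Sc) cb.
  by apply/bP => //; exact: lt_trans cb ba.
- move=> a b Sa Sb ab; have := S_off _ _ Sa Sb ab.
  rewrite negb_or -!ltNge => /andP[_ cK].
  have [h|h|h] := ltgtP (cdf_sum a) (cdf_sum b).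
  + by right; apply/bP.
  + by left; apply/bP.
  + by move: cK; rewrite h subrr normr0 ltNge K0.
Qed.

Lemma off_le n K (a b : die R n) : (0 < n)%N -> 0 < K ->
  ((off K a b)%:R : R) <= ((2 * n%:R * K) ^+ 2)^-1 * residual_sum a b ^+ 2 +
    (`|cdf_sum b - cdf_sum a| <= K)%R%:R.
Proof.
move=> n0 K0; rewrite /off [`|cdf_sum a - _|]distrC.
have w0 : 0 < 2 * n%:R * K by rewrite !mulr_gt0// ltr0n.
have q0 : 0 <= ((2 * n%:R * K) ^+ 2)^-1 * residual_sum a b ^+ 2.
  by rewrite mulr_ge0// ?invr_ge0 sqr_ge0.
case: (boolP (2 * n%:R * K <= _)) => [h|_] /=; last by rewrite lerDr.
apply: ler_wpDr => //.
rewrite mulrC ler_pdivlMr ?exprn_gt0// mul1r -[residual_sum a b ^+ 2]real_normK ?num_real//.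
by rewrite ler_pXn2r// ?nnegrE ?normr_ge0// ltW.
Qed.

Lemma measurable_cdf_sum n : measurable_fun setT F ->
  measurable_fun setT (fun a : n.-tuple R => cdf_sum a).
Proof. exact: measurable_sum_tnth. Qed.

Lemma measurable_residual_sum n :
    measurable_fun setT (fun p : R * R => residual F p.1 p.2) ->
  measurable_fun setT (fun p : n.-tuple R * n.-tuple R => residual_sum p.1 p.2).
Proof.
move=> mr; apply: measurable_sum => i; apply: measurable_sum => j.
apply: (measurableT_comp mr (g := fun p : n.-tuple R * n.-tuple R =>
  (tnth p.1 i, tnth p.2 j))).
apply: measurable_fun_pair.
- exact: (measurableT_comp (measurable_tnth i) measurable_fst).
- exact: (measurableT_comp (measurable_tnth j) measurable_snd).
Qed.

Lemma measurable_off n K : measurable_fun setT F ->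
    measurable_fun setT (fun p : R * R => residual F p.1 p.2) ->
  measurable_fun setT (fun p : n.-tuple R * n.-tuple R => off K p.1 p.2).
Proof.
move=> mF mr; apply: measurable_or; apply: measurable_fun_ler => //.
- by apply: measurableT_comp => //; exact: measurable_residual_sum.
- apply: measurableT_comp => //; apply: measurable_funB.
    exact: (measurableT_comp (@measurable_cdf_sum n mF) measurable_fst).
  exact: (measurableT_comp (@measurable_cdf_sum n mF) measurable_snd).
Qed.

End pairwise_comparison.

Section three_dice.
Context {R : realType}.
Local Notation ti := tuple_integral.
Variables (f : R -> R).
Hypotheses (mf : measurable_fun [set: R] f) (f0 : forall x, 0 <= f x).
Variable m : nat.
Local Notation D := (m.+1.-tuple R).
Local Notation E1 := (zs f (m := m)).

Definition zs2 (g : die R m.+1 -> die R m.+1 -> \bar R) : \bar R :=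
  E1 (fun a => E1 (g a)).

Definition zs3 (g : die R m.+1 -> die R m.+1 -> die R m.+1 -> \bar R) : \bar R :=
  E1 (fun a => zs2 (g a)).

Lemma zs2_ge0 g : (forall a b, 0 <= g a b)%E -> (0 <= zs2 g)%E.
Proof. by move=> g0; do 2 (apply: zs_ge0 => // ?). Qed.

Lemma zs2_le g k : (forall a b, 0 <= g a b)%E -> (forall a b, g a b <= k a b)%E ->
  (zs2 g <= zs2 k)%E.
Proof.
move=> g0 gk; apply: zs_le => // a; first by apply: zs_ge0.
exact: zs_le.
Qed.

Lemma nnm_section d1 d2 (T1 : measurableType d1) (T2 : measurableType d2)
    (g : T1 -> T2 -> \bar R) : nnm (fun p : T1 * T2 => g p.1 p.2) ->
  forall x, nnm (g x).
Proof.
move=> ng x; apply: (nnm_comp (h := fun y => (x, y)) _ ng).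
exact: measurable_fun_pair.
Qed.

Lemma zs2D g k : nnm (fun p : D * D => g p.1 p.2) ->
    nnm (fun p : D * D => k p.1 p.2) ->
  zs2 (fun a b => g a b + k a b)%E = (zs2 g + zs2 k)%E.
Proof.
move=> ng nk; rewrite /zs2 -zsD//; [|exact: nnm_zs..].
by apply: zs_eq => a; rewrite zsD//; exact: nnm_section.
Qed.

Lemma zs2Z c g : 0 <= c -> nnm (fun p : D * D => g p.1 p.2) ->
  zs2 (fun a b => c%:E * g a b)%E = (c%:E * zs2 g)%E.
Proof.
move=> c0 ng; rewrite /zs2 -zsZ//; last exact: nnm_zs.
by apply: zs_eq => a; rewrite zsZ//; exact: nnm_section.
Qed.

Lemma nnm_zs2 d (Y : measurableType d) (g : Y -> D -> D -> \bar R) :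
  nnm (fun p : Y * D * D => g p.1.1 p.1.2 p.2) -> nnm (fun y => zs2 (g y)).
Proof.
move=> ng; apply: (nnm_zs mf f0 (H := fun y a => E1 (g y a))).
exact: (nnm_zs mf f0 (H := fun p a => g p.1 p.2 a)).
Qed.

Lemma zs3D g k : nnm (fun p : D * D * D => g p.1.1 p.1.2 p.2) ->
    nnm (fun p : D * D * D => k p.1.1 p.1.2 p.2) ->
  zs3 (fun a b c => g a b c + k a b c)%E = (zs3 g + zs3 k)%E.
Proof.
have sec (h : D -> D -> D -> \bar R) : nnm (fun p : D * D * D => h p.1.1 p.1.2 p.2) ->
    forall a, nnm (fun p : D * D => h a p.1 p.2).
  move=> nh a; apply: (nnm_comp (h := fun p : D * D => (a, p.1, p.2)) _ nh).
  apply: measurable_fun_pair => //; exact: measurable_fun_pair.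
move=> ng nk; rewrite /zs3 -zsD//; [|exact: nnm_zs2..].
by apply: zs_eq => a; rewrite zs2D//; exact: sec.
Qed.

Lemma zs3_le g k : (forall a b c, 0 <= g a b c)%E ->
  (forall a b c, g a b c <= k a b c)%E -> (zs3 g <= zs3 k)%E.
Proof.
move=> g0 gk; apply: zs_le => // a; first exact: zs2_ge0.
exact: zs2_le.
Qed.

Lemma integral_E0E (g : D -> D -> D -> R) : (forall a b c, 0 <= g a b c) ->
    measurable_fun setT (fun p : D * D * D => g p.1.1 p.1.2 p.2) ->
  integral_E0 (fun a b c => g a b c * dice_density f a b c) =
  zs3 (fun a b c => (g a b c)%:E).
Proof.
move=> g0 mg.
have ng : nnm (fun p : D * D * D => (g p.1.1 p.1.2 p.2)%:E) by exact: nnm_EFin.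
have ng1 a : nnm (fun p : D * D => (g a p.1 p.2)%:E).
  apply: (nnm_comp (h := fun p : D * D => (a, p.1, p.2)) _ ng).
  apply: measurable_fun_pair => //; exact: measurable_fun_pair.
have ng2 a b : nnm (fun c => (g a b c)%:E).
  exact: (nnm_section (g := fun b c => (g a b c)%:E) (ng1 a)).
have d0 n (a : die R n) := die_density_ge0 f0 a.
apply: ti_eq => u; set a := die_of u 0.
rewrite /zs2 /zs -tiZ//; last first.
  apply: (nnm_zs_integrand mf f0 (H := fun b => E1 (fun c => (g a b c)%:E))).
  exact: nnm_zs.
apply: ti_eq => v; set b := die_of v 0.
rewrite muleA -EFinM -tiZ//; last 2 first.
- by rewrite mulr_ge0.
- exact: (nnm_zs_integrand mf f0 (H := fun c => (g a b c)%:E)).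
apply: ti_eq => w; set c := die_of w 0.
by rewrite -!EFinM /dice_density; congr EFin; ring.
Qed.

Lemma le_integral_E0 (g k : D -> D -> D -> R) : (forall a b c, 0 <= g a b c) ->
    (forall a b c, g a b c <= k a b c) ->
  (integral_E0 (fun a b c => g a b c * dice_density f a b c)%R <=
   integral_E0 (fun a b c => k a b c * dice_density f a b c)%R)%E.
Proof.
move=> g0 gk; have d0 n (a : die R n) := die_density_ge0 f0 a.
have dd0 (a b c : die R m.+1) : 0 <= dice_density f a b c.
  by rewrite !mulr_ge0.
have i0 (a b c : die R m.+1) : (0 <= (g a b c * dice_density f a b c)%:E)%E.
  by rewrite lee_fin mulr_ge0.
apply: ti_le => u; first by apply: ti_ge0 => v; exact: ti_ge0.
apply: ti_le => v; first exact: ti_ge0.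
by apply: ti_le => w //; rewrite lee_fin ler_wpM2r.
Qed.

Variable z : R.
Hypotheses (z0 : 0 < z) (zE : zmass f m = z%:E).

Lemma zs_cst k : 0 <= k -> E1 (fun=> k%:E) = (k * z)%:E.
Proof.
move=> k0; rewrite EFinM -zE -(zs1 mf f0) -zsZ//.
by apply: zs_eq => a; rewrite mule1.
Qed.

Lemma Pr_E0_bounds (w : R) (B : D -> D -> bool) (A : D -> D -> D -> Prop) :
    measurable_fun setT (fun p : D * D => B p.1 p.2) ->
    (zs2 (fun a b => ((B a b)%:R)%:E) <= (w * z ^+ 2)%:E)%E ->
    (forall a b c, ~~ B a b -> ~~ B b c -> ~~ B a c -> A a b c) ->
  1 - 3 * w <= Pr_E0 f A <= 1.
Proof.
move=> mB Bw BA.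
have nB := nnm_indic R mB.
have mab : measurable_fun setT (fun p : D * D * D => B p.1.1 p.1.2).
  apply: (measurableT_comp mB (g := fun p : D * D * D => (p.1.1, p.1.2))).
  by apply: measurable_fun_pair; exact: measurableT_comp.
have mbc : measurable_fun setT (fun p : D * D * D => B p.1.2 p.2).
  apply: (measurableT_comp mB (g := fun p : D * D * D => (p.1.2, p.2))).
  by apply: measurable_fun_pair => //; exact: measurableT_comp.
have mac : measurable_fun setT (fun p : D * D * D => B p.1.1 p.2).
  apply: (measurableT_comp mB (g := fun p : D * D * D => (p.1.1, p.2))).
  by apply: measurable_fun_pair => //; exact: measurableT_comp.
pose G (a b c : D) := [&& ~~ B a b, ~~ B b c & ~~ B a c].
have mG : measurable_fun setT (fun p : D * D * D => G p.1.1 p.1.2 p.2).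
  by apply: measurable_and; [|apply: measurable_and]; exact: measurable_neg.
have mGr : measurable_fun setT (fun p : D * D * D => ((G p.1.1 p.1.2 p.2)%:R : R)).
  exact: measurable_nat_of_bool.
pose I := zs2 (fun a b => ((B a b)%:R)%:E).
have I0 : (0 <= I)%E by apply: zs2_ge0 => a b; rewrite lee_fin.
have If : I \is a fin_num by rewrite ge0_fin_numE// (le_lt_trans Bw) ?ltry.
have z0' := ltW z0.
have Iab : zs3 (fun a b c => ((B a b)%:R)%:E) = (I * z%:E)%E.
  rewrite muleC -zs2Z//; apply: zs_eq => a; apply: zs_eq => b.
  by rewrite zs_cst// EFinM muleC.
have Ibc : zs3 (fun a b c => ((B b c)%:R)%:E) = (I * z%:E)%E.
  by rewrite /zs3 -/I -(fineK If) zs_cst ?EFinM// fine_ge0.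
have Iac : zs3 (fun a b c => ((B a c)%:R)%:E) = (I * z%:E)%E.
  rewrite muleC /I /zs2 -zsZ//; last exact: nnm_zs.
  apply: zs_eq => a; rewrite /zs2.
  pose J := E1 (fun c => ((B a c)%:R)%:E); rewrite -/J.
  have J0 : (0 <= J)%E by apply: zs_ge0 => // c; rewrite lee_fin.
  have Jf : J \is a fin_num.
    rewrite ge0_fin_numE// (@le_lt_trans _ _ (1 * z)%:E) ?ltry//.
    rewrite -zs_cst//; apply: zs_le => // c.
    by rewrite lee_fin lern1 leq_b1.
  by rewrite -(fineK Jf) zs_cst ?fine_ge0// EFinM muleC.
have one : zs3 (fun _ _ _ => 1%E) = (z ^+ 3)%:E.
  transitivity (E1 (fun=> (1 * z * z)%:E)).
    apply: zs_eq => a; transitivity (E1 (fun=> (1 * z)%:E)).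
      by apply: zs_eq => b; rewrite zs_cst.
    by rewrite zs_cst// mulr_ge0.
  by rewrite zs_cst ?mulr_ge0// mul1r !exprS expr0 mulr1 mulrA.
have den : integral_E0 (@dice_density R f m.+1) = (z ^+ 3)%:E.
  rewrite -one -(integral_E0E (g := fun _ _ _ => 1))//.
  by congr integral_E0; apply/funext => a; apply/funext => b; apply/funext => c; rewrite mul1r.
set num := integral_E0 (fun a b c => (`[< A a b c >])%:R * dice_density f a b c).
have num_le : (num <= (z ^+ 3)%:E)%E.
  rewrite -one -(integral_E0E (g := fun _ _ _ => 1))//.
  by apply: le_integral_E0 => // a b c; rewrite lern1 leq_b1.
have num_ge : (zs3 (fun a b c => ((G a b c)%:R)%:E) <= num)%E.
  rewrite -integral_E0E//; apply: le_integral_E0 => // a b c.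
  rewrite ler_nat; case: (boolP (G a b c)) => // /and3P[ab bc ac].
  by rewrite (asboolT (BA _ _ _ ab bc ac)).
have total : ((z ^+ 3)%:E <= num + (I * z%:E + (I * z%:E + I * z%:E)))%E.
  apply: le_trans; last exact: leeD num_ge (lexx _).
  have nG := nnm_indic R mG; have nab := nnm_indic R mab.
  have nbc := nnm_indic R mbc; have nac := nnm_indic R mac.
  have nbcac := nnmD nbc nac; have nabc := nnmD nab nbcac.
  rewrite -{1}Iab -{1}Ibc -{1}Iac -one -!zs3D//.
  apply: zs3_le => // a b c; rewrite -!EFinD lee_fin -!natrD ler1n.
  by rewrite /G; case: (B a b); case: (B b c); case: (B a c).
have num0 : (0 <= num)%E.
  do 3 (apply: ti_ge0 => ?); rewrite lee_fin mulr_ge0//.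
  by rewrite !mulr_ge0//; exact: die_density_ge0.
have numf : num \is a fin_num by rewrite ge0_fin_numE// (le_lt_trans num_le) ?ltry.
have z30 : 0 < z ^+ 3 by rewrite exprn_gt0.
rewrite /Pr_E0 den -/num /=.
move: num_le total Bw; rewrite -(fineK numf) -/I -(fineK If) -!EFinM -!EFinD !lee_fin.
move=> h1 h2 h3; rewrite ler_pdivlMr// ler_pdivrMr// mul1r h1 andbT.
have : fine I * z <= w * z ^+ 2 * z by rewrite ler_wpM2r.
have -> : (1 - 3 * w) * z ^+ 3 = z ^+ 3 - 3 * (w * z ^+ 2 * z) by ring.
lra.
Qed.

End three_dice.

Section law_bounds.
Context {R : realType}.
Local Notation mu := (@lebesgue_measure R).
Context d (T : measurableType d) (P : probability T R) (X : {RV P >-> R}).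
Variables f F : R -> R.
Hypotheses (hf : has_density X f) (hF : forall x, cdf X x = (F x)%:E).
Hypotheses (hmean : ('E_P[X] = 0)%E) (hvar : ('V_P[X] = 1)%E).
Hypothesis hmoments : (X : T -> R) \in Lfun P 6%:E.
Hypothesis hsupp : is_interval (supp f).
Hypothesis hcont : {within supp f, continuous f}.
Hypothesis hunif : ~ forall A : set R, measurable A ->
  distribution P X A = uniform_prob (sqrt3_itv R) A.
Hypothesis hE0 : face_sum_density_bounded f.

Let mf : measurable_fun [set: R] f. Proof. by case: hf. Qed.
Let f0 x : 0 <= f x. Proof. by case: hf. Qed.
Let mF := measurable_cdf_F hF.
Let mres := measurable_residual hF.

Lemma residual_sum_moment_le (CV z : R) m : 0 <= CV -> 0 < z -> zmass f m = z%:E ->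
    (forall (rho : R -> R) (v B : R), measurable_fun setT rho -> 0 <= v ->
    (forall t : R, (\int[mu]_x ((f x)%:E * ((t + rho x) ^+ 2)%:E) =
      (t ^+ 2 + v)%:E)%E) ->
    (forall x, `|rho x| <= B) ->
    (zs f (fun a : die R m.+1 => ((\sum_(i < m.+1) rho (tnth a i)) ^+ 2)%:E) <=
    (CV * (m%:R * v + B ^+ 2))%:E * zmass f m)%E) ->
  (zs2 f (fun a b : die R m.+1 => (residual_sum F a b ^+ 2)%:E) <=
   (9 * (CV ^+ 2 + CV) * m.+1%:R ^+ 2 * z ^+ 2)%:E)%E.
Proof.
move=> CV0 z0 zE mom; have f1 := density_int1 hf.
pose n : R := m.+1%:R.
have n0 : 0 <= n by rewrite ler0n.
have mn : m%:R <= n by rewrite ler_nat.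
have z0' := ltW z0.
pose rho (a : m.+1.-tuple R) (y : R) : R := \sum_(i < m.+1) residual F y (tnth a i).
have mrho : measurable_fun setT (fun p : m.+1.-tuple R * R => rho p.1 p.2).
  apply: measurable_sum => i.
  apply: (measurableT_comp mres (g := fun p : m.+1.-tuple R * R => (p.2, tnth p.1 i))).
  apply: measurable_fun_pair => //.
  exact: (measurableT_comp (measurable_tnth i) measurable_fst).
have mrho1 a : measurable_fun setT (rho a).
  by apply: (measurableT_comp mrho (g := fun y => (a, y))); exact: measurable_fun_pair.
have rhoB a y : `|rho a y| <= 3 * n.
  apply: le_trans (ler_norm_sum _ _ _) _.
  apply: (@le_trans _ _ (\sum_(i < m.+1) 3)).
    by apply: ler_sum => i _; exact: residual_le hF _ _.
  by rewrite sumr_const card_ord [leRHS]mulr_natr.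
have nrho2 : nnm (fun p : m.+1.-tuple R * R => (f p.2)%:E * (rho p.1 p.2 ^+ 2)%:E)%E.
  apply: nnmM.
    by apply: nnm_EFin => //; exact: (measurableT_comp mf measurable_snd).
  by apply: nnm_EFin => [|p]; [exact: measurable_funX|exact: sqr_ge0].
have inner (a : die R m.+1) :
    (zs f (fun b : die R m.+1 => (residual_sum F a b ^+ 2)%:E) <=
     (CV * n * z)%:E * (\int[mu]_y ((f y)%:E * (rho a y ^+ 2)%:E)) +
     (CV * (9 * n ^+ 2) * z)%:E)%E.
  have crho : centered P (rho a \o X).
    apply: (@centered_sum _ _ _ _ _ _ (fun (i : 'I_m.+1) o => residual F (X o) (tnth a i))) => i.
    exact: (centered_residual hf hF).
  have [v v0 [vE v2]] := centered_second_moment hf (mrho1 a) (rhoB a) crho.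
  rewrite vE; apply: le_trans (_ : ((CV * (m%:R * v + (3 * n) ^+ 2))%:E * zmass f m <= _)%E).
    apply: le_trans (mom _ _ _ (mrho1 a) v0 v2 (rhoB a)); apply: zs_le => // b.
      by rewrite lee_fin sqr_ge0.
    rewrite lee_fin /residual_sum exchange_big -sqrrN -sumrN.
    rewrite (eq_bigr (fun j => rho a (tnth b j)))// => j _.
    by rewrite -sumrN; apply: eq_bigr => i _; rewrite -residualC.
  rewrite zE -!EFinM -EFinD lee_fin.
  have : CV * z * (m%:R * v) <= CV * z * (n * v).
    by rewrite ler_wpM2l ?mulr_ge0// ler_wpM2r.
  have -> : (3 * n) ^+ 2 = 9 * n ^+ 2 by ring.
  lra.
have nI : nnm (fun a : die R m.+1 => \int[mu]_y ((f y)%:E * (rho a y ^+ 2)%:E))%E.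
  exact: (nnm_int mu (g := fun (a : m.+1.-tuple R) y =>
    ((f y)%:E * (rho a y ^+ 2)%:E)%E) nrho2).
have c1 : 0 <= CV * n * z by rewrite !mulr_ge0.
have c2 : 0 <= CV * (9 * n ^+ 2) * z by rewrite !mulr_ge0// sqr_ge0.
apply: le_trans (_ : (zs f (fun a : die R m.+1 =>
    (CV * n * z)%:E * (\int[mu]_y ((f y)%:E * (rho a y ^+ 2)%:E)) +
    (CV * (9 * n ^+ 2) * z)%:E) <= _)%E).
  apply: zs_le => // a; apply: zs_ge0 => // b; rewrite lee_fin; exact: sqr_ge0.
have nc (k : R) : 0 <= k -> nnm (fun _ : m.+1.-tuple R => k%:E).
  by move=> k0; apply: nnm_EFin.
rewrite (zsD mf f0 (nnmM (nc _ c1) nI) (nc _ c2)).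
rewrite zsZ// (zs_cst mf f0 zE c2).
rewrite (zs_int_exchange mf f0 (H := fun a y => ((f y)%:E * (rho a y ^+ 2)%:E)%E) nrho2).
have Iy : (\int[mu]_y zs f (fun a : die R m.+1 => (f y)%:E * (rho a y ^+ 2)%:E) <=
    (CV * (9 * n) * z)%:E)%E.
  apply: le_trans (_ : (\int[mu]_y ((CV * (9 * n) * z)%:E * (f y)%:E) <= _)%E); last first.
    rewrite intZ ?f1 ?mule1//; last exact: nnm_EFin.
    by rewrite !mulr_ge0.
  apply: int_le => y.
    by apply: zs_ge0 => // a; rewrite -EFinM lee_fin mulr_ge0// sqr_ge0.
  rewrite zsZ//; last first.
    apply: nnm_EFin => [|a]; last exact: sqr_ge0.
    apply: measurable_funX.
    apply: (measurableT_comp mrho (g := fun a : m.+1.-tuple R => (a, y))).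
    exact: measurable_fun_pair.
  rewrite muleC; apply: lee_wpmul2r; first by rewrite lee_fin.
  have cy : centered P (residual F ^~ y \o X) by exact: (centered_residual hf hF).
  have my : measurable_fun setT (residual F ^~ y).
    by apply: (measurableT_comp mres (g := fun x : R => (x, y))); exact: measurable_fun_pair.
  have By x : `|residual F x y| <= 3 by exact: residual_le hF _ _.
  have [v v0 [vE v2]] := centered_second_moment hf my By cy.
  have v9 : v <= 9.
    rewrite -lee_fin -vE; apply: le_trans (_ : (\int[mu]_x (9%:E * (f x)%:E) <= _)%E); last first.
      by rewrite intZ ?f1 ?mule1//; exact: nnm_EFin.
    apply: int_le => x; first by rewrite mule_ge0 ?lee_fin ?sqr_ge0.
    rewrite muleC lee_wpmul2r ?lee_fin// -real_normK ?num_real//.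
    have -> : 9 = 3 ^+ 2 :> R by ring.
    by rewrite ler_pXn2r ?nnegrE.
  apply: le_trans (_ : ((CV * (m%:R * v + 3 ^+ 2))%:E * zmass f m <= _)%E).
    apply: le_trans (mom _ _ _ my v0 v2 By); apply: zs_le => // a.
      by rewrite lee_fin sqr_ge0.
    rewrite lee_fin -sqrrN -sumrN.
    by under eq_bigr do rewrite residualC opprK.
  rewrite zE -EFinM lee_fin ler_wpM2r// ler_wpM2l//.
  have : m%:R * v <= m%:R * 9 by rewrite ler_wpM2l.
  have -> : n = m%:R + 1 by rewrite /n natr1.
  lra.
apply: (@le_trans _ _ ((CV * n * z)%:E * (CV * (9 * n) * z)%:E + (CV * (9 * n ^+ 2) * z * z)%:E)%E).
  by apply: leeD => //; apply: lee_wpmul2l; rewrite ?lee_fin.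
rewrite -EFinM -EFinD lee_fin le_eqVlt; apply/orP; left; apply/eqP.
by rewrite -/n; ring.
Qed.

Lemma zs2_off_le : exists2 C : R, 0 <= C & forall K, 0 < K ->
  exists2 CK : R, 0 <= CK & exists N, forall m, (N <= m)%N ->
  exists z : R, [/\ 0 < z, zmass f m = z%:E &
    (zs2 f (fun a b : die R m.+1 => ((off F K a b)%:R)%:E) <=
     ((C / K ^+ 2 + CK / Num.sqrt m.+1%:R) * z ^+ 2)%:E)%E].
Proof.
have [al [be [c [h [eta [c0 h0 eta0 [fal fbe] flipF]]]]]] :=
  nonuniform_flip hf hF hmean hvar hmoments hsupp hcont hunif.
have f1 := density_int1 hf.
have f2 := face_second_moment hf hmean hvar hmoments.
have [m0 [M fM']] := hE0.
have fM y : (iter m0 (conv f) (phi0 f) y <= M%:E)%E.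
  by rewrite -[y]opprK -(face_sum_densityE mf f0).
have [CV CV0 [N1 N1P]] := zs_moment_le mf f0 f1 f2 c0 h0 fal fM.
have [c1 c10 [N2 N2P]] := zmass_ge mf f0 f1 f2 c0 h0 fal.
exists (9 * (CV ^+ 2 + CV) / 4) => [|K K0].
  by rewrite divr_ge0// mulr_ge0// addr_ge0// sqr_ge0.
have [CK CK0 [N3 N3P]] := zs_conc_le mf f0 f1 f2 c0 h0 fal fM mF eta0 fbe flipF K.
exists CK => //; exists (maxn (maxn N1 (4 * m0)) (maxn N2 N3)) => m.
rewrite !geq_max => /andP[/andP[/N1P mom mm0] /andP[/N2P mass /N3P cnc]].
have Zf := zmass_fin mf f0 f1 c0 h0 fal fM mm0.
have s0 : 0 < Num.sqrt m.+1%:R :> R by rewrite sqrtr_gt0 ltr0n.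
have z0 : 0 < fine (zmass f m).
  by rewrite -lte_fin fineK// (lt_le_trans _ mass)// lte_fin divr_gt0.
exists (fine (zmass f m)); split => //; first by rewrite fineK.
have zE : zmass f m = (fine (zmass f m))%:E by rewrite fineK.
move: (fine _) z0 zE => z z0 zE {Zf mass}.
have z0' := ltW z0.
pose n : R := m.+1%:R.
have n0 : 0 < n by rewrite ltr0n.
pose q : R := ((2 * n * K) ^+ 2)^-1.
have q0 : 0 <= q by rewrite invr_ge0 sqr_ge0.
pose ind (a b : die R m.+1) := `|cdf_sum F b - cdf_sum F a| <= K.
have nr : nnm (fun p : m.+1.-tuple R * m.+1.-tuple R => (residual_sum F p.1 p.2 ^+ 2)%:E).
  apply: nnm_EFin => [|p]; last exact: sqr_ge0.
  by apply: measurable_funX; exact: measurable_residual_sum.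
have nqr : nnm (fun p : m.+1.-tuple R * m.+1.-tuple R => q%:E * (residual_sum F p.1 p.2 ^+ 2)%:E)%E.
  apply: nnm_EFin => [|p]; last by rewrite mulr_ge0// sqr_ge0.
  by apply: measurable_funM => //; apply: measurable_funX; exact: measurable_residual_sum.
have nind : nnm (fun p : m.+1.-tuple R * m.+1.-tuple R => ((ind p.1 p.2)%:R)%:E : \bar R).
  apply: nnm_indic; apply: measurable_fun_ler => //.
  apply: measurableT_comp => //; apply: measurable_funB.
    exact: (measurableT_comp (@measurable_cdf_sum _ _ m.+1 mF) measurable_snd).
  exact: (measurableT_comp (@measurable_cdf_sum _ _ m.+1 mF) measurable_fst).
apply: le_trans (_ : (zs2 f (fun a b : die R m.+1 =>
    q%:E * (residual_sum F a b ^+ 2)%:E + ((ind a b)%:R)%:E) <= _)%E).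
  apply: zs2_le => // a b; rewrite -EFinM -EFinD lee_fin; exact: off_le.
rewrite (zs2D mf f0 nqr nind) zs2Z//.
apply: (@le_trans _ _ (q%:E * (9 * (CV ^+ 2 + CV) * n ^+ 2 * z ^+ 2)%:E +
    (CK / Num.sqrt m.+1%:R * z * z)%:E)%E).
  apply: leeD.
    apply: lee_wpmul2l; first by rewrite lee_fin.
    exact: residual_sum_moment_le CV0 z0 zE mom.
  have k0 : 0 <= CK / Num.sqrt m.+1%:R * z.
    by rewrite mulr_ge0// divr_ge0// ltW.
  rewrite -(zs_cst mf f0 zE k0); apply: zs_le => // a.
    by apply: zs_ge0 => // b; rewrite lee_fin.
  by have := cnc (cdf_sum F a); rewrite zE -EFinM.
rewrite -EFinM -EFinD lee_fin le_eqVlt; apply/orP; left; apply/eqP.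
rewrite /q; field.
by rewrite !gt_eqF.
Qed.

Lemma Pr_E0_cvg1 (A : forall m, die R m.+1 -> die R m.+1 -> die R m.+1 -> Prop) :
    (forall K m (a b c : die R m.+1), 0 < K ->
      ~~ off F K a b -> ~~ off F K b c -> ~~ off F K a c -> A m a b c) ->
  (fun m => Pr_E0 f (A m)) @ \oo --> (1 : R).
Proof.
move=> hA; have [C C0 CP] := zs2_off_le.
apply/cvgrPdist_le => e e0.
pose K := 1 + 6 * C / e.
have K1 : 1 <= K by rewrite lerDl divr_ge0 ?mulr_ge0// ltW.
have K0 : 0 < K by exact: lt_le_trans K1.
have [CK CK0 [N NP]] := CP K K0.
pose k := 6 * CK / e.
have k0 : 0 <= k by rewrite divr_ge0 ?mulr_ge0// ltW.
near=> m.
have [z [z0 zE Bz]] : exists z : R, [/\ 0 < z, zmass f m = z%:E &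
    (zs2 f (fun a b : die R m.+1 => ((off F K a b)%:R)%:E) <=
     ((C / K ^+ 2 + CK / Num.sqrt m.+1%:R) * z ^+ 2)%:E)%E].
  by apply: NP; near: m; exact: nbhs_infty_ge.
have mk : k ^+ 2 <= m%:R by near: m; exact: nbhs_infty_ger.
have s0 : 0 < Num.sqrt m.+1%:R :> R by rewrite sqrtr_gt0 ltr0n.
have ks : k <= Num.sqrt m.+1%:R.
  rewrite -[k]ger0_norm// -sqrtr_sqr ler_wsqrtr// (le_trans mk)//.
  by rewrite ler_nat.
have e6 : 0 <= e / 6 by rewrite divr_ge0// ltW.
have w1 : C / K ^+ 2 <= e / 6.
  rewrite ler_pdivrMr ?exprn_gt0//.
  have KK : K <= K ^+ 2 by rewrite expr2 ler_peMr// ltW.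
  have : e / 6 * (6 * C / e) <= e / 6 * K ^+ 2.
    by rewrite ler_wpM2l// (le_trans _ KK)// /K lerDr.
  have -> : e / 6 * (6 * C / e) = C by field; rewrite gt_eqF.
  by [].
have w2 : CK / Num.sqrt m.+1%:R <= e / 6.
  rewrite ler_pdivrMr//.
  have : e / 6 * k <= e / 6 * Num.sqrt m.+1%:R by rewrite ler_wpM2l.
  have -> : e / 6 * k = CK by rewrite /k; field; rewrite gt_eqF.
  by [].
have := Pr_E0_bounds mf f0 z0 zE (measurable_off _ mF mres) Bz
  (fun a b c => hA K m a b c K0).
rewrite ler_norml; move: (Pr_E0 f (A m)) => p /andP[p1 p2]; apply/andP; split; lra.
Unshelve. all: by end_near. Qed.

End law_bounds.

Theorem theorem1p1 (R : realType) (d : measure_display) (T : measurableType d)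
    (P : probability T R) (X : {RV P >-> R}) (f F : R -> R)
    (hf : has_density X f)
    (hF : forall x, cdf X x = (F x)%:E)
    (hmean : ('E_P[X] = 0)%E)
    (hvar : ('V_P[X] = 1)%E)
    (hmoments : (X : T -> R) \in Lfun P 6%:E)
    (hsupp : is_interval (supp f))
    (hcont : {within supp f, continuous f})
    (hunif : ~ forall A : set R, measurable A ->
       distribution P X A = uniform_prob (sqrt3_itv R) A)
    (hE0 : face_sum_density_bounded f) :
  (fun m => Pr_E0 f (fun a b c : die R m.+1 =>
     beats a b <-> \sum_(i < m.+1) F (tnth b i) < \sum_(i < m.+1) F (tnth a i)))
    @ \oo --> (1 : R)
  /\
  (fun m => Pr_E0 f (fun a b c : die R m.+1 =>
     transitive_dice [set a; b; c]))
    @ \oo --> (1 : R).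
Proof.
have cvg1 := Pr_E0_cvg1 hf hF hmean hvar hmoments hsupp hcont hunif hE0.
split.
- apply: (cvg1 (fun m a b c => beats a b <-> cdf_sum F b < cdf_sum F a)).
  by move=> K m a b c _ ab _ _; exact: beatsP ab.
- apply: (cvg1 (fun m a b c => transitive_dice [set a; b; c])).
  move=> K m a b c K0 ab bc ac; apply: (transitive_diceP (F := F) (K := K)) => //.
    have [ba cb ca] : [/\ ~~ off F K b a, ~~ off F K c b & ~~ off F K c a].
      by rewrite ![off F K _ a]offC [off F K c b]offC.
    by move=> x y [[]|] -> [[]|] -> xy.
  exact: ltW.
Qed.
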